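(* Assume (A1)–(A5) as stated in the context. Let $\widehat S_n(\lambda)=\{j:|\widehat\mu_j|\ge\lambda\}$ be the set selected by marginal regression on $\mathcal D_1$, where $\widehat\mu_j=n^{-1}\langle Y,X_{\bullet j}\rangle$. Let $k_n\to\infty$ with $k_n=o(\sqrt n)$, and let $\Lambda_n=\{\lambda:|\widehat S_n(\lambda)|\le k_n\}$. Let $\mu_j=\mathbb E(\widehat\mu_j)$, let $|\mu_{(1)}|\ge|\mu_{(2)}|\ge\cdots$ denote the values $\mu_j$ ordered by absolute value, and assume $$\min_{j\in D}|\mu_j|>|\mu_{(k_n)}|.$$ Let $\widehat S_n,\widehat D_n$ be the resulting multi-stage selectors defined in the context. Then: 1. $\mathbb P(D\subset\widehat S_n(\lambda_* ))\to1$, where $\lambda_*=\arg\min_{\lambda\in\Lambda_n}L(\lambda)$. 2. $\mathbb P(D\subset\widehat S_n(\widehat\lambda))\to1$, where $\widehat\lambda=\arg\min_{\lambda\in\Lambda_n}\widehat L(\lambda)$. 3. For fixed level $\alpha\in(0,1)$, $\limsup_{n\to\infty}\mathbb P(D^c\cap\widehat D_n\neq\varnothing)\le\alpha$. 4. If the level is $\alpha=\alpha_n$ with $\alpha_n\to0$ and $\sqrt n\,\alpha_n\to\infty$, then $\mathbb P(\widehat D_n=D)\to1$. 5. For fixed level $\alpha\in(0,1)$, $\liminf_{n\to\infty}\mathbb P(\widehat D_n\subset D\subset\widehat S_n)\ge1-\alpha$.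
   Context: **Model and standing assumptions.** We observe i.i.d. pairs $(X_i,Y_i)$ with $X_i=(X_{i1},\dots,X_{ip})^T\in\mathbb R^p$, where $p=p_n>n$ and $\beta\in\mathbb R^p$. There are $3n$ observations, split randomly into three groups $\mathcal D_1,\mathcal D_2,\mathcal D_3$ of size $n$ each. $D=\{j:\beta_j\neq0\}$, taken to be $\{1,\dots,s\}$; $S=\{1,\dots,p\}$; $D^c=S\setminus D$; $\psi=\min_{j\in D}|\beta_j|$. The symbol $\subset$ denotes non-strict inclusion. For an $n\times p$ design matrix $X$ (rows $X_i^T$ of one group) and $M\subset S$, $X_M$ is the submatrix of columns indexed by $M$, and $X_{\bullet j}$ is the $j$th column. For a square matrix $C$, $\phi(C)$ and $\Phi(C)$ are its smallest and largest eigenvalues, and $\phi_n(k)=\min_{|M|=k}\phi(\frac1nX_M^TX_M)$, $\Phi_n(k)=\max_{|M|=k}\Phi(\frac1nX_M^TX_M)$. (A1) $Y_i=X_i^T\beta+\varepsilon_i$ with $\varepsilon_i\sim N(0,\sigma^2)$ i.i.d., independent of the covariates. (A2) $p_n\to\infty$ and $p_n\le c_1e^{n^{c_2}}$ for some $c_1>0$, $0\le c_2<1$. (A3) $s=|D|=O(1)$ and $\psi>0$. (Only $p_n$ varies with $n$: $s$, the nonzero coefficients and $\sigma^2$ do not depend on $n$.) (A4) There are positive constants $C_0,C_1,\kappa$ with $\mathbb P(\limsup_{n\to\infty}\Phi_n(n)\le C_0)=1$ and $\mathbb P(\liminf_{n\to\infty}\phi_n(C_1\log n)\ge\kappa)=1$;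 also $\mathbb P(\phi_n(n)>0)=1$ for all $n$. (This is for the design matrix of each group.) (A5) $\mathbb E(X_{ij})=0$, $\mathbb E(X_{ij}^2)=1$, and for some $0<B<\infty$, $\mathbb P(|X_{jk}|\le B)=1$. **Screening (stage I, with $X,Y$ the design matrix and response vector of $\mathcal D_1$).** For each $\lambda$, $\widehat\beta(\lambda)$ is the least-squares estimator on $\mathcal D_1$ using only the covariates in $\widehat S_n(\lambda)$, extended by $0$ to a vector in $\mathbb R^p$. The true loss is $L(\lambda)=\frac1n(\widehat\beta(\lambda)-\beta)^TX^TX(\widehat\beta(\lambda)-\beta)$. **Cross-validation (stage II, data $\mathcal D_2$).** $\widehat L(\lambda)=\frac1n\sum_{i\in\mathcal D_2}(Y_i-X_i^T\widehat\beta(\lambda))^2$; $\widehat\lambda$ minimizes $\widehat L$ over $\Lambda_n$; $\widehat S_n=\widehat S_n(\widehat\lambda)$. **Cleaning (stage III, data $\mathcal D_3$).** Let $M=\widehat S_n$, $m=|\widehat S_n|$, and (now with $X,Y$ from $\mathcal D_3$) $\widehat\beta_M=(X_M^TX_M)^{-1}X_M^TY$. For $j\in M$, $T_j=\widehat\beta_{M,j}/\big(\widehat\sigma\sqrt{e_j^T(X_M^TX_M)^{-1}e_j}\big)$ is the usual $t$-statistic, where $e_j$ is the unit vector for coordinate $j$ and $\widehat\sigma^2$ is the usual residual variance estimate with $n-m$ degrees of freedom. For level $\alpha$, $\widehat D_n=\{j\in\widehat S_n:|T_j|>c_n\}$ with $c_n=z_{\alpha/(2m)}$, where $z_u$ is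 the upper $u$-quantile of $N(0,1)$: $\mathbb P(Z>z_u)=u$. *)

(* Defs.v *)
From HB Require Import structures.
From mathcomp Require Import all_boot all_order all_fingroup all_algebra.
From mathcomp Require Import all_classical all_reals all_analysis.

Set Implicit Arguments.
Unset Strict Implicit.
Unset Printing Implicit Defensive.

Import Order.TTheory GRing.Theory Num.Theory.
Import numFieldNormedType.Exports.

Local Open Scope classical_set_scope.
Local Open Scope ring_scope.

Definition same_law d d' (Omega : measurableType d) (R : realType)
    (P : probability Omega R) (T : measurableType d') (f g : Omega -> T) : Prop :=
  forall B : set T, measurable B -> P (f @^-1` B) = P (g @^-1` B).

Definition independent_pair d d1 d2 (Omega : measurableType d) (R : realType)
    (P : probability Omega R) (T1 : measurableType d1) (T2 : measurableType d2)
    (f : Omega -> T1) (g : Omega -> T2) : Prop :=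
  forall (A : set T1) (B : set T2), measurable A -> measurable B ->
    P (f @^-1` A `&` g @^-1` B) = (P (f @^-1` A) * P (g @^-1` B))%E.

Definition mutually_independent d d' (Omega : measurableType d) (R : realType)
    (P : probability Omega R) (T : measurableType d') (I : finType)
    (f : I -> Omega -> T) : Prop :=
  forall (J : {set I}) (B : I -> set T), (forall i, measurable (B i)) ->
    P (\bigcap_(i in [set i | i \in J]) (f i @^-1` B i)) =
    (\prod_(i in J) P (f i @^-1` B i))%E.

(* Upper u-quantile of N(0,1); it exists and is unique for 0 < u < 1, and has
   the default value 0 for the other u. *)
Definition normal_upper_quantile (R : realType) (u : R) : R :=
  xget 0 [set z : R | normal_prob 0 1 `]z, +oo[ = u%:E].

Definition submx_cols (R : realType) n p (X : 'M[R]_(n, p)) (M : {set 'I_p}) :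
    'M[R]_(n, #|M|) :=
  colsub (@enum_val _ (mem M)) X.

(* For the symmetric matrices of positive size below, the set of eigenvalues is
   finite and nonempty, so that inf and sup are a minimum and a maximum. *)
Definition eig_min (R : realType) r (C : 'M[R]_r) : R :=
  inf [set a | eigenvalue C a].

Definition eig_max (R : realType) r (C : 'M[R]_r) : R :=
  sup [set a | eigenvalue C a].

Definition gram (R : realType) n p (X : 'M[R]_(n, p)) (M : {set 'I_p}) :
    'M[R]_#|M| :=
  n%:R^-1 *: ((submx_cols X M)^T *m submx_cols X M).

(* phi_n(r) and Phi_n(r), again minimum and maximum over a finite set. *)
Definition sparse_eig_min (R : realType) n p (X : 'M[R]_(n, p)) (r : nat) : R :=
  inf [set eig_min (gram X M) | M in [set M : {set 'I_p} | #|M| = r]].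

Definition sparse_eig_max (R : realType) n p (X : 'M[R]_(n, p)) (r : nat) : R :=
  sup [set eig_max (gram X M) | M in [set M : {set 'I_p} | #|M| = r]].

(* invmx is total: this is the least-squares estimator when the columns of X
   indexed by M are linearly independent. *)
Definition ols (R : realType) n p (X : 'M[R]_(n, p)) (Y : 'cV[R]_n)
    (M : {set 'I_p}) : 'cV[R]_#|M| :=
  invmx ((submx_cols X M)^T *m submx_cols X M) *m ((submx_cols X M)^T *m Y).

(* [ols] extended by 0 outside M *)
Definition ols_ext (R : realType) n p (X : 'M[R]_(n, p)) (Y : 'cV[R]_n)
    (M : {set 'I_p}) : 'cV[R]_p :=
  \col_j \sum_(k < #|M| | enum_val k == j) ols X Y M k 0.

Definition marginal (R : realType) n p (X : 'M[R]_(n, p)) (Y : 'cV[R]_n)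
    (j : 'I_p) : R :=
  n%:R^-1 * \sum_(i < n) Y i 0 * X i j.

Definition screen (R : realType) n p (X : 'M[R]_(n, p)) (Y : 'cV[R]_n)
    (lambda : R) : {set 'I_p} :=
  [set j | lambda <= `|marginal X Y j|]%SET.

Definition screen_fit (R : realType) n p (X : 'M[R]_(n, p)) (Y : 'cV[R]_n)
    (lambda : R) : 'cV[R]_p :=
  ols_ext X Y (screen X Y lambda).

Definition admissible (R : realType) n p (X : 'M[R]_(n, p)) (Y : 'cV[R]_n)
    (k : nat) : set R :=
  [set lambda | (#|screen X Y lambda| <= k)%N].

Definition true_loss (R : realType) n p (X : 'M[R]_(n, p)) (Y : 'cV[R]_n)
    (beta : 'cV[R]_p) (lambda : R) : R :=
  n%:R^-1 * ((screen_fit X Y lambda - beta)^T *m X^T *m X *m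
             (screen_fit X Y lambda - beta)) 0 0.

(* Fit on (X1, Y1), evaluated on (X2, Y2). *)
Definition cv_loss (R : realType) n p (X1 : 'M[R]_(n, p)) (Y1 : 'cV[R]_n)
    (X2 : 'M[R]_(n, p)) (Y2 : 'cV[R]_n) (lambda : R) : R :=
  n%:R^-1 * \sum_(i < n) (Y2 i 0 - (X2 *m screen_fit X1 Y1 lambda) i 0) ^+ 2.

Definition minimizes (R : realType) (A : set R) (f : R -> R) (x : R) : Prop :=
  A x /\ forall y, A y -> f x <= f y.

Definition residual_variance (R : realType) n p (X : 'M[R]_(n, p))
    (Y : 'cV[R]_n) (M : {set 'I_p}) : R :=
  (n - #|M|)%:R^-1 *
  \sum_(i < n) ((Y - submx_cols X M *m ols X Y M) i 0) ^+ 2.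

(* k : 'I_#|M| stands for the covariate [enum_val k]. *)
Definition t_stat (R : realType) n p (X : 'M[R]_(n, p)) (Y : 'cV[R]_n)
    (M : {set 'I_p}) (k : 'I_#|M|) : R :=
  ols X Y M k 0 /
  (Num.sqrt (residual_variance X Y M) *
   Num.sqrt (invmx ((submx_cols X M)^T *m submx_cols X M) k k)).

Definition clean (R : realType) n p (X : 'M[R]_(n, p)) (Y : 'cV[R]_n)
    (M : {set 'I_p}) (alpha : R) : {set 'I_p} :=
  [set enum_val k | k : 'I_#|M| &
    normal_upper_quantile (alpha / (2 * #|M|%:R)) < `|t_stat X Y k| ]%SET.

(* [allocation] is the random permutation that splits the 3n observations into
   three groups: the i-th member of group g is the observation
   [allocation w (mxvec_index g i)], where [mxvec_index] is the library's
   bijection between 'I_3 * 'I_n and 'I_(3 * n). *)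
Record observations d (Omega : measurableType d) (R : realType)
    (P : probability Omega R) (n p : nat) := Observations {
  covar : 'I_(3 * n) -> {RV P >-> p.-tuple R} ;
  response : 'I_(3 * n) -> {RV P >-> R} ;
  noise : 'I_(3 * n) -> {RV P >-> R} ;
  allocation : Omega -> 'S_(3 * n)
}.

Definition group_screen : 'I_3 := @Ordinal 3 0 isT.
Definition group_validate : 'I_3 := @Ordinal 3 1 isT.
Definition group_clean : 'I_3 := @Ordinal 3 2 isT.

Definition group_member d (Omega : measurableType d) (R : realType)
    (P : probability Omega R) n p (o : observations P n p) (g : 'I_3)
    (w : Omega) (i : 'I_n) : 'I_(3 * n) :=
  allocation o w (mxvec_index g i).

Definition design d (Omega : measurableType d) (R : realType)
    (P : probability Omega R) n p (o : observations P n p) (g : 'I_3)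
    (w : Omega) : 'M[R]_(n, p) :=
  \matrix_(i, j) tnth (covar o (group_member o g w i) w) j.

Definition responses d (Omega : measurableType d) (R : realType)
    (P : probability Omega R) n p (o : observations P n p) (g : 'I_3)
    (w : Omega) : 'cV[R]_n :=
  \col_i response o (group_member o g w i) w.

Definition iid_observations d (Omega : measurableType d) (R : realType)
    (P : probability Omega R) n p (o : observations P n p) : Prop :=
  mutually_independent P (fun i w => (covar o i w, response o i w)) /\
  forall i i', same_law P (fun w => (covar o i w, response o i w))
                          (fun w => (covar o i' w, response o i' w)).

Definition random_split d (Omega : measurableType d) (R : realType)
    (P : probability Omega R) n p (o : observations P n p) : Prop :=
  forall pi : 'S_(3 * n),
    [/\ measurable (allocation o @^-1` [set pi]),
        P (allocation o @^-1` [set pi]) = (((3 * n)`!)%:R^-1)%:E &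
        forall B : set ((3 * n).-tuple (p.-tuple R * R)), measurable B ->
          let data w := [tuple (covar o i w, response o i w) | i < 3 * n] in
          P (allocation o @^-1` [set pi] `&` data @^-1` B) =
          (P (allocation o @^-1` [set pi]) * P (data @^-1` B))%E].

Definition linear_model d (Omega : measurableType d) (R : realType)
    (P : probability Omega R) n p (o : observations P n p)
    (beta : 'cV[R]_p) (sigma : R) : Prop :=
  [/\ forall i w, response o i w =
        \sum_(j < p) tnth (covar o i w) j * beta j 0 + noise o i w,
      forall i (B : set R), measurable B ->
        P (noise o i @^-1` B) = normal_prob 0 sigma B,
      mutually_independent P (fun i w => noise o i w) &
      independent_pair P (fun w => [tuple covar o i w | i < 3 * n])
                         (fun w => [tuple noise o i w | i < 3 * n])].

Definition bounded_standardized d (Omega : measurableType d) (R : realType)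
    (P : probability Omega R) n p (o : observations P n p) (B : R) : Prop :=
  forall i (j : 'I_p),
    [/\ ('E_P[fun w => tnth (covar o i w) j] = 0)%E,
        ('E_P[fun w => (tnth (covar o i w) j ^+ 2)%R] = 1)%E &
        {ae P, forall w, `|tnth (covar o i w) j| <= B}].

Definition first_coords (R : realType) p r (h : (r <= p)%N) (x : p.-tuple R) :
    r.-tuple R :=
  [tuple tnth x (widen_ord h j) | j < r].

(* Only the dimension varies with n: the distributions of the covariate
   vectors at sizes n and n' agree on the coordinates they share. The joint
   distribution of the data at different sizes is left arbitrary. *)
Definition consistent_covariates d (Omega : measurableType d) (R : realType)
    (P : probability Omega R) (p : nat -> nat)
    (o : forall n, observations P n (p n)) : Prop :=
  forall n n' (i : 'I_(3 * n)) (i' : 'I_(3 * n')) r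
      (h : (r <= p n)%N) (h' : (r <= p n')%N),
    same_law P (fun w => first_coords h (covar (o n) i w))
               (fun w => first_coords h' (covar (o n') i' w)).

(* C1 log n is rounded down to an integer. *)
Definition sparse_eigenvalues d (Omega : measurableType d) (R : realType)
    (P : probability Omega R) (p : nat -> nat)
    (o : forall n, observations P n (p n)) (C0 C1 kappa : R) : Prop :=
  forall g : 'I_3,
    [/\ {ae P, forall w,
          (limn_esup (fun n => (sparse_eig_max (design (o n) g w) n)%:E)
           <= C0%:E)%E},
        {ae P, forall w,
          (kappa%:E <= limn_einf (fun n =>
             (sparse_eig_min (design (o n) g w)
                (Num.truncn (C1 * ln n%:R)))%:E))%E} &
        forall n, (0 < n)%N ->
          {ae P, forall w, 0 < sparse_eig_min (design (o n) g w) n}].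

(* The coefficients are the first p terms of a fixed sequence. *)
Definition coef (R : realType) (beta : nat -> R) p : 'cV[R]_p :=
  \col_(j < p) beta j.

Definition active_set (R : realType) p (beta : 'cV[R]_p) : {set 'I_p} :=
  [set j | beta j 0 != 0]%SET.

(* min over j in D of |v_j|, equal to +oo when D is empty *)
Definition min_abs (R : realType) p (D : {set 'I_p}) (v : 'I_p -> R) : \bar R :=
  ereal_inf [set `|v j|%:E | j in [set j | j \in D]].

Definition mean_marginal d (Omega : measurableType d) (R : realType)
    (P : probability Omega R) n p (o : observations P n p) (j : 'I_p) : R :=
  fine ('E_P[fun w =>
    marginal (design o group_screen w) (responses o group_screen w) j])%E.

(* k-th largest of the |v_j|, for 1 <= k <= p *)
Definition order_stat_abs (R : realType) p (v : 'I_p -> R) (k : nat) : R :=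
  (sort >=%R [seq `|v j| | j : 'I_p])`_k.-1.

(* Main.v *)
Require Import Defs.
From HB Require Import structures.
From mathcomp Require Import all_boot all_order all_fingroup all_algebra.
From mathcomp Require Import all_classical all_reals all_analysis.
From mathcomp Require Import measurable_realfun zify ring lra.

Set Implicit Arguments.
Unset Strict Implicit.
Unset Printing Implicit Defensive.

Import Order.TTheory GRing.Theory Num.Theory.
Import numFieldNormedType.Exports.

Local Open Scope classical_set_scope.
Local Open Scope ring_scope.

(** By (A4) and the law of large numbers, kappa <= Sigma <= C0 for the
    covariance Sigma on finitely supported vectors. Hence the population
    marginals gam = Sigma beta are square summable and tend to 0, and the gap
    condition bounds |gam_j| away from 0 on D. Sets selected by thresholding
    are nested, so one that misses part of D lies in a fixed finite set of
    coordinates, where all empirical quantities concentrate: its loss is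
    bounded below, while a threshold below min_D |gam_j| has loss close
    to 0. In the cleaning stage, ties in cross-validation have probability 0,
    so the selected set is a function of the first two groups and is fixed
    when the third group is integrated out. The Gram matrix of that group is
    close to Sigma in Frobenius norm because k_n^2 = o(n); the Gaussian tail
    and a union bound give the level alpha, and the relative error n^{-1/4} of
    sigma-hat changes the tail at c_n = O(sqrt (log n)) only by a factor
    1 + o(1). *)

(** * Independence and random allocation *)

(** The lower bound in (A4) concerns sets of C1 log n columns, whereas a selected set may have k_n
    columns, possibly many more. Passing to Sigma removes this restriction: Sigma is the same at
    every n, so a single sample size and a single outcome where the empirical form is close to the
    population form bound the latter, for supports of any fixed size and hence for all vectors.
    Likewise the gap condition, read at one suitable n, gives gam_j <> 0 on D, and the finiteness of
    D makes this uniform. In the cleaning stage the Gram matrix is controlled through second moments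
    only, which do not survive a union over all candidate sets. This is why the selected set has to
    be frozen, and why cross-validation must have an almost surely unique optimal set. The random
    split is handled permutation by permutation: every permuted sample satisfies the same
    hypotheses, and a bound uniform over permutations passes to the allocated data. With x =
    n^(1/8), the relative error is x^-2 and the squared quantile is bounded crudely by 32 x, so that
    their product is O(1/x); this is all the tail comparison asks for. *)

Lemma exists_mfun d1 d2 (T1 : measurableType d1) (T2 : measurableType d2)
    (f : T1 -> T2) :
  measurable_fun setT f -> exists F : {mfun T1 >-> T2}, F = f :> (T1 -> T2).
Proof.
move=> mf; pose F : {mfun T1 >-> T2} :=
  HB.pack f (isMeasurableFun.Build _ _ _ _ f mf).
by exists F.
Qed.

Lemma measurable_preimage d1 d2 (T1 : measurableType d1)
    (T2 : measurableType d2) (f : T1 -> T2) (A : set T2) :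
  measurable_fun setT f -> measurable A -> measurable (f @^-1` A).
Proof. by move=> mf mA; rewrite -[X in measurable X]setTI; exact: mf. Qed.

Section independence.
Context d (Omega : measurableType d) (R : realType) (P : probability Omega R).

(** The joint law of f and g agrees with the product of their laws on rectangles, hence everywhere;
    Tonelli then separates the two outcomes. *)
Lemma indep_decouple d1 d2 (T1 : measurableType d1) (T2 : measurableType d2)
    (f : Omega -> T1) (g : Omega -> T2) (h : (T1 * T2)%type -> \bar R) :
  measurable_fun setT f -> measurable_fun setT g -> independent_pair P f g ->
  measurable_fun setT h -> (forall x, 0 <= h x)%E ->
  (\int[P]_w h (f w, g w) = \int[P]_w \int[P]_w' h (f w, g w'))%E.
Proof.
move=> mf mg ifg mh h0.
have mfg : measurable_fun setT (fun w => (f w, g w)) by exact/measurable_fun_pair.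
have [F FE] := exists_mfun mf; have [G GE] := exists_mfun mg.
have [FG FGE] := exists_mfun mfg.
subst f g.
have E : forall X, measurable X ->
    (distribution P F \x distribution P G)%E X = distribution P FG X.
  apply: product_measure_unique => A B mA mB.
  transitivity (P (FG @^-1` (A `*` B))) => //; rewrite FGE; exact: ifg.
transitivity (\int[distribution P FG]_y h y)%E.
  by rewrite ge0_integral_distribution//=; apply: eq_integral => w _ /=; rewrite FGE.
transitivity (\int[(distribution P F \x distribution P G)%E]_y h y)%E.
  by apply: eq_measure_integral => A mA _; apply/esym; exact: E.
rewrite fubini_tonelli1// ge0_integral_distribution//=.
- apply: eq_integral => w _ /=; rewrite /fubini_F ge0_integral_distribution//=.
  by apply: measurableT_comp => //; exact: measurable_fun_pair.
- exact: measurable_fun_fubini_tonelli_F.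
- by move=> y; exact: integral_ge0.
Qed.

Lemma indep_comp d1 d2 d3 d4 (T1 : measurableType d1) (T2 : measurableType d2)
    (T3 : measurableType d3) (T4 : measurableType d4)
    (f : Omega -> T1) (g : Omega -> T2) (u : T1 -> T3) (v : T2 -> T4) :
  measurable_fun setT u -> measurable_fun setT v -> independent_pair P f g ->
  independent_pair P (u \o f) (v \o g).
Proof.
move=> mu mv ifg A B mA mB.
by apply: (ifg (u @^-1` A) (v @^-1` B)); exact: measurable_preimage.
Qed.

Lemma indep_cst d1 d2 (T1 : measurableType d1) (T2 : measurableType d2)
    (t : T1) (g : Omega -> T2) :
  independent_pair P (cst t) g.
Proof.
move=> A B mA mB; have [At|At] := pselect (A t).
  rewrite (_ : cst t @^-1` A = setT) ?setTI ?probability_setT ?mul1e//.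
  by apply/seteqP; split.
rewrite (_ : cst t @^-1` A = set0) ?set0I ?measure0 ?mul0e//.
by apply/seteqP; split.
Qed.

(** For fixed B both sides are finite measures in A, so agreement on a generating pi-system that
    contains the whole space is enough. *)
Let indep_pi1 d1 d2 (T1 : measurableType d1) (T2 : measurableType d2)
    (G1 : set (set T1)) (f : Omega -> T1) (g : Omega -> T2) (B : set T2) :
  measurable_fun setT f -> measurable_fun setT g -> measurable B ->
  measurable = <<s G1 >> -> setI_closed G1 -> G1 setT ->
  (forall A, G1 A ->
    P (f @^-1` A `&` g @^-1` B) = (P (f @^-1` A) * P (g @^-1` B))%E) ->
  forall A, measurable A ->
    P (f @^-1` A `&` g @^-1` B) = (P (f @^-1` A) * P (g @^-1` B))%E.
Proof.
move=> mf mg mB G1E GI GT H A mA.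
have mgB : measurable (g @^-1` B) by exact: measurable_preimage.
have [F FE] := exists_mfun mf; subst f.
pose c : {nonneg R} := NngNum (fine_ge0 (measure_ge0 P (g @^-1` B))).
have cE : (c%:num)%:E = P (g @^-1` B) by rewrite /= fineK// fin_num_measure.
have := @measure_unique _ _ _ G1 (fun=> setT) G1E GI (fun=> GT) _
  (pushforward (mrestr P mgB) F) (mscale c (pushforward P F)) _ _ _ mA.
rewrite /= /pushforward/= /mrestr/mscale/= cE => ->//.
- by rewrite muleC.
- by rewrite bigcup_const//; exists 0%N.
- by move=> A' GA'; rewrite H// muleC.
- by move=> _; rewrite preimage_setT setTI (le_lt_trans (probability_le1 _ mgB))// ltry.
Qed.

(** The extension from generators is made in one factor at a time. *)
Lemma indep_pi d1 d2 (T1 : measurableType d1) (T2 : measurableType d2)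
    (G1 : set (set T1)) (G2 : set (set T2)) (f : Omega -> T1) (g : Omega -> T2) :
  measurable_fun setT f -> measurable_fun setT g ->
  measurable = <<s G1 >> -> setI_closed G1 -> G1 setT ->
  measurable = <<s G2 >> -> setI_closed G2 -> G2 setT ->
  (forall A B, G1 A -> G2 B ->
    P (f @^-1` A `&` g @^-1` B) = (P (f @^-1` A) * P (g @^-1` B))%E) ->
  independent_pair P f g.
Proof.
move=> mf mg G1E G1I G1T G2E G2I G2T H A B mA mB.
apply: (indep_pi1 mf mg mB G1E) => // A' GA'.
have mA' : measurable A' by rewrite G1E; exact: sub_sigma_algebra.
rewrite setIC muleC; apply: (indep_pi1 mg mf mA' G2E) => // B' GB'.
by rewrite setIC muleC; exact: H.
Qed.

End independence.

Section boxes.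
Context d (T : measurableType d) (n : nat).

Definition box (B : 'I_n -> set T) : set (n.-tuple T) :=
  [set t | forall i, B i (tnth t i)].

Definition boxes : set (set (n.-tuple T)) :=
  [set box B | B in [set B | forall i, measurable (B i)]].

Lemma boxE B : box B = \bigcap_(i in [set: 'I_n]) (@tnth n T ^~ i) @^-1` B i.
Proof. by apply/seteqP; split => t /= H i; [move=> _|]; exact: (H i). Qed.

Lemma measurable_box B : (forall i, measurable (B i)) -> measurable (box B).
Proof.
move=> mB; rewrite boxE; apply: fin_bigcap_measurable => // i _.
exact: (measurable_preimage (@measurable_tnth _ T _ i)).
Qed.

Lemma measurable_boxes : measurable = <<s boxes >>.
Proof.
apply/seteqP; split; last first.
  apply: smallest_sub; first exact: sigma_algebra_measurable.
  by move=> _ [B mB <-]; exact: measurable_box.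
apply: smallest_sub; first exact: smallest_sigma_algebra.
move=> A; rewrite -bigcup_seq => -[i _ [B mB <-]]; rewrite setTI.
apply: sub_sigma_algebra; exists (fun j => if j == i then B else setT) => [j|].
  by case: ifP.
by apply/seteqP; split => t /=; [move/(_ i); rewrite eqxx|
  move=> Bt j; case: eqP => // ->].
Qed.

Lemma boxes_setI : setI_closed boxes.
Proof.
move=> _ _ [A mA <-] [B mB <-]; exists (fun i => A i `&` B i) => [i|].
  exact: measurableI.
apply/seteqP; split => t /= H; first by split=> i; case: (H i).
by case: H => Ht1 Ht2 i; split; [exact: Ht1|exact: Ht2].
Qed.

Lemma boxes_setT : boxes setT.
Proof. by exists (fun=> setT) => //; apply/seteqP; split. Qed.

End boxes.

Section blocks.
Context {d d' : measure_display} (Omega : measurableType d) (R : realType) (P : probability Omega R).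
Context (T : measurableType d') (N : nat).

(** Resampling: a is the data, b an independent copy of it, and K the block of observations that is
    redrawn. *)
Definition splice (K : {set 'I_N}) (a b : N.-tuple T) : N.-tuple T :=
  [tuple if i \in K then tnth b i else tnth a i | i < N].

Lemma measurable_splice d0 (T0 : measurableType d0) K (u v : T0 -> N.-tuple T) :
  measurable_fun setT u -> measurable_fun setT v ->
  measurable_fun setT (fun x => splice K (u x) (v x)).
Proof.
move=> mu mv; apply/measurable_fun_tnthP => i.
rewrite (_ : _ \o _ = fun x =>
  if i \in K then tnth (v x) i else tnth (u x) i); last first.
  by apply/funext => ab /=; rewrite tnth_mktuple.
by case: (i \in K); [apply: (measurableT_comp (measurable_tnth i) mv)|
  apply: (measurableT_comp (measurable_tnth i) mu)].
Qed.

Variable f : 'I_N -> Omega -> T.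
Hypothesis mf : forall i, measurable_fun setT (f i).

Definition tup (w : Omega) : N.-tuple T := [tuple f i w | i < N].

Lemma measurable_tup : measurable_fun setT tup.
Proof.
apply/measurable_fun_tnthP => i.
by rewrite (_ : _ \o _ = f i)//; apply/funext => w /=; rewrite tnth_mktuple.
Qed.

(** Masking by [t0] outside K keeps all blocks in one tuple space, so that blocks with different
    index sets can be spliced together. *)
Definition block (t0 : T) (K : {set 'I_N}) w : N.-tuple T :=
  [tuple if i \in K then f i w else t0 | i < N].

Lemma measurable_block t0 K : measurable_fun setT (block t0 K).
Proof.
apply/measurable_fun_tnthP => i.
rewrite (_ : _ \o _ = if i \in K then f i else cst t0); last first.
  by apply/funext => w /=; rewrite tnth_mktuple; case: ifP.
by case: ifP.
Qed.

Let splice_mask t0 K w w' : splice K (block t0 (~: K)%SET w) (block t0 K w') =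
  splice K (tup w) (tup w').
Proof.
apply: eq_from_tnth => i; rewrite !tnth_mktuple finset.in_setC.
by case: (i \in K).
Qed.

Let splice_id K w : splice K (tup w) (tup w) = tup w.
Proof. by apply: eq_from_tnth => i; rewrite !tnth_mktuple if_same. Qed.

Let mask_box t0 (K : {set 'I_N}) (B : 'I_N -> set T) : (forall i, i \notin K -> B i t0) ->
  block t0 K @^-1` box B = \bigcap_(i in [set i | i \in K]) (f i @^-1` B i).
Proof.
move=> Bt0; apply/seteqP; split => w /= H i => [iK|].
  by have := H i; rewrite tnth_mktuple iK.
by rewrite tnth_mktuple; case: ifPn => [/H//|/Bt0].
Qed.

Let mask_box0 t0 (K : {set 'I_N}) (B : 'I_N -> set T) : ~ (forall i, i \notin K -> B i t0) ->
  block t0 K @^-1` box B = set0.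
Proof.
move=> nB; apply/seteqP; split => // w /= H; apply: nB => i iK.
by have := H i; rewrite tnth_mktuple (negbTE iK).
Qed.

Hypothesis indf : mutually_independent P f.

Lemma indep_block t0 (J K : {set 'I_N}) : (J :&: K)%SET = finset.set0 ->
  independent_pair P (block t0 J) (block t0 K).
Proof.
move=> JK; apply: (@indep_pi _ _ _ P _ _ _ _ (@boxes _ T N) (@boxes _ T N)) => //;
  try exact: measurable_boxes; try exact: boxes_setI; try exact: boxes_setT;
  try exact: measurable_block.
move=> _ _ [B mB <-] [C mC <-].
(* A box that excludes [t0] at a masked coordinate has empty preimage, and both sides vanish;
   otherwise the masked coordinates impose nothing. *)
have [HB|HB] := pselect (forall i, i \notin J -> B i t0); last first.
  by rewrite (mask_box0 HB) set0I measure0 mul0e.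
have [HC|HC] := pselect (forall i, i \notin K -> C i t0); last first.
  by rewrite (mask_box0 HC) setI0 measure0 mule0.
rewrite (mask_box HB) (mask_box HC).
pose D i := if i \in J then B i else C i.
have KJ i : i \in K -> (i \in J) = false.
  move=> iK; apply/negbTE/negP => iJ.
  by have := finset.in_set0 i; rewrite -JK finset.in_setI iJ iK.
have -> : \bigcap_(i in [set i | i \in J]) f i @^-1` B i `&`
    \bigcap_(i in [set i | i \in K]) f i @^-1` C i =
    \bigcap_(i in [set i | i \in (J :|: K)%SET]) f i @^-1` D i.
  apply/seteqP; split => w /=.
    move=> [H1 H2] i /=; rewrite /D finset.in_setU.
    by case: ifPn => [iJ _|_ /= iK]; [exact: H1|exact: H2].
  move=> H; split => i /= iJ; have := H i; rewrite /= /D finset.in_setU iJ ?orbT.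
    by apply.
  by rewrite KJ//; apply.
have mD i : measurable (D i) by rewrite /D; case: ifP.
rewrite !indf// (big_setID J)/=; congr (_ * _)%E.
  rewrite (_ : (_ :&: _)%SET = J); last first.
    by apply/setP => i; rewrite finset.in_setI finset.in_setU; case: (i \in J); rewrite ?andbF.
  apply: eq_bigr => i iJ.
  by rewrite /D iJ.
rewrite finset.setDUl finset.setDv finset.set0U.
have -> : (K :\: J = K)%SET by rewrite -[RHS](finset.setID K J) finset.setIC JK finset.set0U.
by apply: eq_bigr => i iK; rewrite /D KJ.
Qed.

(** The block in K is independent of the pair formed by X and the remaining coordinates, so it may
    be read off at a second outcome. X is room for further data independent of the tuple, later the
    covariates when the tuple is the noise. *)
Lemma resample_snd d3 (T3 : measurableType d3) (X : Omega -> T3)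
    (t0 : T) (K : {set 'I_N}) (h : (T3 * N.-tuple T)%type -> \bar R) :
  measurable_fun setT X -> independent_pair P X tup ->
  measurable_fun setT h -> (forall x, 0 <= h x)%E ->
  (\int[P]_w h (X w, tup w) =
   \int[P]_w \int[P]_w' h (X w, splice K (tup w) (tup w')))%E.
Proof.
move=> mX iX mh h0.
pose A w := (X w, block t0 (~: K)%SET w).
have mA : measurable_fun setT A.
  by apply/measurable_fun_pair => //; exact: measurable_block.
(* Rectangles suffice for X and the outer block; X is split off first, then the two blocks of the
   tuple are separated by [indep_block]. *)
have iA : independent_pair P A (block t0 K).
  apply: (indep_pi (G1 := [set A `*` B | A in measurable & B in measurable])
                   (G2 := measurable)) => //;
    try exact: measurable_block.
  - by rewrite measurable_prod_measurableType.
  - move=> _ _ [A1 mA1 [A2 mA2 <-]] [B1 mB1 [B2 mB2 <-]]; rewrite -setXI.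
    exists (A1 `&` B1); first exact: measurableI.
    by exists (A2 `&` B2) => //; exact: measurableI.
  - by exists setT => //; exists setT => //; rewrite setXTT.
  - by rewrite sigma_algebra_id//; exact: sigma_algebra_measurable.
  - by move=> ? ? ? ?; exact: measurableI.
  - move=> _ C [A1 mA1 [A2 mA2 <-]] mC.
    have mm : measurable_fun setT (fun t : N.-tuple T =>
        ([tuple if i \in (~: K)%SET then tnth t i else t0 | i < N],
         [tuple if i \in K then tnth t i else t0 | i < N])).
      apply/measurable_fun_pair; apply/measurable_fun_tnthP => i;
        [rewrite (_ : _ \o _ = fun t => if i \in (~: K)%SET then tnth t i else t0)|
         rewrite (_ : _ \o _ = fun t => if i \in K then tnth t i else t0)];
        try by apply/funext => t /=; rewrite tnth_mktuple.
        by case: (_ \in _) => //; exact: measurable_tnth.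
      by case: (_ \in _) => //; exact: measurable_tnth.
    have := indep_comp (@measurable_id _ _ setT) mm iX.
    rewrite (_ : _ \o tup = fun w => (block t0 (~: K)%SET w, block t0 K w));
      last first.
      by apply/funext => w /=; congr (_, _); apply: eq_from_tnth => i;
        rewrite !tnth_mktuple.
    move=> iXm.
    have iKK : independent_pair P (block t0 (~: K)%SET) (block t0 K).
      by apply: indep_block; rewrite finset.setIC finset.setICr.
    have E1 := iXm A1 (A2 `*` C) mA1 (measurableX mA2 mC).
    have E2 := iXm A1 (A2 `*` setT) mA1 (measurableX mA2 measurableT).
    have E3 := iKK A2 C mA2 mC.
    transitivity (P (X @^-1` A1 `&`
       (fun w => (block t0 (~: K)%SET w, block t0 K w)) @^-1` (A2 `*` C))).
      by congr (P _); apply/seteqP; split => w /=; rewrite /A/=; tauto.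
    rewrite E1.
    transitivity (P (X @^-1` A1) * (P (block t0 (~: K)%SET @^-1` A2) *
       P (block t0 K @^-1` C)))%E; first by rewrite -E3.
    rewrite muleA; congr (_ * _)%E.
    transitivity (P (X @^-1` A1 `&`
       (fun w => (block t0 (~: K)%SET w, block t0 K w)) @^-1` (A2 `*` setT))).
      rewrite E2; congr (_ * P _)%E.
      by apply/seteqP; split => w /=; tauto.
    by congr (P _); apply/seteqP; split => w /=; rewrite /A/=; tauto.
have mh' : measurable_fun setT (fun z : (T3 * N.-tuple T) * N.-tuple T =>
    h (z.1.1, splice K z.1.2 z.2)).
  apply: measurableT_comp => //; apply/measurable_fun_pair.
    exact: (measurableT_comp measurable_fst measurable_fst).
  apply: measurable_splice => //.
  exact: (measurableT_comp measurable_snd measurable_fst).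
have := indep_decouple mA (measurable_block t0 K) iA mh' (fun=> h0 _).
rewrite /A/=.
under eq_integral do rewrite splice_mask splice_id.
move=> ->; apply: eq_integral => w _; apply: eq_integral => w' _.
by rewrite splice_mask.
Qed.

(** A conditional bound that holds for almost every frozen outcome is inherited by the unconditional
    probability. *)
Lemma prob_resample_snd d3 (T3 : measurableType d3) (X : Omega -> T3)
    (t0 : T) (K : {set 'I_N}) (H : set (T3 * N.-tuple T)%type) (b : \bar R) :
  measurable_fun setT X -> independent_pair P X tup -> measurable H ->
  (0 <= b)%E ->
  {ae P, forall w,
    (P [set w' | H (X w, splice K (tup w) (tup w'))] <= b)%E} ->
  (P [set w | H (X w, tup w)] <= b)%E.
Proof.
move=> mX iX mH b0 aeb.
have mXt : measurable_fun setT (fun w => (X w, tup w)).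
  by apply/measurable_fun_pair => //; exact: measurable_tup.
have mh : measurable_fun setT (EFin \o (\1_H : _ -> R)).
  by apply/measurable_EFinP; exact: measurable_indic.
have h0 x : (0 <= (EFin \o (\1_H : _ -> R)) x)%E by rewrite lee_fin.
have := resample_snd t0 K mX iX mh h0.
have -> : (\int[P]_w (EFin \o (\1_H : _ -> R)) (X w, tup w))%E =
    P [set w | H (X w, tup w)].
  have mE : measurable [set w | H (X w, tup w)].
    exact: (measurable_preimage mXt mH).
  rewrite -[in RHS](setIT [set w | _]) -integral_indic//.
move=> ->.
have Ein w : (\int[P]_w' (EFin \o (\1_H : _ -> R))
    (X w, splice K (tup w) (tup w')) =
    P [set w' | H (X w, splice K (tup w) (tup w'))])%E.
  have mE : measurable [set w' | H (X w, splice K (tup w) (tup w'))].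
    apply: (measurable_preimage (f := fun w' => (X w, splice K (tup w) (tup w'))) _ mH).
    apply/measurable_fun_pair => //; apply: measurable_splice => //.
    exact: measurable_tup.
  by rewrite -[in RHS](setIT [set w | _]) -integral_indic.
under eq_integral do rewrite Ein.
have mP : measurable_fun setT
    (fun w => P [set w' | H (X w, splice K (tup w) (tup w'))]).
  under eq_fun do rewrite -Ein.
  apply: (measurable_fun_fubini_tonelli_F (fun ww : Omega * Omega =>
    (EFin \o (\1_H : _ -> R)) (X ww.1, splice K (tup ww.1) (tup ww.2)))) => //.
  apply: (measurableT_comp mh); apply/measurable_fun_pair.
    exact: measurableT_comp.
  by apply: measurable_splice; apply: measurableT_comp => //; exact: measurable_tup.
apply: (@le_trans _ _ (\int[P]_w b)%E); last first.
  by rewrite integral_cst// [X in (_ * X)%E]probability_setT mule1.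
apply: ae_ge0_le_integral => //.
by move: aeb; apply: filterS => w Hw _.
Qed.

Lemma prob_resample (t0 : T) (K : {set 'I_N}) (H : set (N.-tuple T))
    (b : \bar R) :
  measurable H -> (0 <= b)%E ->
  {ae P, forall w, (P [set w' | H (splice K (tup w) (tup w'))] <= b)%E} ->
  (P [set w | H (tup w)] <= b)%E.
Proof.
move=> mH b0 aeb.
have := @prob_resample_snd _ unit (cst tt) t0 K (snd @^-1` H) b.
apply => //; last exact: measurable_preimage.
exact: indep_cst.
Qed.

(** Induction on the index list: resampling the single index i pulls its factor out of the
    integral. *)
Lemma expectation_prod (r : seq 'I_N) (g : T -> R) (t0 : T) :
  uniq r -> measurable_fun setT g -> (forall t, 0 <= g t) ->
  (\int[P]_w (\prod_(i <- r) g (f i w))%:E =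
   \prod_(i <- r) \int[P]_w (g (f i w))%:E)%E.
Proof.
move=> + mg g0; elim: r => [_|i r IH /= /andP[ir ur]].
  under eq_integral do rewrite big_nil.
  by rewrite integral_cst// [X in (_ * X)%E]probability_setT mule1 big_nil.
have mtg j : measurable_fun setT (fun t : N.-tuple T => g (tnth t j)).
  by apply: measurableT_comp => //; exact: measurable_tnth.
have mprod : measurable_fun setT
    (fun t : N.-tuple T => \prod_(j <- r) g (tnth t j)).
  by apply: measurable_prod => j _.
have := @resample_snd _ unit (cst tt) t0 [set i]%SET (fun t =>
  (g (tnth t.2 i) * \prod_(j <- r) g (tnth t.2 j))%:E).
rewrite /=.
under eq_integral do rewrite tnth_mktuple.
have E w : \prod_(j <- r) g (tnth (tup w) j) = \prod_(j <- r) g (f j w).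
  by apply: eq_bigr => j _; rewrite tnth_mktuple.
under eq_integral do rewrite E.
move=> H; rewrite big_cons -IH//.
transitivity (\int[P]_w (g (f i w) * \prod_(j <- r) g (f j w))%:E)%E.
  by apply: eq_integral => w _; rewrite big_cons.
rewrite H => //.
- transitivity (\int[P]_w ((\prod_(j <- r) g (f j w))%:E *
      \int[P]_w' (g (f i w'))%:E))%E.
    apply: eq_integral => w _; rewrite -ge0_integralZl//.
    + apply: eq_integral => w' _; rewrite -EFinM mulrC; congr (_ * _)%:E.
        apply: eq_big_seq => j jr; rewrite !tnth_mktuple finset.in_set1.
        by case: eqP => // ji; rewrite ji (negbTE ir) in jr.
      by rewrite !tnth_mktuple finset.in_set1 eqxx.
    + by apply/measurable_EFinP; exact: measurableT_comp.
    + by move=> w' _; rewrite lee_fin.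
    + by rewrite lee_fin prodr_ge0.
  rewrite ge0_integralZr//.
  + by rewrite muleC.
  + apply/measurable_EFinP; apply: measurable_prod => j _.
    exact: measurableT_comp.
  + by move=> w _; rewrite lee_fin prodr_ge0.
  + by apply: integral_ge0 => w _; rewrite lee_fin.
- exact: indep_cst.
- apply/measurable_EFinP; apply: (measurableT_comp
    (f := fun t : N.-tuple T => g (tnth t i) * \prod_(j <- r) g (tnth t j)));
    last exact: measurable_snd.
  exact: measurable_funM.
- by move=> x; rewrite lee_fin mulr_ge0// prodr_ge0.
Qed.

End blocks.

Section allocation.
Context {d : measure_display} (Omega : measurableType d) (R : realType)
  (P : probability Omega R).

Lemma prob_le_sum (I : finType) (A : set Omega) (F : I -> set Omega) :
  measurable A -> (forall i, measurable (F i)) ->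
  (forall w, A w -> exists i, F i w) -> (P A <= \sum_i P (F i))%E.
Proof.
move=> mA mF AF.
have mU (s : seq I) : measurable (\big[setU/set0]_(i <- s) F i).
  by apply: bigsetU_measurable => i _.
apply: (@le_trans _ _ (P (\big[setU/set0]_(i <- index_enum I) F i))).
  apply: le_measure; rewrite ?inE// => w /AF[i Fi].
  by rewrite -bigcup_seq; exists i => //=; exact: mem_index_enum.
elim: (index_enum I) => [|i s IH]; first by rewrite !big_nil measure0.
rewrite !big_cons (le_trans (measureU2 _ _ _))//.
by rewrite leeD2l.
Qed.

Variables (n p : nat) (o : observations P n p).
Hypothesis split : random_split o.

Let data (a : 'I_(3 * n) -> 'I_(3 * n)) w : (3 * n).-tuple (p.-tuple R * R) :=
  [tuple (covar o (a i) w, response o (a i) w) | i < 3 * n].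

Lemma measurable_data a : measurable_fun setT (data a).
Proof.
apply/measurable_fun_tnthP => i.
rewrite (_ : _ \o _ = fun w => (covar o (a i) w, response o (a i) w)).
  by apply/measurable_fun_pair; exact: measurable_funPT.
by apply/funext => w /=; rewrite tnth_mktuple.
Qed.

(** The allocation is uniform and independent of the data, so the probability on the left is an
    average over permutations. Measurability is part of the conclusion, because the event is a
    finite union over the values of the allocation. *)
Lemma alloc_le (H : set ((3 * n).-tuple (p.-tuple R * R))) (b : R) :
  measurable H -> 0 <= b ->
  (forall pi : 'S_(3 * n), P [set w | H (data pi w)] <= b%:E)%E ->
  measurable [set w | H (data (allocation o w) w)] /\
  (P [set w | H (data (allocation o w) w)] <= b%:E)%E.
Proof.
move=> mH b0 Hb.
pose F (pi : 'S_(3 * n)) := allocation o @^-1` [set pi] `&` [set w | H (data pi w)].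
have mF pi : measurable (F pi).
  apply: measurableI; first by have [] := split pi.
  exact: (measurable_preimage (measurable_data pi) mH).
have E : [set w | H (data (allocation o w) w)] = \bigcup_pi F pi.
  apply/seteqP; split => w /=; first by move=> ?; exists (allocation o w).
  by move=> [pi _ [/= ->]].
have mE : measurable [set w | H (data (allocation o w) w)].
  by rewrite E; apply: fin_bigcup_measurable => //; exact: finite_finset.
split=> //.
apply: (le_trans (prob_le_sum mE mF _)).
  by rewrite E => w [pi _ Fw]; exists pi.
have le1 pi : (P (F pi) <= (((3 * n)`!)%:R^-1 * b)%:E)%E.
  have [mA PA ind] := split pi.
  pose shuffle t : (3 * n).-tuple (p.-tuple R * R) :=
    [tuple tnth t (pi i) | i < 3 * n].
  have mS : measurable_fun setT shuffle.
    apply/measurable_fun_tnthP => i.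
    rewrite (_ : _ \o _ = (fun t => tnth t (pi i))); first exact: measurable_tnth.
    by apply/funext => t /=; rewrite tnth_mktuple.
  have := ind (shuffle @^-1` H) (measurable_preimage mS mH).
  rewrite /= PA.
  have <- : [set w | H (data pi w)] = (fun w =>
      [tuple (covar o i w, response o i w) | i < 3 * n]) @^-1` (shuffle @^-1` H).
    have Es w : shuffle [tuple (covar o i w, response o i w) | i < 3 * n] =
        data pi w by apply: eq_from_tnth => i; rewrite !tnth_mktuple.
    by apply/seteqP; split => w /=; rewrite Es.
  rewrite /F => ->; rewrite EFinM; apply: lee_wpmul2l; last exact: Hb.
  by rewrite lee_fin invr_ge0.
apply: (@le_trans _ _ (\sum_(pi : 'S_(3 * n)) (((3 * n)`!)%:R^-1 * b)%:E)%E).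
  by apply: lee_sum => pi _.
by rewrite sumEFin lee_fin sumr_const card_Sn -[leLHS]mulr_natl mulrA divff ?mul1r.
Qed.

End allocation.

(** * Normal variables and Gaussian tails *)

Section affine_change.
Context {R : realType}.
Notation mu := (@lebesgue_measure R).

Lemma measurable_affine (a c : R) : measurable_fun setT (fun x : R => a * x + c).
Proof. by apply: measurable_funD => //; exact: measurable_funM. Qed.

(** The rescaled image measure and Lebesgue measure agree on half-open intervals; for a < 0 the
    preimage is closed on the other side, which does not change its length. *)
Lemma lebesgue_measure_affine (a c : R) (A : set R) : a != 0 -> measurable A ->
  mu A = (`|a|%:E * mu ((fun x => (a * x + c)%R) @^-1` A))%E.
Proof.
move=> a0 mA.
have mF : @measurable_fun _ _ (measurableTypeR R) (measurableTypeR R) setT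
  (fun x => a * x + c) := measurable_affine a c.
have [F FE] := exists_mfun mF.
have -> : mu ((fun x => a * x + c) @^-1` A) = pushforward mu F A.
  by rewrite /pushforward FE.
have := @lebesgue_measure_unique R (mscale (NngNum (normr_ge0 a))
  (pushforward mu F)) _ A mA.
move=> -> // _ [[u v]] _ <-.
transitivity (`|a|%:E * mu (F @^-1` `]u, v]))%E => //; rewrite FE /=.
have [a_gt0|a_lt0] := ltP 0 a.
  have -> : (fun x => a * x + c) @^-1` `]u, v] = `](u - c) / a, (v - c) / a]%classic.
    apply/seteqP; split => x /=; rewrite !in_itv/= ltr_pdivrMr// ler_pdivlMr//;
      by rewrite mulrC ltrBlDr lerBrDr.
  rewrite !lebesgue_measure_itv/= !lte_fin ltr_pM2r ?invr_gt0// ltrD2r.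
  case: ifP => _; last by rewrite mule0.
  by rewrite -!EFinD -EFinM gtr0_norm//; congr (_%:E); field.
have {}a_lt0 : a < 0 by rewrite lt_neqAle a0.
have -> : (fun x => a * x + c) @^-1` `]u, v] = `[(v - c) / a, (u - c) / a[%classic.
  apply/seteqP; split => x /=; rewrite !in_itv/= ltr_ndivlMr// ler_ndivrMr//;
    by rewrite ![_ * a]mulrC ltrBlDr lerBrDr andbC.
rewrite !lebesgue_measure_itv/= !lte_fin ltr_nM2r ?invr_lt0// ltrD2r.
case: ifP => _; last by rewrite mule0.
by rewrite -!EFinD -EFinM ltr0_norm//; congr (_%:E); field.
Qed.

Lemma ge0_integral_affine (a c : R) (f : R -> \bar R) : a != 0 ->
  measurable_fun setT f -> (forall x, 0 <= f x)%E ->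
  (\int[mu]_x f x = `|a|%:E * \int[mu]_x f (a * x + c)%R)%E.
Proof.
move=> a0 mf f0.
have mF : @measurable_fun _ _ (measurableTypeR R) (measurableTypeR R) setT
  (fun x => a * x + c) := measurable_affine a c.
have [F FE] := exists_mfun mF.
pose nu0 m : {measure set (measurableTypeR R) -> \bar R} :=
  @mscale _ _ _ (NngNum (normr_ge0 a))
    (measure_function_pushforward__canonical__measure_function_Measure mu m).
pose nu := nu0 _ (measurable_funPT F).
transitivity (\int[nu]_x f x)%E.
  apply: eq_measure_integral => A mA _.
  transitivity (`|a|%:E * mu (F @^-1` A))%E => //; rewrite FE.
  exact: lebesgue_measure_affine.
rewrite ge0_integral_mscale//= ge0_integral_pushforward//.
by congr (_ * _)%E; apply: eq_integral => x _ /=; rewrite FE.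
Qed.

End affine_change.

(** Equality of the radicands of the normalising constants in the Gaussian convolution formula, with
    q in the place of pi. *)
Lemma peak_identity (R : realType) (a b c q : R) : 0 < c ->
  a ^+ 2 * q *+ 2 * (b ^+ 2 * q *+ 2) =
  c ^+ 2 * q *+ 2 * ((a * b / c) ^+ 2 * q *+ 2).
Proof. by move=> c0; field; rewrite gt_eqF. Qed.

Section normal_law.
Context {R : realType}.
Notation mu := (@lebesgue_measure R).

(** The Radon-Nikodym derivative of the normal law is almost everywhere its density, by uniqueness
    of the derivative. *)
Lemma ge0_integral_normal_prob (m s : R) (f : R -> \bar R) :
  measurable_fun setT f -> (forall x, 0 <= f x)%E ->
  (\int[normal_prob m s]_x f x = \int[mu]_x (f x * (normal_pdf m s x)%:E))%E.
Proof.
move=> mf f0.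
have dom := normal_prob_dominates m s.
rewrite -(@Radon_Nikodym_SigmaFinite.change_of_variables _ _ _ (normal_prob m s) mu dom)//.
have iRN := Radon_Nikodym_SigmaFinite.f_integrable dom.
apply: ae_eq_integral => //.
- by apply: emeasurable_funM => //; exact: (measurable_int mu).
- apply: emeasurable_funM => //; apply/measurable_EFinP.
  exact: measurable_normal_pdf.
- apply: ae_eqe_mul2l => /=.
  apply: integral_ae_eq => //=.
  + by apply/measurable_EFinP; exact: measurable_normal_pdf.
  + by move=> E ET mE; rewrite -Radon_Nikodym_SigmaFinite.f_integral.
Qed.

Lemma normal_prob_indic (m s : R) (A : set R) : measurable A ->
  normal_prob m s A = (\int[mu]_x ((\1_A x)%:E * (normal_pdf m s x)%:E))%E.
Proof.
move=> mA; rewrite -ge0_integral_normal_prob//.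
- by rewrite integral_indic// setIT.
- by apply/measurable_EFinP; exact: measurable_indic.
Qed.

Lemma normal_pdf_scale (a s x : R) : a != 0 -> s != 0 ->
  `|a| * normal_pdf 0 (`|a| * s) (a * x) = normal_pdf 0 s x.
Proof.
move=> a0 s0; have na0 : `|a| != 0 by rewrite normr_eq0.
rewrite !normal_pdfE ?mulf_neq0// mulrA; congr (_ * _).
  rewrite /normal_peak exprMn -mulrA -mulrnAr [in LHS]sqrtrM ?sqr_ge0//.
  by rewrite sqrtr_sqr normr_id invfM mulrA mulfV// mul1r.
rewrite /normal_fun; congr expR; rewrite !subr0 !exprMn real_normK ?num_real//.
have := s0; have := a0; move: (s) (a) => s' a' a0' s0'.
by field; rewrite a0' s0'.
Qed.

(** Completing the square in x: the first factor on the right is free of x, and the second is a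
    density in x and integrates to 1. *)
Lemma normal_pdf_convolution (s1 s2 x z : R) : 0 < s1 -> 0 < s2 ->
  let S : R := Num.sqrt (s1 ^+ 2 + s2 ^+ 2) in
  normal_pdf 0 s1 x * normal_pdf 0 s2 (z - x) =
  normal_pdf 0 S z * normal_pdf (z * s1 ^+ 2 / S ^+ 2) (s1 * s2 / S) x.
Proof.
move=> s10 s20 S.
have q0 : 0 < s1 ^+ 2 + s2 ^+ 2 by rewrite addr_gt0// exprn_gt0.
have S0 : 0 < S by rewrite sqrtr_gt0.
have SE : S ^+ 2 = s1 ^+ 2 + s2 ^+ 2 by rewrite sqr_sqrtr// ltW.
clearbody S; rewrite !normal_pdfE ?gt_eqF ?divr_gt0 ?mulr_gt0//.
rewrite [LHS]mulrACA [RHS]mulrACA; congr (_ * _).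
  rewrite /normal_peak -!invfM -!sqrtrM; last 2 first.
    by rewrite mulrn_wge0// mulr_ge0 ?sqr_ge0// pi_ge0.
    by rewrite mulrn_wge0// mulr_ge0 ?sqr_ge0// pi_ge0.
  by rewrite (peak_identity _ _ _ S0).
rewrite /normal_fun -!expRD; congr expR.
rewrite !expr_div_n !SE subr0.
by field; rewrite !gt_eqF//=.
Qed.


(** Tilting N(0, s^2) by the exponential of a square gives a multiple of N(0, t^2). Both the
    exponential moments of squares and the Gaussian tail bound follow from this identity without
    computing an integral. *)
Lemma normal_pdf_exp_sq (s t x : R) : 0 < s -> 0 < t ->
  expR ((s ^- 2 - t ^- 2) / 2 * x ^+ 2) * normal_pdf 0 s x =
  t / s * normal_pdf 0 t x.
Proof.
move=> s0 t0; rewrite !normal_pdfE ?gt_eqF//.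
have peakE u : 0 < u -> normal_peak u = (u * Num.sqrt (pi *+ 2))^-1 :> R.
  move=> u0; rewrite /normal_peak -mulrnAr sqrtrM ?sqr_ge0//.
  by rewrite sqrtr_sqr gtr0_norm.
rewrite !peakE//.
have p0 : 0 < Num.sqrt (pi *+ 2) :> R by rewrite sqrtr_gt0 mulrn_wgt0// pi_gt0.
rewrite [LHS]mulrC -[LHS]mulrA -expRD [RHS]mulrA; congr (_ * _).
  by move: (Num.sqrt _) p0 => q q0; field; rewrite !gt_eqF.
congr expR; rewrite subr0; field; by rewrite !gt_eqF.
Qed.

Definition is_normal d (Omega : measurableType d) (P : probability Omega R)
    (e : Omega -> R) (s : R) :=
  forall B : set R, measurable B -> P (e @^-1` B) = normal_prob 0 s B.

Section random_normal.
Context d (Omega : measurableType d) (P : probability Omega R).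

Lemma ge0_expect_normal (e : Omega -> R) (s : R) (f : R -> \bar R) :
  measurable_fun setT e -> is_normal P e s ->
  measurable_fun setT f -> (forall x, 0 <= f x)%E ->
  (\int[P]_w f (e w) = \int[mu]_x (f x * (normal_pdf 0 s x)%:E))%E.
Proof.
move=> me ne mf f0.
have me' : @measurable_fun _ _ Omega (measurableTypeR R) setT e := me.
have [F FE] := exists_mfun me'; subst e.
transitivity (\int[distribution P F]_y f y)%E.
  by rewrite ge0_integral_distribution.
rewrite -(ge0_integral_normal_prob 0 s mf f0).
by apply: eq_measure_integral => A mA _; exact: ne.
Qed.

Lemma is_normal_scale (e : Omega -> R) (s a : R) :
  measurable_fun setT e -> is_normal P e s -> a != 0 -> s != 0 ->
  is_normal P (fun w => a * e w) (`|a| * s).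
Proof.
move=> me ne a0 s0 A mA.
have mae : measurable_fun setT (fun x => a * x) by exact: measurable_funM.
have mA' : measurable ((fun x : R => a * x) @^-1` A) by exact: measurable_preimage.
have -> : (fun w => a * e w) @^-1` A = e @^-1` ((fun x => a * x) @^-1` A) by [].
rewrite (ne _ mA') (normal_prob_indic _ _ mA').
pose g z := ((\1_A z)%:E * (normal_pdf 0 (`|a| * s) z)%:E)%E.
have mg : measurable_fun setT g.
  apply: emeasurable_funM; apply/measurable_EFinP.
    exact: measurable_indic.
  exact: measurable_normal_pdf.
have g0 z : (0 <= g z)%E by rewrite mule_ge0// lee_fin// normal_pdf_ge0.
rewrite (normal_prob_indic _ _ mA).
have -> := ge0_integral_affine 0 a0 mg g0.
rewrite -ge0_integralZl//; last by apply: (measurableT_comp mg); exact: measurable_affine.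
rewrite /g.
apply: eq_integral => x _; rewrite addr0 muleCA -EFinM.
by rewrite -(normal_pdf_scale x a0 s0).
Qed.

Lemma is_normal_add (e1 e2 : Omega -> R) (s1 s2 : R) :
  measurable_fun setT e1 -> measurable_fun setT e2 ->
  independent_pair P e1 e2 -> 0 < s1 -> 0 < s2 ->
  is_normal P e1 s1 -> is_normal P e2 s2 ->
  is_normal P (fun w => e1 w + e2 w) (Num.sqrt (s1 ^+ 2 + s2 ^+ 2)).
Proof.
move=> me1 me2 ind s10 s20 n1 n2 A mA.
pose S := Num.sqrt (s1 ^+ 2 + s2 ^+ 2).
have madd : measurable_fun setT (fun xy : R * R => xy.1 + xy.2).
  exact: measurable_funD.
have mind : measurable_fun setT (fun xy : R * R => (\1_A (xy.1 + xy.2) : R)).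
  by apply: (measurableT_comp (f := (\1_A : R -> R))) => //; exact: measurable_indic.
have -> : P ((fun w => e1 w + e2 w) @^-1` A) =
    (\int[P]_w (\1_A (e1 w + e2 w))%:E)%E.
  rewrite -[in LHS](setIT (_ @^-1` A)) -integral_indic//.
  by apply: (measurable_preimage _ mA); exact: measurable_funD.
rewrite (indep_decouple me1 me2 ind (h := fun xy : R * R => (\1_A (xy.1 + xy.2))%:E))/=;
  last 2 first.
  exact/measurable_EFinP.
  by move=> x; rewrite lee_fin.
have mpdf s : measurable_fun setT (fun x : R => (normal_pdf 0 s x)%:E).
  by apply/measurable_EFinP; exact: measurable_normal_pdf.
have mpdf2 : measurable_fun setT (fun xz : R * R =>
    ((normal_pdf 0 s2 (xz.2 - xz.1))%:E)).
  apply/measurable_EFinP; apply: (measurableT_comp (measurable_normal_pdf _ _)).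
  exact: measurable_funB.
have m1A : measurable_fun setT (fun z : R => (\1_A z : R)%:E).
  by apply/measurable_EFinP; exact: measurable_indic.
have step w : (\int[P]_w' (\1_A (e1 w + e2 w'))%:E =
    \int[mu]_z ((\1_A z)%:E * (normal_pdf 0 s2 (z - e1 w))%:E))%E.
  have mu1 : measurable_fun setT (fun y => (\1_A (e1 w + y) : R)%:E).
    apply: (measurableT_comp m1A); exact: measurable_funD.
  have u0 y : (0 <= (\1_A (e1 w + y) : R)%:E)%E by rewrite lee_fin.
  have -> := ge0_expect_normal me2 n2 mu1 u0.
  have mv : measurable_fun setT
      (fun z => (\1_A z)%:E * (normal_pdf 0 s2 (z - e1 w))%:E)%E.
    apply: emeasurable_funM => //.
    by apply: (measurableT_comp (mpdf s2)); exact: measurable_funB.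
  have v0 z : (0 <= (\1_A z)%:E * (normal_pdf 0 s2 (z - e1 w))%:E)%E.
    by rewrite mule_ge0// lee_fin// normal_pdf_ge0.
  have -> := ge0_integral_affine (e1 w) (oner_neq0 R) mv v0.
  rewrite normr1 mul1e; apply: eq_integral => y _.
  by rewrite mul1r addrK addrC.
under eq_integral do rewrite step.
have mF : measurable_fun setT (fun xz : R * R =>
    ((\1_A xz.2)%:E * (normal_pdf 0 s2 (xz.2 - xz.1))%:E)%E).
  apply: emeasurable_funM => //; apply: (measurableT_comp m1A) => //.
have mI : measurable_fun setT (fun x : R =>
    (\int[mu]_z ((\1_A z)%:E * (normal_pdf 0 s2 (z - x))%:E))%E).
  apply: (measurable_fun_fubini_tonelli_F (m2 := mu) (fun xz : R * R =>
    ((\1_A xz.2)%:E * (normal_pdf 0 s2 (xz.2 - xz.1))%:E)%E)) => //.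
  by move=> xz; rewrite mule_ge0// lee_fin// normal_pdf_ge0.
have I0 x : (0 <= \int[mu]_z ((\1_A z)%:E * (normal_pdf 0 s2 (z - x))%:E))%E.
  by apply: integral_ge0 => z _; rewrite mule_ge0// lee_fin// normal_pdf_ge0.
have -> := ge0_expect_normal me1 n1 mI I0.
transitivity (\int[mu]_x \int[mu]_z ((\1_A z)%:E *
    (normal_pdf 0 s2 (z - x))%:E * (normal_pdf 0 s1 x)%:E))%E.
  apply: eq_integral => x _; rewrite -ge0_integralZr//.
  - by apply: emeasurable_funM => //; apply: (measurableT_comp (mpdf s2)); exact: measurable_funB.
  - by move=> z _; rewrite mule_ge0// lee_fin// normal_pdf_ge0.
  - by rewrite lee_fin normal_pdf_ge0.
have := fubini_tonelli (m1 := mu) (m2 := mu) (fun xz : R * R =>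
  ((\1_A xz.2)%:E * (normal_pdf 0 s2 (xz.2 - xz.1))%:E *
   (normal_pdf 0 s1 xz.1)%:E)%E).
rewrite /= => -> //; last 2 first.
- by apply: emeasurable_funM => //; apply: (measurableT_comp (mpdf s1)).
- by move=> xz; rewrite !mule_ge0// lee_fin// normal_pdf_ge0.
rewrite normal_prob_indic//; apply: eq_integral => z _.
transitivity (\int[mu]_x ((\1_A z)%:E * (normal_pdf 0 S z)%:E *
    (normal_pdf (z * s1 ^+ 2 / S ^+ 2) (s1 * s2 / S) x)%:E))%E.
  apply: eq_integral => x _; rewrite -!muleA; congr (_ * _)%E.
  by rewrite -!EFinM mulrC normal_pdf_convolution.
rewrite ge0_integralZl//.
- by rewrite integral_normal_pdf mule1.
- by apply/measurable_EFinP; exact: measurable_normal_pdf.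
- by move=> x _; rewrite lee_fin normal_pdf_ge0.
- by rewrite mule_ge0// lee_fin// normal_pdf_ge0.
Qed.

(** Vanishing coefficients and vanishing partial sums are split off in the induction, since
    [is_normal_add] takes positive standard deviations. *)
Lemma is_normal_sum N (e : 'I_N -> Omega -> R) (s : R) (a : 'I_N -> R)
    (r : seq 'I_N) :
  (forall i, measurable_fun setT (e i)) -> mutually_independent P e ->
  (forall i, is_normal P (e i) s) -> 0 < s -> uniq r ->
  \sum_(i <- r) a i ^+ 2 != 0 ->
  is_normal P (fun w => \sum_(i <- r) a i * e i w)
    (Num.sqrt (\sum_(i <- r) a i ^+ 2) * s).
Proof.
move=> me ind ne s0; elim: r => [|i r IH /= /andP[ir ur]].
  by rewrite big_nil eqxx.
rewrite big_cons => V0.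
have -> : (fun w => \sum_(j <- i :: r) a j * e j w) =
    (fun w => a i * e i w + \sum_(j <- r) a j * e j w).
  by apply/funext => w; rewrite big_cons.
have W0 : 0 <= \sum_(j <- r) a j ^+ 2 by apply: sumr_ge0 => j _; exact: sqr_ge0.
have [ai0|ai0] := eqVneq (a i) 0.
  move: V0; rewrite ai0 expr0n/= !add0r => V0.
  rewrite (_ : (fun w => _) = (fun w => \sum_(j <- r) a j * e j w)); last first.
    by apply/funext => w; rewrite mul0r add0r.
  exact: IH.
have [W00|W1] := eqVneq (\sum_(j <- r) a j ^+ 2) 0.
  rewrite W00 addr0 sqrtr_sqr (_ : (fun w => _) = (fun w => a i * e i w)).
    by apply: is_normal_scale => //; rewrite gt_eqF.
  apply/funext => w; rewrite big1_seq ?addr0// => j /= jr.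
  move: W00 => /eqP; rewrite psumr_eq0; last by move=> *; exact: sqr_ge0.
  by move=> /allP/(_ j jr)/=; rewrite sqrf_eq0 => /eqP ->; rewrite mul0r.
have -> : Num.sqrt (a i ^+ 2 + \sum_(j <- r) a j ^+ 2) * s =
    Num.sqrt ((`|a i| * s) ^+ 2 + (Num.sqrt (\sum_(j <- r) a j ^+ 2) * s) ^+ 2).
  rewrite !exprMn -mulrDl sqrtrM ?sqrtr_sqr ?(gtr0_norm s0)//.
  by rewrite sqr_sqrtr// real_normK// num_real.
apply: is_normal_add => //.
- exact: measurable_funM.
- by apply: measurable_sum => j; exact: measurable_funM.
- pose r' := [set j | j \in r]%SET.
  have disj : ([set i] :&: r')%SET = finset.set0.
    apply/setP => j; rewrite !finset.inE; apply/negbTE/negP => /andP[/eqP -> ].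
    by rewrite (negbTE ir).
  have := indep_comp (u := fun t : N.-tuple R => a i * tnth t i)
    (v := fun t : N.-tuple R => \sum_(j <- r) a j * tnth t j) _ _
    (indep_block me ind 0 disj).
  rewrite (_ : _ \o _ = fun w => a i * e i w); last first.
    by apply/funext => w /=; rewrite tnth_mktuple finset.in_set1 eqxx.
  rewrite (_ : _ \o _ = fun w => \sum_(j <- r) a j * e j w); last first.
    apply/funext => w /=; apply: eq_big_seq => j jr.
    by rewrite tnth_mktuple finset.inE jr.
  apply.
  + by apply: measurable_funM => //; exact: measurable_tnth.
  + by apply: measurable_sum => j; apply: measurable_funM => //; exact: measurable_tnth.
- by rewrite mulr_gt0// normr_gt0.
- by rewrite mulr_gt0// sqrtr_gt0 lt_neqAle eq_sym W1.
- by apply: is_normal_scale => //; rewrite gt_eqF.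
- exact: IH.
Qed.

Lemma expect_exp_sq (e : Omega -> R) (s t : R) :
  measurable_fun setT e -> is_normal P e s -> 0 < s -> 0 < t ->
  (\int[P]_w (expR ((s ^- 2 - t ^- 2) / 2 * e w ^+ 2))%:E = (t / s)%:E)%E.
Proof.
move=> me ne s0 t0.
pose f x := (expR ((s ^- 2 - t ^- 2) / 2 * x ^+ 2))%:E.
have mf : measurable_fun setT f.
  apply/measurable_EFinP; apply: measurableT_comp => //.
  by apply: measurable_funM => //; exact: measurable_funX.
have f0 x : (0 <= f x)%E by rewrite lee_fin expR_ge0.
have -> := ge0_expect_normal me ne mf f0.
transitivity (\int[mu]_x ((t / s)%:E * (normal_pdf 0 t x)%:E))%E.
  by apply: eq_integral => x _; rewrite -!EFinM normal_pdf_exp_sq.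
rewrite ge0_integralZl//.
- by rewrite integral_normal_pdf mule1.
- by apply/measurable_EFinP; exact: measurable_normal_pdf.
- by move=> x _; rewrite lee_fin normal_pdf_ge0.
- by rewrite lee_fin divr_ge0// ltW.
Qed.

(** The variance is the derivative at 0 of the exponential moment of the square. Instead of
    differentiating, 1 + x <= exp x is applied to the exact values at t = s (1 + h) and t = s (1 -
    h), which squeezes the second moment as h tends to 0. *)
Lemma expect_sq (e : Omega -> R) (s : R) :
  measurable_fun setT e -> is_normal P e s -> 0 < s ->
  (\int[P]_w (e w ^+ 2)%:E = (s ^+ 2)%:E)%E.
Proof.
move=> me ne s0.
have me2 : measurable_fun setT (fun w => (e w ^+ 2)%:E).
  by apply/measurable_EFinP; exact: measurable_funX.
have v0 : (0 <= \int[P]_w (e w ^+ 2)%:E)%E.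
  by apply: integral_ge0 => w _; rewrite lee_fin sqr_ge0.
have aE (h : R) : h != 0 -> -1 < h ->
    (s ^- 2 - (s * (1 + h)) ^- 2) / 2 = h * ((2 + h) / (s ^+ 2 * 2 * (1 + h) ^+ 2)).
  by move=> h0 h1; field; rewrite !gt_eqF//=; lra.
have mexp (c : R) : measurable_fun setT (fun w => (expR (c * e w ^+ 2))%:E).
  apply/measurable_EFinP; apply: measurableT_comp => //.
  by apply: measurable_funM => //; exact: measurable_funX.
have int1 (h : R) : -1 < h ->
    (\int[P]_w (expR ((s ^- 2 - (s * (1 + h)) ^- 2) / 2 * e w ^+ 2))%:E =
    (1 + h)%:E)%E.
  move=> h1; rewrite expect_exp_sq//; last by rewrite mulr_gt0//; lra.
  by rewrite mulrC mulKf// gt_eqF.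
have I1 : (\int[P]_w 1%:E = 1%:E)%E.
  by rewrite integral_cst// [X in (_ * X)%E]probability_setT mule1.
have ub (h : R) : 0 < h ->
    (((2 + h) / (s ^+ 2 * 2 * (1 + h) ^+ 2))%:E * \int[P]_w (e w ^+ 2)%:E <= 1%:E)%E.
  move=> h0; have c0 : 0 < (2 + h) / (s ^+ 2 * 2 * (1 + h) ^+ 2).
    by rewrite divr_gt0 ?mulr_gt0 ?exprn_gt0//; lra.
  have h1 : -1 < h by lra.
  have := int1 h h1; rewrite aE ?gt_eqF//; set c := (X in h * X).
  move=> I2.
  have : (1%:E + (h * c)%:E * \int[P]_w (e w ^+ 2)%:E <= (1 + h)%:E)%E.
    rewrite -{1}I1 -I2 -ge0_integralZl//; last 2 first.
      by move=> w _; rewrite lee_fin sqr_ge0.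
      by rewrite lee_fin mulr_ge0// ltW.
    rewrite -ge0_integralD//; last 2 first.
      by move=> w _; rewrite -EFinM lee_fin mulr_ge0 ?sqr_ge0// mulr_ge0// ltW.
      by apply: emeasurable_funM.
    apply: ge0_le_integral => //.
    - by move=> w _; rewrite -EFinM -EFinD lee_fin addr_ge0// mulr_ge0 ?sqr_ge0// mulr_ge0// ltW.
    - by apply: emeasurable_funD => //; exact: emeasurable_funM.
    - by move=> w _; rewrite -EFinM -EFinD lee_fin expR_ge1Dx.
  rewrite EFinD leeD2lE// EFinM -muleA => H.
  by rewrite -(@lee_pmul2l _ h%:E)// ?mule1// lte_fin.
(* Finiteness is read off the upper bound at h = 1. *)
have fin : (\int[P]_w (e w ^+ 2)%:E)%E \is a fin_num.
  rewrite ge0_fin_numE//; have := ub 1 ltr01.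
  case: (\int[P]_w _)%E => [r||]//; rewrite ?ltry//.
  by rewrite gt0_muley// lte_fin divr_gt0 ?mulr_gt0 ?exprn_gt0//; lra.
have [v vE] : exists v, (\int[P]_w (e w ^+ 2)%:E)%E = v%:E.
  by exists (fine (\int[P]_w (e w ^+ 2)%:E)%E); rewrite fineK.
rewrite vE in v0 ub *; congr (_%:E); apply/eqP; rewrite eq_le.
have s20 : 0 < s ^+ 2 by rewrite exprn_gt0.
apply/andP; split.
  apply/ler_addgt0Pr => eps eps0.
  pose h := eps / (2 * s ^+ 2).
  have h0 : 0 < h by rewrite divr_gt0// mulr_gt0.
  have := ub h h0; rewrite -EFinM lee_fin mulrAC ler_pdivrMr ?mul1r; last first.
    by rewrite mulr_gt0 ?exprn_gt0 ?mulr_gt0//; lra.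
  have -> : eps = 2 * s ^+ 2 * h by rewrite /h; field; rewrite gt_eqF.
  move: (s ^+ 2) s20 => S S0 H.
  have : (2 + h) * v <= (2 + h) * (S + 2 * S * h).
    apply: (le_trans H); have : 0 <= S * h by rewrite mulr_ge0// ltW.
    by nra.
  by rewrite ler_pM2l//; lra.
have lb (h : R) : 0 < h < 1 ->
    1 <= ((2 - h) / (s ^+ 2 * 2 * (1 - h) ^+ 2)) * v.
  move=> /andP[h0 h1].
  have h2 : -1 < - h by lra.
  have := int1 (- h) h2; rewrite aE ?oppr_eq0 ?gt_eqF//; set c := (X in - h * X).
  have c0 : 0 < c by rewrite /c divr_gt0 ?mulr_gt0 ?exprn_gt0//; lra.
  move=> I2.
  have : (1%:E <= (1 - h)%:E + (h * c)%:E * v%:E)%E.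
    rewrite -{1}I1 -vE -I2 -ge0_integralZl//; last 2 first.
      by move=> w _; rewrite lee_fin sqr_ge0.
      by rewrite lee_fin mulr_ge0// ltW.
    rewrite -ge0_integralD//; last 2 first.
      by move=> w _; rewrite -EFinM lee_fin mulr_ge0 ?sqr_ge0// mulr_ge0// ltW.
      by apply: emeasurable_funM.
    apply: ge0_le_integral => //.
    - by apply: emeasurable_funD => //; exact: emeasurable_funM.
    - move=> w _; rewrite -EFinM -EFinD lee_fin.
      have := expR_ge1Dx (- h * c * e w ^+ 2); nra.
  rewrite -EFinM -EFinD lee_fin => H.
  have : h * 1 <= h * (c * v) by rewrite mulrA; lra.
  by rewrite ler_pM2l.
apply/ler_addgt0Pr => eps eps0.
have [h /andP[h0 /andP[h1 hs]]] : exists h : R, (0 < h) && ((h < 1) && (h * (2 * s ^+ 2) <= eps)).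
  exists (Num.min (1 / 2) (eps / (2 * s ^+ 2))).
  rewrite lt_min !divr_gt0 ?mulr_gt0//= gt_min; apply/andP; split.
    by apply/orP; left; lra.
  by rewrite -ler_pdivlMr ?mulr_gt0// ge_min lexx orbT.
have := lb h; rewrite h0 h1 => /(_ isT).
rewrite mulrAC ler_pdivlMr ?mul1r; last by rewrite mulr_gt0 ?exprn_gt0 ?mulr_gt0//; lra.
move: hs; move: (s ^+ 2) s20 => S S0 hs H.
have : (2 - h) * S <= (2 - h) * (v + 2 * S * h).
  suff : (2 - h) * (S - 2 * S * h) <= (2 - h) * v by lra.
  apply: le_trans H; nra.
rewrite ler_pM2l; [nra|lra].
Qed.

Lemma normal_integrable (e : Omega -> R) (s : R) :
  measurable_fun setT e -> is_normal P e s -> 0 < s ->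
  P.-integrable setT (EFin \o e).
Proof.
move=> me ne s0; apply/integrableP; split; first exact/measurable_EFinP.
have me2 : measurable_fun setT (fun w => (e w ^+ 2)%:E).
  by apply/measurable_EFinP; exact: measurable_funX.
apply: (@le_lt_trans _ _ (\int[P]_w (1%:E + (e w ^+ 2)%:E))%E).
  apply: ge0_le_integral => //.
  - apply: measurableT_comp => //; exact/measurable_EFinP.
  - exact: emeasurable_funD.
  - move=> w _ /=; rewrite lee_fin; have := sqr_ge0 (`|e w| - 1).
    rewrite sqrrB expr1n mulr1 real_normK ?num_real//; have := normr_ge0 (e w).
    by rewrite -mulr_natl; lra.
rewrite ge0_integralD//; last by move=> w _; rewrite lee_fin sqr_ge0.
rewrite (expect_sq me ne s0) integral_cst// [X in (_ * X)%E]probability_setT mule1.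
by rewrite -EFinD ltry.
Qed.

(** By symmetry e and -e have the same law, so the positive and the negative part have the same
    finite integral. *)
Lemma expect_normal (e : Omega -> R) (s : R) :
  measurable_fun setT e -> is_normal P e s -> 0 < s ->
  (\int[P]_w (e w)%:E = 0)%E.
Proof.
move=> me ne s0.
have ne' : is_normal P (fun w => - 1 * e w) s.
  have n1 : -1 != 0 :> R by rewrite oppr_eq0 oner_eq0.
  by have := is_normal_scale me ne n1 (negbT (gt_eqF s0)); rewrite normrN1 mul1r.
have me' : measurable_fun setT (fun w => - 1 * e w) by exact: measurable_funM.
pose f (x : R) := (Num.max x 0)%:E.
have mf : measurable_fun setT f.
  by apply/measurable_EFinP; exact: measurable_maxr.
have f0 x : (0 <= f x)%E by rewrite lee_fin le_max lexx orbT.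
have E1 := ge0_expect_normal me ne mf f0.
have E2 := ge0_expect_normal me' ne' mf f0.
have iP := normal_integrable me ne s0.
rewrite integralE.
have -> : (\int[P]_w (fun w => (e w)%:E)^\+ w = \int[P]_w f (e w))%E.
  by apply: eq_integral => w _; rewrite funeposE /f EFin_max.
have -> : (\int[P]_w (fun w => (e w)%:E)^\- w = \int[P]_w f (- 1 * e w)%R)%E.
  by apply: eq_integral => w _; rewrite funenegE /f EFin_max mulN1r.
rewrite E1 E2 subee// -E1.
have := integrable_pos_fin_num measurableT iP.
congr (_ \is a fin_num); apply: eq_integral => w _.
by rewrite funeposE /f EFin_max.
Qed.

End random_normal.

Local Notation N01 := (@normal_prob R 0 1).

Definition tail (c : R) : R := fine (N01 `]c, +oo[).

Lemma tailE c : (tail c)%:E = N01 `]c, +oo[.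
Proof. by rewrite /tail fineK// fin_num_measure. Qed.

(** Comparison with N(0, 2): the standard density is sqrt 2 exp (- x^2 / 4) times that density, and
    the exponential is largest at x = c. *)
Lemma tail_ub (c : R) : 0 <= c ->
  tail c <= Num.sqrt 2 * expR (- (c ^+ 2 / 4)).
Proof.
move=> c0; rewrite -lee_fin tailE normal_prob_indic//.
have q0 : 0 < Num.sqrt 2 :> R by rewrite sqrtr_gt0.
have q2 : Num.sqrt 2 ^+ 2 = 2 :> R by rewrite sqr_sqrtr.
have mpdf s : measurable_fun setT (fun x : R => (normal_pdf 0 s x)%:E).
  by apply/measurable_EFinP; exact: measurable_normal_pdf.
apply: (@le_trans _ _ (\int[mu]_x ((Num.sqrt 2 * expR (- (c ^+ 2 / 4)))%:E *
    (normal_pdf 0 (Num.sqrt 2) x)%:E))%E).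
  apply: ge0_le_integral => //.
  - by move=> x _; rewrite mule_ge0// lee_fin// normal_pdf_ge0.
  - apply: emeasurable_funM => //; apply/measurable_EFinP.
    exact: measurable_indic.
  - exact: measurable_normal_pdf.
  - by apply: emeasurable_funM => //; exact: mpdf.
  - move=> x _; rewrite -!EFinM lee_fin indicE; case: (boolP (x \in _)); last first.
      by rewrite mul0r mulr_ge0 ?normal_pdf_ge0// mulr_ge0 ?expR_ge0// ltW.
    rewrite inE/= in_itv/= andbT mul1r => cx.
    have := normal_pdf_exp_sq x ltr01 q0; rewrite q2 expr1n divr1 => E.
    rewrite mulrAC -E mulrAC -expRD -[leLHS]mul1r ler_wpM2r ?normal_pdf_ge0//.
    rewrite -[leLHS]expR0 ler_expR.
    have : c ^+ 2 <= x ^+ 2 by rewrite ler_sqr ?nnegrE//; lra.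
    by rewrite invr1; lra.
rewrite ge0_integralZl//.
- by rewrite integral_normal_pdf mule1.
- exact: mpdf.
- by move=> x _; rewrite lee_fin normal_pdf_ge0.
Qed.

Lemma normal_pdf01 (x : R) : normal_pdf 0 1 x = normal_peak 1 * expR (- (x ^+ 2 / 2)).
Proof.
by rewrite normal_pdfE// /normal_fun subr0 expr1n mulNr.
Qed.

Lemma normal_pdf01_le (x y : R) : 0 <= x -> x <= y ->
  normal_pdf 0 1 y <= normal_pdf 0 1 x.
Proof.
move=> x0 xy; rewrite !normal_pdf01 ler_wpM2l ?normal_peak_ge0// ler_expR.
have : x ^+ 2 <= y ^+ 2 by rewrite ler_sqr ?nnegrE//; lra.
lra.
Qed.

(** The density is integrated over a window of length 1 / (c + 1) to the right of c, on which it
    decreases by a factor of at least exp (- 3/2). Taking c + 1 rather than c keeps the window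
    bounded at c = 0. *)
Lemma tail_lb (c : R) : 0 <= c ->
  normal_pdf 0 1 c * expR (- (3 / 2)) <= tail c * (c + 1).
Proof.
move=> c0; have c1 : 0 < c + 1 by lra.
rewrite -ler_pdivrMr//.
pose u := (c + 1)^-1; have u0 : 0 < u by rewrite invr_gt0.
have u1 : u * (c + 1) = 1 by rewrite mulVf// gt_eqF.
pose m := normal_pdf 0 1 c * expR (- (3 / 2)).
have m0 : 0 <= m by rewrite mulr_ge0 ?normal_pdf_ge0 ?expR_ge0.
suff H : ((m / (c + 1))%:E <= N01 `]c, +oo[)%E by rewrite -lee_fin tailE.
rewrite /normal_prob.
have H1 : ((m / (c + 1))%:E <= \int[mu]_(x in `]c, (c + u)%R]) m%:E)%E.
  rewrite integral_cst// [X in (_ * X)%E]lebesgue_measure_itv/= lte_fin ltrDl u0.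
  by rewrite -EFinB -EFinM lee_fin addrAC subrr add0r.
apply: (le_trans H1).
have mpdf : measurable_fun setT (fun x : R => (normal_pdf 0 1 x)%:E).
  by apply/measurable_EFinP; exact: measurable_normal_pdf.
apply: (@le_trans _ _ (\int[mu]_(x in `]c, (c + u)%R]) (normal_pdf 0 1 x)%:E)%E).
  apply: ge0_le_integral => //.
  - exact: measurable_funTS.
  - move=> x /=; rewrite in_itv/= => /andP[cx xu]; rewrite lee_fin.
    apply: (@le_trans _ _ (normal_pdf 0 1 (c + u))); last first.
      by apply: normal_pdf01_le => //; lra.
    rewrite /m !normal_pdf01 -mulrA ler_wpM2l ?normal_peak_ge0//.
    rewrite -expRD ler_expR.
    have ule1 : u <= 1 by rewrite invf_le1//; lra.
    have : u ^+ 2 <= 1 by rewrite expr_le1// ltW.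
    have -> : (c + u) ^+ 2 = c ^+ 2 + 2 * (u * (c + 1)) - 2 * u + u ^+ 2 by ring.
    by rewrite u1; lra.
apply: ge0_subset_integral => //.
- exact: measurable_funTS.
- by move=> x _; rewrite lee_fin normal_pdf_ge0.
- by move=> x /=; rewrite !in_itv/= andbT => /andP[].
Qed.

Lemma normal_prob_itv_le (a b m : R) : a <= b ->
  (forall x, a < x <= b -> normal_pdf 0 1 x <= m) ->
  (N01 `]a, b] <= ((b - a) * m)%:E)%E.
Proof.
move=> ab Hm; rewrite /normal_prob.
apply: (@le_trans _ _ (\int[mu]_(x in `]a, b]) m%:E)%E).
  apply: ge0_le_integral => //.
  - by move=> x _; rewrite lee_fin normal_pdf_ge0.
  - apply: measurable_funTS; apply/measurable_EFinP.
    exact: measurable_normal_pdf.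
rewrite integral_cst// [X in (_ * X)%E]lebesgue_measure_itv/= lte_fin.
case: ltP => [_|ba]; first by rewrite -EFinB -EFinM mulrC.
have -> : a = b by apply/eqP; rewrite eq_le ab.
by rewrite mule0 subrr mul0r.
Qed.

Lemma tail_split (a b : R) : a <= b ->
  (tail a)%:E = (N01 `]a, b] + (tail b)%:E)%E.
Proof.
move=> ab; rewrite !tailE -measureU//.
  congr (N01 _); apply/seteqP; split => x /=; rewrite !in_itv/= !andbT.
    by move=> ->; case: (leP x b); [left|right].
  by move=> [/andP[]//|]; apply: le_lt_trans.
apply/seteqP; split => x //=; rewrite !in_itv/= andbT => -[/andP[_]].
by rewrite leNgt => /negbTE ->.
Qed.

Lemma tail_anti (a b : R) : a <= b -> tail b <= tail a.
Proof.
by move=> ab; rewrite -lee_fin (tail_split ab) leeDr.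
Qed.

Lemma tail_shift (c h : R) : 0 <= h -> h <= c ->
  tail (c - h) <= tail c + h * normal_pdf 0 1 (c - h).
Proof.
move=> h0 hc; have hcc : c - h <= c by lra.
rewrite -lee_fin (tail_split hcc) [leRHS]EFinD [leRHS]addeC; apply: leeD => //.
have -> : h * normal_pdf 0 1 (c - h) = (c - (c - h)) * normal_pdf 0 1 (c - h).
  by congr (_ * _); lra.
apply: normal_prob_itv_le => // x /andP[/ltW + _].
by apply: normal_pdf01_le; lra.
Qed.

Lemma tail_lipschitz (a b : R) : a <= b ->
  tail a <= tail b + (b - a) * normal_peak 1.
Proof.
move=> ab; rewrite -lee_fin (tail_split ab) [leRHS]EFinD [leRHS]addeC; apply: leeD => //.
by apply: normal_prob_itv_le => // x _; apply: normal_pdf_ub; rewrite oner_eq0.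
Qed.

Lemma tail_continuous : continuous tail.
Proof.
move=> x; apply/cvgrPdist_le => /= e e0.
have p0 : 0 < normal_peak 1 :> R by rewrite normal_peak_gt0// oner_eq0.
near=> y.
have xy : `|x - y| <= e / normal_peak 1.
  by near: y; apply: cvgr_dist_le; [exact: cvg_id|rewrite divr_gt0].
rewrite ler_pdivlMr// in xy.
apply: le_trans xy.
case: (leP x y) => xy.
  have H1 := tail_lipschitz xy; have H2 := tail_anti xy.
  have -> : `|x - y| = y - x by rewrite distrC ger0_norm// subr_ge0.
  by have -> : `|tail x - tail y| = tail x - tail y; [rewrite ger0_norm// subr_ge0|lra].
have H1 := tail_lipschitz (ltW xy); have H2 := tail_anti (ltW xy).
have -> : `|x - y| = x - y by rewrite gtr0_norm// subr_gt0.
by have -> : `|tail x - tail y| = tail y - tail x;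
  [rewrite distrC ger0_norm// subr_ge0|lra].
Unshelve. all: end_near. Qed.

Lemma normal_prob_opp (A : set R) : measurable A -> N01 (-%R @^-1` A) = N01 A.
Proof.
move=> mA; have n1 : -1 != 0 :> R by rewrite oppr_eq0 oner_eq0.
have id1 : is_normal N01 (fun x : R => x) 1 by [].
have := @is_normal_scale _ (measurableTypeR R) N01 (fun x => x) 1 (- 1)
  (@measurable_id _ _ setT) id1 n1 (oner_neq0 _) _ mA.
rewrite normrN1 mul1r => <-; congr (N01 _).
by apply/seteqP; split => x /=; rewrite mulN1r.
Qed.

Lemma normal_prob_abs (c : R) : 0 <= c ->
  N01 [set x | c < `|x|] = (2 * tail c)%:E.
Proof.
move=> c0.
have -> : [set x | c < `|x|] = `]c, +oo[ `|` (-%R @^-1` `]c, +oo[) :> set R.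
  apply/seteqP; split => x /=; rewrite !in_itv/= !andbT ltr_normr.
    by move=> /orP[]; [left|right].
  by move=> [->//|->]; rewrite orbT.
have mN : measurable (-%R @^-1` `]c, +oo[ : set R).
  by apply: measurable_preimage => //; exact: oppr_measurable.
rewrite measureU//.
  transitivity (N01 `]c, +oo[ + N01 `]c, +oo[)%E.
    by congr (_ + _)%E; exact: normal_prob_opp.
  by rewrite -tailE -EFinD; congr (_%:E); lra.
by apply/seteqP; split => x //=; rewrite !in_itv/= !andbT => -[]; lra.
Qed.

Lemma tail0 : tail 0 = 1 / 2.
Proof.
suff : (2 * tail 0 = 1)%R by lra.
apply: EFin_inj; rewrite -normal_prob_abs// -(probability_setT N01).
have -> : [set x | 0 < `|x|] = ~` [set 0] :> set R.
  apply/seteqP; split => x /=; rewrite normr_gt0; first by move/eqP.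
  by move=> ?; apply/eqP.
rewrite probability_setC// probability_setT.
have N0 : N01 [set 0] = 0%E by rewrite /normal_prob integral_set1.
by rewrite [X in (_ - X)%E]N0 sube0.
Qed.

Lemma normal_upper_quantile_spec (u : R) : 0 < u < 1 / 2 ->
  0 <= normal_upper_quantile u /\ tail (normal_upper_quantile u) = u.
Proof.
move=> /andP[u0 u12].
have [z0 Hz0] : exists z, tail z = u.
  (* At b the bound [tail_ub] is below u: with b u = 8, u exp (b^2 / 4) >= u (1 + b^2 / 4) = u + 2 b
     >= 2. *)
  pose b := 8 / u.
  have b0 : 0 <= b by rewrite divr_ge0// ltW.
  have tb : tail b <= u.
    apply: (le_trans (tail_ub b0)).
    have q2 : Num.sqrt 2 <= 2 :> R.
      by rewrite -[leRHS]ger0_norm// -sqrtr_sqr ler_sqrt//; lra.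
    have : 1 + b ^+ 2 / 4 <= expR (b ^+ 2 / 4) by exact: expR_ge1Dx.
    have E : b * u = 8 by rewrite /b divfK// gt_eqF.
    rewrite expRN => H.
    have e0 : 0 < expR (b ^+ 2 / 4) by exact: expR_gt0.
    rewrite ler_pdivrMr//; apply: (le_trans q2).
    apply: (@le_trans _ _ (u * (1 + b ^+ 2 / 4))); last by rewrite ler_pM2l.
    have -> : u * (1 + b ^+ 2 / 4) = u + b * (b * u) / 4 by ring.
    by rewrite E; have : 1 <= b; [rewrite /b ler_pdivlMr//; lra|lra].
  have [|z _ Hz] := @IVT R tail 0 b u b0 (continuous_subspaceT tail_continuous).
    by rewrite ge_min le_max tb tail0 (ltW u12) orbT.
  by exists z.
have Hz : tail (normal_upper_quantile u) = u.
  apply: EFin_inj; rewrite tailE.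
  apply: (@xgetPex _ 0 [set z : R | normal_prob 0 1 `]z, +oo[ = u%:E]).
  by exists z0; rewrite /= -Hz0 tailE.
split=> //; rewrite leNgt; apply/negP => zlt0.
have := tail_anti (ltW zlt0); rewrite tail0 Hz; lra.
Qed.

(** The second claim inverts the tail bound and limits the growth of c. The third measures the
    effect of lowering the threshold by a relative amount d: the added mass is at most c d times the
    density at c (1 - d), and [tail_lb] expresses the density at c through u. The result is a
    relative error, which a union over m tests preserves. *)
Lemma normal_upper_quantile_bounds (u d : R) : 0 < u < 1 / 2 -> 0 <= d <= 1 ->
  let c := normal_upper_quantile u in
  [/\ 0 <= c, expR (c ^+ 2 / 4) * u <= 2 &
      tail (c * (1 - d)) <=
        u * (1 + c * (c + 1) * d * expR (c ^+ 2 * d + 3 / 2))].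
Proof.
move=> u01 /andP[d0 d1] c; have [c0 tc] := normal_upper_quantile_spec u01.
rewrite -/c in c0 tc; have /andP[u0 _] := u01.
split=> //.
  have := tail_ub c0; rewrite tc expRN ler_pdivlMr ?expR_gt0// mulrC => H.
  apply: (le_trans H).
  by rewrite -[leRHS]ger0_norm// -sqrtr_sqr ler_sqrt//; lra.
have h0 : 0 <= c * d by rewrite mulr_ge0.
have hc : c * d <= c by rewrite ler_piMr.
have := tail_shift h0 hc; rewrite tc.
have -> : c - c * d = c * (1 - d) by ring.
move=> /le_trans; apply.
suff H : normal_pdf 0 1 (c * (1 - d)) <= u * (c + 1) * expR (c ^+ 2 * d + 3 / 2).
  have := ler_wpM2l h0 H; lra.
have := tail_lb c0; rewrite tc => Hlb.
have e0 : 0 < expR (c ^+ 2 * d + 3 / 2) by exact: expR_gt0.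
have := ler_wpM2r (ltW e0) Hlb; apply: le_trans.
rewrite !normal_pdf01 [leRHS](_ : _ = normal_peak 1 *
  expR (- (c ^+ 2 / 2) + - (3 / 2) + (c ^+ 2 * d + 3 / 2))); last first.
  by rewrite !expRD; ring.
rewrite ler_wpM2l ?normal_peak_ge0// ler_expR.
have : 0 <= (c * d) ^+ 2 by exact: sqr_ge0.
by nra.
Qed.

End normal_law.

(** * Rayleigh quotients and least squares *)

Section squared_norm.
Context {R : realType}.

Definition dot n (u v : 'cV[R]_n) : R := \sum_i u i 0 * v i 0.
Definition sqn n (v : 'cV[R]_n) : R := dot v v.

Lemma dotE n (u v : 'cV[R]_n) : (u^T *m v) 0 0 = dot u v.
Proof. by rewrite mxE; apply: eq_bigr => i _; rewrite mxE. Qed.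

Lemma dotC n (u v : 'cV[R]_n) : dot u v = dot v u.
Proof. by apply: eq_bigr => i _; rewrite mulrC. Qed.

Lemma dot0l n (v : 'cV[R]_n) : dot 0 v = 0.
Proof. by rewrite /dot big1// => i _; rewrite mxE mul0r. Qed.

Lemma dotDl n (u v w : 'cV[R]_n) : dot (u + v) w = dot u w + dot v w.
Proof. by rewrite -big_split; apply: eq_bigr => i _; rewrite mxE mulrDl. Qed.

Lemma dotDr n (u v w : 'cV[R]_n) : dot w (u + v) = dot w u + dot w v.
Proof. by rewrite dotC dotDl !(dotC w). Qed.

Lemma dotZl n a (u v : 'cV[R]_n) : dot (a *: u) v = a * dot u v.
Proof. by rewrite mulr_sumr; apply: eq_bigr => i _; rewrite mxE mulrA. Qed.

Lemma dotZr n a (u v : 'cV[R]_n) : dot u (a *: v) = a * dot u v.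
Proof. by rewrite dotC dotZl dotC. Qed.

Lemma dotNl n (u v : 'cV[R]_n) : dot (- u) v = - dot u v.
Proof. by rewrite -scaleN1r dotZl mulN1r. Qed.

Lemma dotNr n (u v : 'cV[R]_n) : dot u (- v) = - dot u v.
Proof. by rewrite dotC dotNl dotC. Qed.

Lemma dot_adj m n (A : 'M[R]_(m, n)) (u : 'cV[R]_m) (v : 'cV[R]_n) :
  dot u (A *m v) = dot (A^T *m u) v.
Proof. by rewrite -!dotE trmx_mul trmxK mulmxA. Qed.

Lemma sqn_ge0 n (v : 'cV[R]_n) : 0 <= sqn v.
Proof. by apply: sumr_ge0 => i _; rewrite -expr2 sqr_ge0. Qed.

Lemma sqnE n (v : 'cV[R]_n) : sqn v = \sum_i v i 0 ^+ 2.
Proof. by apply: eq_bigr => i _; rewrite expr2. Qed.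

Lemma sqr_le_sqn n (v : 'cV[R]_n) i : v i 0 ^+ 2 <= sqn v.
Proof.
rewrite sqnE (bigD1 i)//= lerDl; apply: sumr_ge0 => j _; exact: sqr_ge0.
Qed.

Lemma sqn_eq0 n (v : 'cV[R]_n) : (sqn v == 0) = (v == 0).
Proof.
apply/idP/idP => [/eqP v0|/eqP ->]; last first.
  by rewrite sqnE big1// => i _; rewrite mxE expr0n.
apply/eqP/matrixP => i j; rewrite ord1 mxE; apply/eqP; rewrite -sqrf_eq0.
by rewrite eq_le sqr_ge0 andbT -v0 sqr_le_sqn.
Qed.

Lemma sqnN n (v : 'cV[R]_n) : sqn (- v) = sqn v.
Proof. by rewrite /sqn dotNl dotNr opprK. Qed.

Lemma sqnD n (u v : 'cV[R]_n) : sqn (u + v) = sqn u + 2 * dot u v + sqn v.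
Proof. by rewrite /sqn dotDl !dotDr (dotC v u); ring. Qed.

Lemma sqnB n (u v : 'cV[R]_n) : sqn (u - v) = sqn u - 2 * dot u v + sqn v.
Proof. by rewrite sqnD dotNr sqnN; ring. Qed.

End squared_norm.

Section rayleigh.
Context {R : realType}.

Let qform r (A : 'M[R]_r) (u : 'rV[R]_r) : R := \sum_i \sum_j u 0 i * A i j * u 0 j.
Let qnorm r (u : 'rV[R]_r) : R := \sum_i u 0 i ^+ 2.

Let qformE r (A : 'M[R]_r) u : qform A u = (u *m A *m u^T) 0 0.
Proof.
rewrite mxE /qform exchange_big; apply: eq_bigr => j _ /=.
by rewrite mxE mulr_suml; apply: eq_bigr => i _; rewrite mxE.
Qed.

Let qnormE r (u : 'rV[R]_r) : (u *m u^T) 0 0 = qnorm u.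
Proof. by rewrite mxE; apply: eq_bigr => i _; rewrite mxE expr2. Qed.

Let continuous_qform r (A : 'M[R]_r) : continuous (qform A).
Proof.
apply: continuous_big => [|i _]; first exact: add_continuous.
apply: continuous_big => [|j _ u]; first exact: add_continuous.
apply: (@continuousM _ _ (fun x : 'rV[R]_r => x 0 i * A i j) (fun x => x 0 j) u);
  last exact: coord_continuous.
apply: (@continuousM _ _ (fun x : 'rV[R]_r => x 0 i) (fun=> A i j) u);
  [exact: coord_continuous|exact: cst_continuous].
Qed.

Let continuous_qnorm r : continuous (@qnorm r).
Proof.
apply: continuous_big => [|i _ u]; first exact: add_continuous.
apply: (@continuous_comp _ _ _ (fun v : 'rV[R]_r => v 0 i) (fun x : R => x ^+ 2)).
  exact: coord_continuous.
exact: sqr_continuous.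
Qed.

(** The quadratic form attains its minimum a on the compact unit sphere at some u0. Then A - a is
    positive semidefinite with form 0 at u0, and this forces u0 into its kernel. *)
Let min_eigenvalue r (A : 'M[R]_r) : (0 < r)%N -> A^T = A ->
  exists2 a, eigenvalue A a & forall u, a * qnorm u <= qform A u.
Proof.
move=> r0 As; pose S := [set u : 'rV[R]_r | qnorm u = 1].
pose i0 := Ordinal r0.
have S0 : S !=set0.
  exists (delta_mx 0 i0); rewrite /S/= /qnorm (bigD1 i0)//= mxE !eqxx expr1n.
  rewrite big1 ?addr0// => i /negbTE ii0.
  by rewrite mxE ii0 andbF expr0n.
have cS : compact S.
  have -> : S = [set v : 'rV[R]_r | forall i, `[-1, 1]%classic (v ord0 i)] `&` S.
    apply/esym/setIidPr => u /= Su i; rewrite in_itv/= -ler_norml.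
    rewrite -(@expr_le1 _ 2)// real_normK ?num_real// -Su /qnorm (bigD1 i)//=.
    by rewrite lerDl; apply: sumr_ge0 => j _; exact: sqr_ge0.
  apply: compact_closedI.
    by apply: (@rV_compact R _ (fun=> `[-1, 1]%classic)) => i; exact: segment_compact.
  rewrite (_ : S = @qnorm r @^-1` [set 1])//.
  apply: closed_comp => [u _|]; first exact: continuous_qnorm.
  exact: closed_eq.
have [u0 u0S umin] := EVT_min_rV S0 cS (continuous_subspaceT (@continuous_qform r A)).
rewrite inE in u0S.
pose a := qform A u0.
have qZ t u : qform A (t *: u) = t ^+ 2 * qform A u.
  rewrite !qformE -scalemxAl linearZ/= -scalemxAl -scalemxAr scalerA mxE.
  by rewrite expr2.
have nZ t u : qnorm (t *: u) = t ^+ 2 * qnorm u.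
  by rewrite mulr_sumr; apply: eq_bigr => i _; rewrite mxE exprMn.
have n0 u : 0 <= qnorm u by apply: sumr_ge0 => i _; exact: sqr_ge0.
have H u : a * qnorm u <= qform A u.
  have [u00|un0] := eqVneq (qnorm u) 0.
    have -> : u = 0.
      apply/rowP => i; rewrite mxE; apply/eqP; rewrite -sqrf_eq0; apply/eqP.
      move: u00 => /eqP; rewrite psumr_eq0; last by move=> *; exact: sqr_ge0.
      by move=> /allP/(_ i); rewrite mem_index_enum => /(_ isT)/= /eqP.
    rewrite -(scale0r 0) qZ nZ expr0n/= !mul0r mulr0; exact: lexx.
  have un : 0 < qnorm u by rewrite lt_neqAle eq_sym un0 n0.
  have := umin ((Num.sqrt (qnorm u))^-1 *: u).
  rewrite inE /S/= nZ qZ exprVn sqr_sqrtr// mulVf// => /(_ erefl).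
  by rewrite mulrC ler_pdivlMr.
exists a => //; apply/eigenvalueP; exists u0; last first.
  apply/eqP => u00; move: u0S; rewrite /S/= u00 /qnorm big1.
    by move/eqP; rewrite eq_sym oner_eq0.
  by move=> i _; rewrite mxE expr0n.
pose B := A - a%:M.
have Bs : B^T = B by rewrite /B linearB/= As tr_scalar_mx.
have qB u : 0 <= qform B u.
  rewrite qformE /B mulmxBr mulmxBl mxE -qformE mul_mx_scalar -scalemxAl.
  rewrite [X in _ + X]mxE mxE subr_ge0.
  by rewrite qnormE.
have qB0 : qform B u0 = 0.
  rewrite qformE /B mulmxBr mulmxBl mxE -qformE mul_mx_scalar -scalemxAl.
  by rewrite [X in _ + X]mxE mxE qnormE u0S mulr1 subrr.
suff : u0 *m B = 0.
  by rewrite /B mulmxBr => /eqP; rewrite subr_eq0 mul_mx_scalar => /eqP.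
clearbody B.
(* first-order condition at the minimizer u0 in the direction u0 B *)
pose w := u0 *m B; have bw t : 0 <= 2 * t * qnorm w + t ^+ 2 * qform B w.
  have := qB (u0 + t *: w); rewrite qformE.
  rewrite mulmxDl linearD/= mulmxDl !mulmxDr [X in 0 <= X]mxE.
  rewrite [X in X + _]mxE [X in _ + X]mxE -qformE qB0 add0r.
  have Ew : (t *: w)^T = t *: w^T by rewrite linearZ.
  rewrite !Ew -!scalemxAl -!scalemxAr.
  have E1 : (u0 *m B *m w^T) 0 0 = qnorm w.
    exact: qnormE.
  have E2 : (w *m B *m u0^T) 0 0 = qnorm w.
    rewrite -mulmxA (_ : B *m u0^T = w^T); first exact: qnormE.
    by rewrite /w trmx_mul Bs.
  have Z c (M : 'M[R]_1) : (c *: M) 0 0 = c * M 0 0 by rewrite mxE.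
  by rewrite !Z E1 E2 -qformE expr2; lra.
have [w0|wn0] := eqVneq (qnorm w) 0.
  apply/rowP => i; rewrite [RHS]mxE; apply/eqP; rewrite -sqrf_eq0; apply/eqP.
  move: w0 => /eqP; rewrite psumr_eq0; last by move=> *; exact: sqr_ge0.
  by move=> /allP/(_ i); rewrite mem_index_enum => /(_ isT)/= /eqP.
have wn : 0 < qnorm w by rewrite lt_neqAle eq_sym wn0 n0.
have c0 := qB w.
have := bw (- (qnorm w / (qform B w + 1))).
set c := qform B w in c0 *; set N := qnorm w in wn *.
have c1 : 0 < c + 1 by lra.
pose x := N / (c + 1); rewrite -/x.
have x0 : 0 < x by rewrite divr_gt0.
have xN : x * (c + 1) = N by rewrite divfK// gt_eqF.
have x2 : 0 < x ^+ 2 by rewrite exprn_gt0.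
have -> : 2 * - x * N + (- x) ^+ 2 * c = - (x ^+ 2 * (c + 2)) by rewrite -xN; ring.
have : 0 < x ^+ 2 * (c + 2) by rewrite mulr_gt0//; lra.
by rewrite oppr_ge0 => h1 h2; have := lt_le_trans h1 h2; rewrite ltxx.
Qed.

(** Every eigenvalue is a value of the Rayleigh quotient, so the infimum is not the default value of
    an unbounded set and lies below the minimum found. A matrix of size 0 has no eigenvalue and is
    treated apart. *)
Lemma eig_min_le r (A : 'M[R]_r) (u : 'cV[R]_r) : A^T = A ->
  eig_min A * sqn u <= dot u (A *m u).
Proof.
case: (posnP r) => [r0|r0] As.
  by subst r; rewrite /sqn /dot !big_ord0 mulr0.
have [a ea Ha] := min_eigenvalue r0 As.
have En : qnorm u^T = sqn u by rewrite sqnE; apply: eq_bigr => i _; rewrite mxE.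
have Eq : qform A u^T = dot u (A *m u) by rewrite qformE trmxK -dotE mulmxA.
have := Ha u^T; rewrite En Eq; apply: le_trans; rewrite ler_wpM2r ?sqn_ge0//.
apply: ge_inf => //; exists a => b /= /eigenvalueP[v vA v0].
have := Ha v; rewrite qformE vA -scalemxAl mxE.
rewrite qnormE.
rewrite ler_pM2r// lt_neqAle sumr_ge0 ?andbT; last by move=> *; exact: sqr_ge0.
rewrite eq_sym; apply: contra v0 => /eqP v0; apply/eqP/rowP => i.
rewrite mxE; apply/eqP; rewrite -sqrf_eq0; apply/eqP.
move: v0 => /eqP; rewrite psumr_eq0; last by move=> *; exact: sqr_ge0.
by move=> /allP/(_ i); rewrite mem_index_enum => /(_ isT)/= /eqP.
Qed.

Lemma eig_max_ge r (A : 'M[R]_r) (u : 'cV[R]_r) : A^T = A ->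
  dot u (A *m u) <= eig_max A * sqn u.
Proof.
move=> As; have AsN : (- A)^T = - A by rewrite linearN/= As.
have := eig_min_le u AsN; rewrite mulNmx dotNr.
suff -> : eig_min (- A) = - eig_max A by rewrite mulNr lerN2.
rewrite /eig_min /eig_max /inf; congr (- sup _).
apply/seteqP; split => a /=.
  move=> [b /eigenvalueP[v vA v0] <-]; apply/eigenvalueP; exists v => //.
  by apply/eqP; rewrite scaleNr -vA mulmxN opprK.
move=> /eigenvalueP[v vA v0]; exists (- a); rewrite ?opprK//.
by apply/eigenvalueP; exists v => //; rewrite mulmxN vA scaleNr.
Qed.

End rayleigh.

Section submatrix.
Context {R : realType} (n p : nat) (X : 'M[R]_(n, p)).

Definition supported (M : {set 'I_p}) (v : 'cV[R]_p) :=
  forall j, j \notin M -> v j 0 = 0.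

Definition restrict_to (M : {set 'I_p}) (v : 'cV[R]_p) : 'cV[R]_#|M| :=
  \col_k v (enum_val k) 0.

Lemma submx_restrict M v : supported M v ->
  submx_cols X M *m restrict_to M v = X *m v.
Proof.
move=> sv; apply/matrixP => i j; rewrite !mxE ord1.
rewrite (bigID (mem M))/= [X in _ + X]big1 ?addr0; last first.
  by move=> l lM; rewrite sv// mulr0.
by rewrite [RHS]big_enum_val; apply: eq_bigr => l _; rewrite !mxE.
Qed.

Lemma sqn_restrict M v : supported M v -> sqn (restrict_to M v) = sqn v.
Proof.
move=> sv; rewrite !sqnE [RHS](bigID (mem M))/= [X in _ = _ + X]big1 ?addr0.
  by rewrite [RHS]big_enum_val; apply: eq_bigr => l _; rewrite !mxE.
by move=> l lM; rewrite sv// expr0n.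
Qed.

Definition extend (M : {set 'I_p}) (u : 'cV[R]_#|M|) : 'cV[R]_p :=
  \col_j \sum_(k < #|M| | enum_val k == j) u k 0.

Lemma supported_extend M u : supported M (@extend M u).
Proof.
move=> j jM; rewrite mxE big1// => k /eqP kj.
by rewrite -kj enum_valP in jM.
Qed.

Lemma restrict_extend M u : restrict_to M (@extend M u) = u.
Proof.
apply/matrixP => k i; rewrite !mxE ord1.
rewrite (bigD1 k)//= big1 ?addr0// => l /andP[/eqP/enum_val_inj -> ].
by rewrite eqxx.
Qed.

Lemma gram_sym M : (gram X M)^T = gram X M.
Proof. by rewrite /gram linearZ/= trmx_mul trmxK. Qed.

Lemma dot_gram M v : supported M v ->
  dot (restrict_to M v) (gram X M *m restrict_to M v) = n%:R^-1 * sqn (X *m v).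
Proof.
move=> sv; rewrite /gram -scalemxAl dotZr -mulmxA dot_adj trmxK.
by rewrite (submx_restrict sv).
Qed.

(** The sparse eigenvalues range over sets of exactly r columns, so a smaller support is padded to
    size r. *)
Let ex_superset (M : {set 'I_p}) r : (#|M| <= r <= p)%N ->
  exists2 M' : {set 'I_p}, M \subset M' & #|M'| = r.
Proof.
elim: r => [|r IH] /andP[Mr rp].
  by exists M => //; apply/eqP; rewrite -leqn0.
move: Mr; rewrite leq_eqVlt => /orP[/eqP Mr|Mr]; first by exists M.
have [|M' MM' M'r] := IH; first by rewrite -ltnS Mr (ltnW rp).
have [x xM'] : exists x, x \notin M'.
  apply/existsP; rewrite -negb_forall; apply/negP => /forallP H.
  suff : #|M'| = p by rewrite M'r => e; rewrite e ltnn in rp.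
  by rewrite -[RHS]card_ord; apply/eq_card => x; rewrite H.
exists (x |: M')%SET; last by rewrite cardsU1 xM' M'r.
by apply: (fintype.subset_trans MM'); exact: finset.subsetUr.
Qed.

Let fin_lbound (f : {set 'I_p} -> R) (Q : set {set 'I_p}) M :
  Q M -> inf [set f M | M in Q] <= f M.
Proof.
move=> QM; apply: ge_inf; last by exists M.
exists (- \sum_(N : {set 'I_p}) `|f N|) => _ [N _ <-].
rewrite lerNl; apply: (le_trans (ler_norm _)); rewrite normrN.
by rewrite (bigD1 N)//= lerDl sumr_ge0.
Qed.

Let fin_ubound (f : {set 'I_p} -> R) (Q : set {set 'I_p}) M :
  Q M -> f M <= sup [set f M | M in Q].
Proof.
move=> QM; apply: ub_le_sup; last by exists M.
exists (\sum_(N : {set 'I_p}) `|f N|) => _ [N _ <-].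
apply: (le_trans (ler_norm _)).
by rewrite (bigD1 N)//= lerDl sumr_ge0.
Qed.

Lemma sparse_eig_min_le (M : {set 'I_p}) r v : (#|M| <= r <= p)%N ->
  supported M v -> sparse_eig_min X r * sqn v <= n%:R^-1 * sqn (X *m v).
Proof.
move=> /ex_superset[M' MM' M'r] sv.
have sv' : supported M' v.
  by move=> j jM'; apply: sv; apply: contra jM'; apply: (fintype.subsetP MM').
rewrite -(dot_gram sv') -(sqn_restrict sv').
apply: le_trans (eig_min_le _ (gram_sym M')); rewrite ler_wpM2r ?sqn_ge0//.
exact: (fin_lbound (fun M => eig_min (gram X M))).
Qed.

Lemma sparse_eig_max_ge (M : {set 'I_p}) r v : (#|M| <= r <= p)%N ->
  supported M v -> n%:R^-1 * sqn (X *m v) <= sparse_eig_max X r * sqn v.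
Proof.
move=> /ex_superset[M' MM' M'r] sv.
have sv' : supported M' v.
  by move=> j jM'; apply: sv; apply: contra jM'; apply: (fintype.subsetP MM').
rewrite -(dot_gram sv') -(sqn_restrict sv').
apply: (le_trans (eig_max_ge _ (gram_sym M'))); rewrite ler_wpM2r ?sqn_ge0//.
exact: (fin_ubound (fun M => eig_max (gram X M))).
Qed.

Lemma gram_form (v : 'cV[R]_p) : n%:R^-1 * sqn (X *m v) =
  \sum_j \sum_l v j 0 * v l 0 * (n%:R^-1 * \sum_i X i j * X i l).
Proof.
rewrite sqnE mulr_sumr.
transitivity (\sum_i \sum_j \sum_l n%:R^-1 * (v j 0 * v l 0 * (X i j * X i l))).
  apply: eq_bigr => i _; rewrite mxE expr2 mulr_suml mulr_sumr.
  apply: eq_bigr => j _; rewrite mulr_sumr mulr_sumr.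
  by apply: eq_bigr => l _; ring.
rewrite exchange_big; apply: eq_bigr => j _ /=.
rewrite exchange_big; apply: eq_bigr => l _ /=.
by rewrite !mulr_sumr; apply: eq_bigr => i _; ring.
Qed.

End submatrix.

Lemma card_below p q : (#|[set j : 'I_p | (j < q)%N]%SET| <= q)%N.
Proof.
rewrite cardE -(size_map val) -[leqRHS](size_iota 0).
apply: uniq_leq_size => [|_ /mapP[j + ->]].
  by rewrite map_inj_uniq ?enum_uniq//; exact: val_inj.
by rewrite mem_enum finset.inE mem_iota.
Qed.

Section least_squares.
Context {R : realType} (n m : nat) (W : 'M[R]_(n, m)).

Let A := W^T *m W.

Lemma gram_unit : (forall u : 'cV[R]_m, W *m u = 0 -> u = 0) -> A \in unitmx.
Proof.
move=> injW; rewrite -row_free_unit; apply: inj_row_free => v vA.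
have E : A *m v^T = 0.
  by have := congr1 trmx vA; rewrite trmx_mul /A trmx_mul trmxK linear0.
have /eqP : sqn (W *m v^T) = 0 by rewrite /sqn dot_adj mulmxA -/A E dot0l.
rewrite sqn_eq0 => /eqP/injW/(congr1 trmx).
by rewrite trmxK linear0.
Qed.

Hypothesis A_unit : A \in unitmx.

Let G := invmx A *m W^T.
Let H := W *m G.

Lemma invmx_gram_sym : (invmx A)^T = invmx A.
Proof. by rewrite trmx_inv /A trmx_mul trmxK. Qed.

Lemma hat_sym : H^T = H.
Proof. by rewrite /H /G !trmx_mul trmxK invmx_gram_sym mulmxA. Qed.

Lemma hat_idem : H *m H = H.
Proof.
rewrite /H /G -!mulmxA (mulmxA W^T W) -/A (mulmxA A) mulmxV// mul1mx//.
Qed.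

Lemma hat_trace : \tr H = m%:R.
Proof. by rewrite /H mxtrace_mulC /G -mulmxA -/A mulVmx// mxtrace1. Qed.

Lemma hat_rows : \sum_i sqn (row i H)^T = m%:R.
Proof.
rewrite -hat_trace -[in RHS]hat_idem; apply: eq_bigr => i _.
rewrite mxE sqnE; apply: eq_bigr => j _.
have -> : (row i H)^T j 0 = H i j by rewrite [LHS]mxE [LHS]mxE.
by rewrite expr2; congr (_ * _); rewrite -{1}hat_sym [LHS]mxE.
Qed.

(** Row k of G gives the kth least-squares coefficient as a linear form in the response; its squared
    norm is the variance factor in the t-statistic. *)
Lemma coef_row k : sqn (row k G)^T = invmx A k k.
Proof.
have <- : G *m G^T = invmx A.
  by rewrite /G trmx_mul trmxK invmx_gram_sym mulmxA -(mulmxA _ W^T W) -/A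
    mulVmx// mul1mx.
by rewrite mxE sqnE; apply: eq_bigr => i _; rewrite !mxE expr2.
Qed.

Lemma normal_equations (Y : 'cV[R]_n) : W^T *m (Y - W *m (G *m Y)) = 0.
Proof.
by rewrite mulmxBr mulmxA -/A /G mulmxA (mulmxA A) mulmxV// mul1mx subrr.
Qed.

Lemma least_squares_opt (Y : 'cV[R]_n) (u : 'cV[R]_m) :
  sqn (Y - W *m (G *m Y)) <= sqn (Y - W *m u).
Proof.
have -> : Y - W *m u = (Y - W *m (G *m Y)) + W *m (G *m Y - u).
  by rewrite mulmxBr; rewrite addrA subrK.
rewrite [leRHS]sqnD dot_adj normal_equations dot0l.
by rewrite mulr0 addr0 lerDl sqn_ge0.
Qed.

Lemma least_squares_linear (u : 'cV[R]_m) (e : 'cV[R]_n) :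
  G *m (W *m u + e) = u + G *m e.
Proof.
by rewrite mulmxDr mulmxA /G -(mulmxA _ W^T W) -/A mulVmx// mul1mx.
Qed.

Lemma least_squares_residual (u : 'cV[R]_m) (e : 'cV[R]_n) :
  sqn (W *m u + e - W *m (G *m (W *m u + e))) = sqn e - sqn (H *m e).
Proof.
rewrite least_squares_linear mulmxDr opprD addrACA subrr add0r.
rewrite mulmxA -/H sqnB; have -> : dot e (H *m e) = sqn (H *m e).
  by rewrite /sqn [RHS]dot_adj mulmxA hat_sym hat_idem dotC.
ring.
Qed.

(** With w the kth column of the inverse Gram matrix, the squared norm of W w equals w_k, while that
    of w is at least w_k^2. *)
Lemma invmx_diag_bounds (a : R) k : 0 < a ->
  (forall u, a * sqn u <= sqn (W *m u)) -> 0 < invmx A k k <= a^-1.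
Proof.
move=> a0 Ha; pose w : 'cV[R]_m := invmx A *m delta_mx k 0.
have wk : w k 0 = invmx A k k.
  rewrite mxE (bigD1 k)//= big1 ?addr0.
    by rewrite mxE !eqxx mulr1.
  by move=> j /negbTE jk; rewrite mxE jk mulr0.
have Aw : A *m w = delta_mx k 0 by rewrite mulmxA mulmxV// mul1mx.
have E : sqn (W *m w) = w k 0.
  rewrite /sqn dot_adj mulmxA -/A Aw /dot (bigD1 k)//= big1 ?addr0.
    by rewrite mxE !eqxx mul1r.
  by move=> j /negbTE jk; rewrite mxE jk mul0r.
have Hw := Ha w; rewrite E wk in Hw.
have sw : invmx A k k ^+ 2 <= sqn w by rewrite -wk sqr_le_sqn.
have v0 : 0 < invmx A k k.
  rewrite lt_neqAle; apply/andP; split; last first.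
    by rewrite -wk -E sqn_ge0.
  apply/eqP => v0; rewrite -v0 in Hw.
  have : sqn w == 0.
    by rewrite eq_le sqn_ge0 andbT -(ler_pM2l a0) mulr0.
  rewrite sqn_eq0 => /eqP w0; have := Aw; rewrite w0 mulmx0 => /matrixP/(_ k 0).
  by rewrite !mxE !eqxx => /eqP; rewrite eq_sym oner_eq0.
rewrite v0/= -(ler_pM2l v0) -expr2; apply: (le_trans sw).
by rewrite ler_pdivlMr// mulrC.
Qed.

End least_squares.

(** * Screening and cross-validation on a deterministic event *)

Section model_selection.
Context {R : realType} (n p : nat) (X1 X2 : 'M[R]_(n, p)) (e1 e2 : 'cV[R]_n)
  (beta : 'cV[R]_p) (Sig : nat -> nat -> R) (gam : nat -> R) (q k : nat)
  (kap C0 eta psi mu0 : R).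

Let Y1 := X1 *m beta + e1.
Let Y2 := X2 *m beta + e2.
Let D := active_set beta.
Let J : {set 'I_p} := [set j : 'I_p | (j < q)%N]%SET.

Definition pop_form (v : 'cV[R]_p) : R := \sum_i \sum_j v i 0 * v j 0 * Sig i j.

(** The event on which the selection argument is deterministic: finitely many empirical averages,
    over coordinates below q, are within eta of their means. *)
Definition entries_close (X : 'M[R]_(n, p)) (e : 'cV[R]_n) :=
  (forall j l : 'I_p, (j < q)%N -> (l < q)%N ->
    `|n%:R^-1 * (\sum_i X i j * X i l) - Sig j l| <= eta) /\
  (forall j : 'I_p, (j < q)%N -> `|n%:R^-1 * \sum_i X i j * e i 0| <= eta).

Hypothesis n_gt0 : (0 < n)%N.
Hypothesis kap0 : 0 < kap.
Hypothesis C00 : 0 <= C0.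
Hypothesis eta0 : 0 <= eta.
Hypothesis psi0 : 0 < psi.
Hypothesis mu00 : 0 < mu0.
Hypothesis qk : (q <= k)%N.
Hypothesis Sig_lb : forall v, supported J v -> kap * sqn v <= pop_form v.
Hypothesis Sig_ub : forall v, supported J v -> pop_form v <= C0 * sqn v.
Hypothesis DJ : forall j : 'I_p, j \in D -> (j < q)%N.
Hypothesis D_psi : forall j : 'I_p, j \in D -> psi <= `|beta j 0|.
Hypothesis D_gam : forall j : 'I_p, j \in D -> mu0 <= `|gam j|.
Hypothesis gam_small : forall j : 'I_p, (q <= j)%N -> `|gam j| < mu0 / 2.
Hypothesis close1 : entries_close X1 e1.
Hypothesis close2 : entries_close X2 e2.
Hypothesis marg : forall j, `|marginal X1 Y1 j - gam j| <= mu0 / 4.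

(** Noise level left over by Young's inequality in [cross_close]: 2 eta^2 / kap for each coordinate
    below q. *)
Let E := 2 * q%:R * eta ^+ 2 / kap.

Hypothesis eta_small1 : q%:R * eta <= kap / 2.
Hypothesis eta_small2 : (10 + 8 * C0 / kap) * E < kap * psi ^+ 2 / 4.

Let a (X : 'M[R]_(n, p)) v := n%:R^-1 * sqn (X *m v).

Let cardJ : #|J|%:R <= q%:R :> R.
Proof. by rewrite ler_nat card_below. Qed.

Let supp_sum (v : 'cV[R]_p) (f : 'I_p -> R) : supported J v ->
  (forall j, v j 0 = 0 -> f j = 0) -> \sum_j f j = \sum_(j in J) f j.
Proof.
move=> sv fv; rewrite (bigID (mem J))/= [X in _ + X]big1 ?addr0// => j jJ.
by apply/fv/sv.
Qed.

Let sqn_supp (v : 'cV[R]_p) : supported J v -> sqn v = \sum_(j in J) v j 0 ^+ 2.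
Proof. by move=> sv; rewrite sqnE (supp_sum sv)// => j ->; rewrite expr0n. Qed.

(** Each entry contributes at most eta |v_j| |v_l|, and 2 |v_j| |v_l| <= v_j^2 + v_l^2 costs one
    factor q. *)
Lemma entries_close_form X e v : entries_close X e -> supported J v ->
  `|n%:R^-1 * sqn (X *m v) - pop_form v| <= q%:R * eta * sqn v.
Proof.
move=> [cX _] sv.
rewrite gram_form /pop_form -sumrB.
under eq_bigr do rewrite -sumrB.
under eq_bigr do under eq_bigr do rewrite -mulrBr.
rewrite (supp_sum sv); last first.
  by move=> j vj; rewrite big1// => l _; rewrite vj !mul0r.
have -> : \sum_(j in J) \sum_l v j 0 * v l 0 *
      (n%:R^-1 * (\sum_i X i j * X i l) - Sig j l) =
    \sum_(j in J) \sum_(l in J) v j 0 * v l 0 *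
      (n%:R^-1 * (\sum_i X i j * X i l) - Sig j l).
  apply: eq_bigr => j _; rewrite (supp_sum sv)// => l vl.
  by rewrite vl mulr0 mul0r.
apply: (le_trans (ler_norm_sum _ _ _)).
apply: (@le_trans _ _ (\sum_(j in J) \sum_(l in J)
    (eta / 2 * v j 0 ^+ 2 + eta / 2 * v l 0 ^+ 2))).
  apply: ler_sum => j jJ; apply: (le_trans (ler_norm_sum _ _ _)).
  apply: ler_sum => l lJ; rewrite !normrM.
  have H := cX j l; rewrite !finset.inE in jJ lJ.
  have {}H := H jJ lJ.
  apply: (le_trans (ler_wpM2l _ H)); first by rewrite mulr_ge0.
  have := sqr_ge0 (`|v j 0| - `|v l 0|).
  rewrite sqrrB !real_normK ?num_real// -mulr_natl => h.
  have : 0 <= eta * (v j 0 ^+ 2 - 2 * (`|v j 0| * `|v l 0|) + v l 0 ^+ 2).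
    by rewrite mulr_ge0.
  lra.
rewrite (eq_bigr (fun j => eta / 2 * v j 0 ^+ 2 * #|J|%:R + eta / 2 * sqn v)); last first.
  move=> j _; rewrite big_split/= sumr_const -[X in X + _]mulr_natr -mulr_sumr.
  by rewrite -sqn_supp.
rewrite big_split/= -mulr_suml -mulr_sumr -sqn_supp// sumr_const -mulr_natr.
have : 0 <= (q%:R - #|J|%:R) * (eta * sqn v).
  by rewrite mulr_ge0 ?mulr_ge0 ?sqn_ge0// subr_ge0.
lra.
Qed.

(** Young's inequality in each coordinate. The weight kap / 8 is such that twice the cross term uses
    up half of the curvature kap / 2 given by [a_lb]. *)
Let cross_close X e v : entries_close X e -> supported J v ->
  `|n%:R^-1 * dot e (X *m v)| <= E + kap / 8 * sqn v.
Proof.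
move=> [_ cX] sv.
have -> : n%:R^-1 * dot e (X *m v) =
    \sum_(j in J) v j 0 * (n%:R^-1 * \sum_i X i j * e i 0).
  rewrite -(supp_sum sv); last by move=> j ->; rewrite mul0r.
  rewrite /dot mulr_sumr.
  transitivity (\sum_i \sum_j n%:R^-1 * (v j 0 * (X i j * e i 0))).
    apply: eq_bigr => i _; rewrite mxE !mulr_sumr.
    by apply: eq_bigr => j _; ring.
  rewrite exchange_big; apply: eq_bigr => j _ /=.
  by rewrite !mulr_sumr; apply: eq_bigr => i _; ring.
apply: (le_trans (ler_norm_sum _ _ _)).
apply: (@le_trans _ _ (\sum_(j in J) (2 * eta ^+ 2 / kap + kap / 8 * v j 0 ^+ 2))).
  apply: ler_sum => j jJ; rewrite normrM finset.inE in jJ *.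
  apply: (le_trans (ler_wpM2l _ (cX j jJ))) => //.
  rewrite -[v j 0 ^+ 2]real_normK ?num_real//; set z := `|v j 0|.
  have -> : 2 * eta ^+ 2 / kap + kap / 8 * z ^+ 2 =
      z * eta + (4 * eta - kap * z) ^+ 2 / (8 * kap) by field; rewrite gt_eqF.
  by rewrite lerDl divr_ge0 ?sqr_ge0 ?mulr_ge0// ltW.
rewrite big_split/= sumr_const -mulr_sumr -sqn_supp// lerD2r /E -[X in X <= _]mulr_natl.
rewrite -!mulrA !(mulrCA _ 2) ler_pM2l// ler_wpM2r//.
by rewrite mulr_ge0// divr_ge0// ltW.
Qed.

Let a_lb X e v : entries_close X e -> supported J v -> kap / 2 * sqn v <= a X v.
Proof.
move=> cX sv; have := entries_close_form cX sv; rewrite -/(a X v) ler_norml => /andP[+ _].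
have := Sig_lb sv; have := ler_wpM2r (sqn_ge0 v) eta_small1; lra.
Qed.

Let a_ub X e v : entries_close X e -> supported J v ->
  a X v <= (C0 + kap / 2) * sqn v.
Proof.
move=> cX sv; have := entries_close_form cX sv; rewrite -/(a X v) ler_norml => /andP[_].
have := Sig_ub sv; have := ler_wpM2r (sqn_ge0 v) eta_small1; lra.
Qed.

Let fit lam := screen_fit X1 Y1 lam.

Let fitE lam : X1 *m fit lam =
  submx_cols X1 (screen X1 Y1 lam) *m ols X1 Y1 (screen X1 Y1 lam).
Proof.
rewrite -(submx_restrict X1 (supported_extend (ols X1 Y1 (screen X1 Y1 lam)))).
by rewrite restrict_extend.
Qed.

Let marg_D (j : 'I_p) : j \in D -> 3 / 4 * mu0 <= `|marginal X1 Y1 j|.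
Proof.
move=> jD; have := D_gam jD; have := marg j.
have := ler_distD (marginal X1 Y1 j) (gam j) 0; rewrite !subr0 distrC; lra.
Qed.

Let marg_J (j : 'I_p) : 3 / 4 * mu0 <= `|marginal X1 Y1 j| -> (j < q)%N.
Proof.
move=> Hj; rewrite ltnNge; apply/negP => /gam_small; have := marg j.
have := ler_distD (gam j) (marginal X1 Y1 j) 0; rewrite !subr0; lra.
Qed.

(* the selected sets are nested, hence one that misses part of D has a large
   threshold and is contained in the fixed set J *)
Let screen_J lam : ~~ (D \subset screen X1 Y1 lam) ->
  forall j, j \in screen X1 Y1 lam -> (j < q)%N.
Proof.
move=> /fintype.subsetPn[j0 j0D]; rewrite finset.inE -ltNge => lj0 j.
rewrite finset.inE => lj; apply: marg_J; apply: le_trans lj.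
by apply: ltW; apply: le_lt_trans lj0; exact: marg_D.
Qed.

Let supported_diff lam : (forall j, j \in screen X1 Y1 lam -> (j < q)%N) ->
  supported J (fit lam - beta).
Proof.
move=> H j jJ; rewrite mxE (supported_extend (M := screen X1 Y1 lam)); last first.
  by apply: contra jJ => /H jq; rewrite finset.inE.
rewrite add0r mxE; apply/eqP; rewrite oppr_eq0; apply/negPn/negP => bj.
by move: jJ; rewrite finset.inE DJ// finset.inE.
Qed.

Let missed lam : ~~ (D \subset screen X1 Y1 lam) ->
  psi ^+ 2 <= sqn (fit lam - beta).
Proof.
move=> /fintype.subsetPn[j jD jM]; apply: le_trans (sqr_le_sqn _ j).
rewrite mxE (supported_extend (M := screen X1 Y1 lam))// add0r mxE sqrrN.
rewrite -[leRHS]real_normK ?num_real// ler_sqr ?nnegrE//; last exact: ltW.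
exact: D_psi.
Qed.

(** With marginals known up to mu0 / 4, this threshold separates D, where they are at least mu0 -
    mu0 / 4, from the coordinates beyond q, where they are below mu0 / 2 + mu0 / 4. *)
Let lam0 := 3 / 4 * mu0.

Let screen0_D : D \subset screen X1 Y1 lam0.
Proof. by apply/fintype.subsetP => j jD; rewrite finset.inE marg_D. Qed.

Let screen0_J j : j \in screen X1 Y1 lam0 -> (j < q)%N.
Proof. by rewrite finset.inE => /marg_J. Qed.

Let admissible0 : admissible X1 Y1 k lam0.
Proof.
rewrite /admissible/=; apply: leq_trans qk; rewrite -(ler_nat R).
apply: le_trans cardJ; rewrite ler_nat; apply: subset_leq_card.
by apply/fintype.subsetP => j /screen0_J; rewrite finset.inE.
Qed.

(** Basic inequality of least squares: the set selected at [lam0] contains D, so beta is a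
    competitor of the fit. Hence the loss is at most twice the cross term, of which half the loss is
    reabsorbed. *)
Let fit0_loss : a X1 (fit lam0 - beta) <= 4 * E.
Proof.
set v := fit lam0 - beta.
have sv : supported J v by apply: supported_diff; exact: screen0_J.
pose M := screen X1 Y1 lam0; pose W := submx_cols X1 M.
have inj (u : 'cV[R]_#|M|) : W *m u = 0 -> u = 0.
  move=> Wu; have su : supported J (extend u).
    move=> j jJ; apply: supported_extend; apply: contra jJ => /screen0_J.
    by rewrite finset.inE.
  have := a_lb close1 su; rewrite /a.
  rewrite -(submx_restrict X1 (supported_extend u)) restrict_extend Wu.
  rewrite (_ : sqn 0 = 0); last by apply/eqP; rewrite sqn_eq0.
  rewrite mulr0 pmulr_rle0 ?divr_gt0// => H.
  have : sqn (extend u) == 0 by rewrite eq_le sqn_ge0 andbT.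
  rewrite -(sqn_restrict (supported_extend u)) restrict_extend sqn_eq0.
  by move/eqP.
have sb : supported M beta.
  move=> j jM; apply/eqP; apply: contraT => bj.
  by have := fintype.subsetP screen0_D j; rewrite finset.inE bj (negbTE jM) => /(_ isT).
have := least_squares_opt (gram_unit inj) Y1 (restrict_to M beta).
rewrite (submx_restrict X1 sb).
have -> : Y1 - W *m (invmx (W^T *m W) *m W^T *m Y1) = e1 - X1 *m v.
  have -> : W *m (invmx (W^T *m W) *m W^T *m Y1) = X1 *m fit lam0.
    by rewrite fitE /ols !mulmxA.
  by rewrite /v mulmxBr opprB addrA [e1 + _]addrC.
have -> : Y1 - X1 *m beta = e1 by rewrite /Y1 addrAC subrr add0r.
rewrite sqnB => H.
have := cross_close close1 sv; rewrite ler_norml => /andP[_ Hc].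
have ni : 0 <= n%:R^-1 :> R by rewrite invr_ge0.
have H2 : a X1 v <= 2 * (n%:R^-1 * dot e1 (X1 *m v)).
  have H' : sqn (X1 *m v) <= 2 * dot e1 (X1 *m v) by lra.
  by have := ler_wpM2l ni H'; rewrite /a mulrCA.
have := a_lb close1 sv; lra.
Qed.

Let E0 : 0 <= E.
Proof. by rewrite divr_ge0 ?mulr_ge0 ?sqr_ge0// ltW. Qed.

Let C0E : 0 <= C0 / kap * E.
Proof. by rewrite mulr_ge0// divr_ge0// ltW. Qed.

Let true_lossE lam : true_loss X1 Y1 beta lam = a X1 (fit lam - beta).
Proof.
rewrite /true_loss /a; congr (_ * _).
by rewrite /sqn -dotE trmx_mul !mulmxA.
Qed.

(** A set missing an index of D has loss at least kap psi^2 / 2, against at most 4 E at [lam0]. *)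
Lemma true_loss_minimizer lam :
  minimizes (admissible X1 Y1 k) (true_loss X1 Y1 beta) lam ->
  D \subset screen X1 Y1 lam.
Proof.
move=> [_ /(_ _ admissible0)]; rewrite !true_lossE => Hmin.
apply: contraT => miss; have psi2 := missed miss.
have := a_lb close1 (supported_diff (screen_J miss)).
have kp := ler_wpM2l (ltW kap0) psi2.
have := fit0_loss; have := C0E; have := E0; have := eta_small2; lra.
Qed.

Let cv_lossE lam : cv_loss X1 Y1 X2 Y2 lam = n%:R^-1 * sqn e2 -
  2 * (n%:R^-1 * dot e2 (X2 *m (fit lam - beta))) + a X2 (fit lam - beta).
Proof.
rewrite /cv_loss.
have -> : \sum_i (Y2 i 0 - (X2 *m screen_fit X1 Y1 lam) i 0) ^+ 2 =
    sqn (e2 - X2 *m (fit lam - beta)).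
  have -> : e2 - X2 *m (fit lam - beta) = Y2 - X2 *m fit lam.
    by rewrite /Y2 mulmxBr opprB addrA [_ + e2]addrC.
  by rewrite sqnE; apply: eq_bigr => i _; rewrite [in RHS]mxE [X in _ = (_ + X) ^+ 2]mxE.
by rewrite sqnB /a; ring.
Qed.

(** The noise norm is common to all thresholds and cancels. Missing an index leaves at least kap
    psi^2 / 4 - 2 E; at [lam0] the estimation error sq0 satisfies kap sq0 <= 8 E, and the remaining
    loss is at most 2 E + (C0 + 3 kap / 4) sq0. This is the origin of the constants 10 and 8 C0 /
    kap in [eta_small2]. *)
Lemma cv_loss_minimizer lam :
  minimizes (admissible X1 Y1 k) (cv_loss X1 Y1 X2 Y2) lam ->
  D \subset screen X1 Y1 lam.
Proof.
move=> [_ /(_ _ admissible0)]; rewrite !cv_lossE => Hmin.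
apply: contraT => miss; have psi2 := missed miss.
have sm := supported_diff (screen_J miss).
have s0 : supported J (fit lam0 - beta) by apply: supported_diff; exact: screen0_J.
have := a_lb close2 sm; have := cross_close close2 sm; rewrite ler_norml => /andP[_].
have := a_ub close2 s0; have := cross_close close2 s0; rewrite ler_norml => /andP[+ _].
have := a_lb close1 s0; have F := fit0_loss.
have kp := ler_wpM2l (ltW kap0) psi2.
move: Hmin; set am := a X2 _; set bm := n%:R^-1 * dot e2 _; set sqm := sqn _.
set a0 := a X2 _; set b0 := n%:R^-1 * dot e2 _; set sq0 := sqn (fit lam0 - beta).
set se := sqn e2; move=> Hmin h1 h2 h3 h4 h5.
have sq0E : kap * sq0 <= 8 * E by lra.
have sq1E : C0 * sq0 <= 8 * (C0 / kap * E).
  have := ler_wpM2l (_ : 0 <= C0 / kap) sq0E.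
  have -> : C0 / kap * (kap * sq0) = C0 * sq0 by field; rewrite gt_eqF.
  by rewrite divr_ge0 ?(ltW kap0)// => /(_ isT); lra.
have := E0; have := eta_small2; rewrite -/psi; lra.
Qed.

End model_selection.

(** * Exact recovery by cleaning on a deterministic event *)

Lemma double_sub_ge (m n : nat) : (2 * m <= n)%N -> (n <= 2 * (n - m))%N.
Proof. lia. Qed.

Section cleaning.
Context {R : realType} (n p : nat) (X : 'M[R]_(n, p)) (e : 'cV[R]_n)
  (beta : 'cV[R]_p) (M : {set 'I_p}).

Let W := submx_cols X M.
Let G := invmx (W^T *m W) *m W^T.

Lemma submx_unit : (forall v, supported M v -> X *m v = 0 -> v = 0) ->
  W^T *m W \in unitmx.
Proof.
move=> inj; apply: gram_unit => u Wu; rewrite -(restrict_extend u).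
rewrite (inj (extend u)); first by apply/matrixP => i j; rewrite !mxE.
  exact: supported_extend.
by rewrite -(submx_restrict X (supported_extend u)) restrict_extend.
Qed.

Variables (sigma c delta kap psi alpha : R).
Let Y := X *m beta + e.
Let D := active_set beta.
Hypothesis n_gt0 : (0 < n)%N.
Hypothesis sigma0 : 0 < sigma.
Hypothesis kap0 : 0 < kap.
Hypothesis psi0 : 0 < psi.
Hypothesis delta01 : 0 <= delta < 1.
Hypothesis DM : D \subset M.
Hypothesis m_small : (2 * #|M| <= n)%N.
Hypothesis D_psi : forall j : 'I_p, j \in D -> psi <= `|beta j 0|.
Hypothesis X_lb : forall v, supported M v -> kap * sqn v <= n%:R^-1 * sqn (X *m v).
Hypothesis c_quantile : c = normal_upper_quantile (alpha / (2 * #|M|%:R)).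
Hypothesis c0 : 0 <= c.
Hypothesis c_small : 9 * sigma ^+ 2 * c ^+ 2 < psi ^+ 2 * (n%:R * kap).
Hypothesis noise_coord : forall k,
  `|(G *m e) k 0| <= sigma * Num.sqrt (invmx (W^T *m W) k k) * (c * (1 - delta)).
Hypothesis noise_proj :
  sqn (W *m G *m e) <= sigma ^+ 2 * n%:R * (delta / 2).
Hypothesis noise_norm :
  `|sqn e - n%:R * sigma ^+ 2| <= sigma ^+ 2 * n%:R * (delta / 2).

Let nR0 : 0 < n%:R :> R. Proof. by rewrite ltr0n. Qed.

Let W_lb u : n%:R * kap * sqn u <= sqn (W *m u).
Proof.
have := X_lb (supported_extend u).
rewrite -(submx_restrict X (supported_extend u)).
rewrite -(sqn_restrict (supported_extend u)) restrict_extend.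
by rewrite -(ler_pM2l nR0) !mulrA mulfV ?mul1r ?gt_eqF.
Qed.

Let A_unit : W^T *m W \in unitmx.
Proof.
apply: submx_unit => v sv Xv; have := X_lb sv; rewrite Xv.
rewrite (_ : sqn 0 = 0); last by apply/eqP; rewrite sqn_eq0.
rewrite mulr0 pmulr_rle0// => H; apply/eqP.
by rewrite -sqn_eq0 eq_le H sqn_ge0.
Qed.

Let YE : Y = W *m restrict_to M beta + e.
Proof.
rewrite /Y (submx_restrict X)// => j jM; apply/eqP; apply: contraT => bj.
by have := fintype.subsetP DM j; rewrite finset.inE bj (negbTE jM) => /(_ isT).
Qed.

Let olsE : ols X Y M = restrict_to M beta + G *m e.
Proof. by rewrite /ols mulmxA YE least_squares_linear. Qed.

Let varE : residual_variance X Y M =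
  (n - #|M|)%:R^-1 * (sqn e - sqn (W *m G *m e)).
Proof.
rewrite /residual_variance; congr (_ * _).
rewrite -(least_squares_residual A_unit (restrict_to M beta) e) -YE sqnE /ols.
by apply: eq_bigr => i _; rewrite !mulmxA.
Qed.

Let s := Num.sqrt (residual_variance X Y M).

Let nm_bounds : (n%:R <= 2 * (n - #|M|)%:R :> R) /\ ((n - #|M|)%:R <= n%:R :> R).
Proof.
split; last by rewrite ler_nat leq_subr.
by rewrite -natrM ler_nat double_sub_ge.
Qed.

(** The noise norm and its projection each lose a share delta / 2 of n sigma^2, and n - |M| <= n
    gives the lower bound. For the upper one, n <= 2 (n - |M|). *)
Let var_bounds : sigma ^+ 2 * (1 - delta) <= residual_variance X Y M <= 4 * sigma ^+ 2.
Proof.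
have [nm1 nm2] := nm_bounds; rewrite varE.
have nm0 : 0 < (n - #|M|)%:R :> R by have := nR0; lra.
have s20 : 0 < sigma ^+ 2 by rewrite exprn_gt0.
have /andP[d0 d1] := delta01.
have := noise_norm; rewrite ler_norml => /andP[h1 h2].
have := noise_proj; have := sqn_ge0 (W *m G *m e) => h3 h4.
rewrite [_ * (sqn e - _)]mulrC ler_pdivlMr// ler_pdivrMr//; apply/andP; split.
  have : sigma ^+ 2 * (1 - delta) * (n - #|M|)%:R <= sigma ^+ 2 * (1 - delta) * n%:R.
    by rewrite ler_wpM2l// mulr_ge0 ?ltW//; lra.
  lra.
have : sigma ^+ 2 * n%:R <= sigma ^+ 2 * (2 * (n - #|M|)%:R) by rewrite ler_pM2l.
have : sigma ^+ 2 * n%:R * (delta / 2) <= sigma ^+ 2 * n%:R * (1 / 2).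
  by rewrite ler_wpM2l// ?mulr_ge0 ?ltW//; lra.
lra.
Qed.

Let s_bounds : sigma * (1 - delta) <= s <= 2 * sigma.
Proof.
have /andP[v1 v2] := var_bounds; have /andP[d0 d1] := delta01.
have s20 : 0 < sigma ^+ 2 by rewrite exprn_gt0.
have v0 : 0 <= residual_variance X Y M.
  by apply: le_trans v1; rewrite mulr_ge0 ?ltW//; lra.
have d2 : 0 <= sigma * (1 - delta) by rewrite mulr_ge0 ?ltW//; lra.
rewrite -(ger0_norm d2) -sqrtr_sqr ler_sqrt//; apply/andP; split.
  apply: le_trans v1; rewrite exprMn ler_pM2l//.
  have : 0 <= delta * (1 - delta) by rewrite mulr_ge0//; lra.
  lra.
have s2 : 0 <= 2 * sigma by rewrite mulr_ge0// ltW.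
rewrite -(ger0_norm s2) -sqrtr_sqr ler_sqrt ?sqr_ge0//.
by apply: (le_trans v2); rewrite exprMn; lra.
Qed.

(** For an inactive index the margin 1 - delta in the noise bound is compensated by the same factor
    in the lower bound on the residual deviation, so its statistic is at most c. For an active index
    psi exceeds both the threshold and the noise. *)
Lemma clean_exact : clean X Y M alpha = D.
Proof.
have /andP[s1 s2] := s_bounds; have /andP[d0 d1] := delta01.
have s0 : 0 < s by apply: lt_le_trans s1; rewrite mulr_gt0//; lra.
have key (k : 'I_#|M|) : (c < `|t_stat X Y k|) = (enum_val k \in D).
  have nk0 : 0 < n%:R * kap by rewrite mulr_gt0.
  have /andP[v0 vub] := invmx_diag_bounds A_unit k nk0 W_lb.
  rewrite /t_stat olsE -/W -/s; set r := Num.sqrt (invmx (W^T *m W) k k).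
  have r0 : 0 < r by rewrite sqrtr_gt0.
  have r2 : r ^+ 2 * (n%:R * kap) <= 1.
    by rewrite sqr_sqrtr ?(ltW v0)// -ler_pdivlMr// mul1r.
  have sr0 : 0 < s * r by rewrite mulr_gt0.
  rewrite normrM normfV (gtr0_norm sr0) ltr_pdivlMr// !mxE -/(_ k 0).
  have := noise_coord k; rewrite -/r => Hk.
  have [jD|jD] := boolP (enum_val k \in D).
    have crs : c * (s * r) <= c * (2 * sigma * r).
      by rewrite ler_wpM2l// ler_wpM2r// ltW.
    (* Of the factor 3, two units are the threshold, since s <= 2 sigma, and one is the noise of the
       coefficient; r is at most (n kap)^(-1/2). *)
    have H3 : 3 * sigma * c * r < psi.
      have h0 : 0 <= 3 * sigma * c * r by rewrite !mulr_ge0// ltW.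
      rewrite -ltr_sqr ?nnegrE ?(ltW psi0)//.
      rewrite -(ltr_pM2r nk0); apply: le_lt_trans c_small.
      rewrite (_ : (3 * sigma * c * r) ^+ 2 * (n%:R * kap) =
        9 * sigma ^+ 2 * c ^+ 2 * (r ^+ 2 * (n%:R * kap))); last by ring.
      by rewrite ler_piMr// mulr_ge0 ?sqr_ge0// mulr_ge0 ?sqr_ge0.
    have Hb := D_psi jD.
    have : sigma * r * (c * (1 - delta)) <= sigma * r * c.
      apply: ler_wpM2l; first by rewrite mulr_ge0 ?ltW.
      by apply: ler_piMr => //; lra.
    have := lerB_normD (beta (enum_val k) 0) ((G *m e) k 0).
    rewrite [(G *m e) k 0]mxE in Hk *; lra.
  have -> : beta (enum_val k) 0 = 0.
    by apply/eqP; move: jD; rewrite finset.inE negbK.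
  apply/negbTE; rewrite -leNgt add0r; rewrite [(G *m e) k 0]mxE in Hk.
  apply: (le_trans Hk).
  have := ler_wpM2r (mulr_ge0 c0 (ltW r0)) s1; lra.
apply/setP => j; apply/imsetP/idP => [[k + ->]|jD].
  by rewrite finset.inE -c_quantile key.
have jM : j \in M by apply: (fintype.subsetP DM).
exists (enum_rank_in jM j); last by rewrite enum_rankK_in.
by rewrite finset.inE -c_quantile key enum_rankK_in.
Qed.

End cleaning.

(** * Exponential deviations *)

Section exponential_bounds.
Context {R : realType}.
Implicit Types x t : R.

(** The remainder x^2 exp |x| is the quantity whose mean is assumed bounded in all deviation lemmas
    below. *)
Lemma expR_taylor1 x : expR x <= 1 + x + x ^+ 2 * expR `|x|.
Proof.
have e1 : expR x - 1 <= x * expR x.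
  have := ler_wpM2r (expR_ge0 x) (expR_ge1Dx (- x)).
  by rewrite -expRD addNr expR0; lra.
have [x0|x0] := leP 0 x.
  rewrite (ger0_norm x0).
  have := ler_wpM2l x0 e1; have := expR_ge0 x; lra.
have : x ^+ 2 * 1 <= x ^+ 2 * expR `|x|.
  by rewrite ler_wpM2l ?sqr_ge0// -expR0 ler_expR.
have := expR_ge1Dx x => h.
have : 0 <= (- x) * (expR x - (1 + x)) by rewrite mulr_ge0; lra.
lra.
Qed.

Lemma sqr_le_expR x : 0 <= x -> x ^+ 2 <= 4 * expR x.
Proof.
move=> x0; have h := expR_ge1Dx (x / 2); have h2 : 0 <= 1 + x / 2 by lra.
have := ler_pM h2 h2 h h; rewrite -expRD -splitr; nra.
Qed.

Lemma norm_le_sqr_expR x : `|x| <= 1 + x ^+ 2 * expR `|x|.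
Proof.
have : x ^+ 2 * 1 <= x ^+ 2 * expR `|x|.
  by rewrite ler_wpM2l ?sqr_ge0// -expR0 ler_expR.
have := sqr_ge0 (`|x| - 1); have := sqr_ge0 `|x|.
rewrite -[x ^+ 2]real_normK ?num_real//; nra.
Qed.

End exponential_bounds.

Section level_sets.
Context {d : measure_display} (T : measurableType d) (R : realType).
Implicit Types f g : T -> R.

Lemma measurable_set_lt f g : measurable_fun setT f -> measurable_fun setT g ->
  measurable [set x | f x < g x].
Proof.
move=> mf mg; rewrite -[X in measurable X]setTI.
rewrite (_ : [set x | _] = (fun x => f x < g x) @^-1` [set true]).
  exact: measurable_fun_ltr.
by apply/seteqP; split.
Qed.

Lemma measurable_set_le f g : measurable_fun setT f -> measurable_fun setT g ->
  measurable [set x | f x <= g x].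
Proof.
move=> mf mg; rewrite -[X in measurable X]setTI.
rewrite (_ : [set x | _] = (fun x => f x <= g x) @^-1` [set true]).
  exact: measurable_fun_ler.
by apply/seteqP; split.
Qed.

Lemma measurable_set_eq f g : measurable_fun setT f -> measurable_fun setT g ->
  measurable [set x | f x = g x].
Proof.
move=> mf mg.
rewrite (_ : [set x | _] = [set x | f x <= g x] `&` [set x | g x <= f x]).
  by apply: measurableI; exact: measurable_set_le.
by apply/seteqP; split => x /= => [->|[h1 h2]]; [rewrite lexx|apply/eqP; rewrite eq_le h1].
Qed.

Lemma measurable_forall (I : finType) (A : I -> set T) :
  (forall i, measurable (A i)) -> measurable [set t | forall i, A i t].
Proof.
move=> mA; rewrite (_ : [set t | _] = \bigcap_(i in [set: I]) A i).
  by apply: fin_bigcap_measurable => // i _; exact: mA.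
by apply/seteqP; split => t /= H i; [move=> _; exact: H|exact: H].
Qed.

Lemma measurable_exists (I : finType) (A : I -> set T) :
  (forall i, measurable (A i)) -> measurable [set t | exists i, A i t].
Proof.
move=> mA; rewrite (_ : [set t | _] = \bigcup_(i in [set: I]) A i).
  by apply: fin_bigcup_measurable => // i _; exact: mA.
by apply/seteqP; split => t /= [i]; [exists i|move=> _; exists i].
Qed.

Lemma measurable_cst_imp (b : bool) (A : set T) :
  measurable A -> measurable [set t | b -> A t].
Proof.
move=> mA; case: b.
  by rewrite (_ : [set t | _] = A)//; apply/seteqP; split => t /=; [apply|].
by rewrite (_ : [set t | _] = setT)//; apply/seteqP; split.
Qed.

Lemma measurable_imp (A B : set T) : measurable A -> measurable B ->
  measurable [set t | A t -> B t].
Proof.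
move=> mA mB; rewrite (_ : [set t | _] = ~` A `|` B).
  by apply: measurableU => //; exact: measurableC.
apply/seteqP; split => t /=; last by move=> [|].
by move=> AB; have [/AB|] := pselect (A t); [right|left].
Qed.

End level_sets.

Section real_integrals.
Context {d : measure_display} (Omega : measurableType d) (R : realType)
  (P : probability Omega R).

Lemma ge0_integrable (g : Omega -> R) (K : R) :
  measurable_fun setT g -> (forall w, 0 <= g w) ->
  (\int[P]_w (g w)%:E <= K%:E)%E -> P.-integrable setT (EFin \o g).
Proof.
move=> mg g0 gK; apply/integrableP; split; first exact/measurable_EFinP.
apply: le_lt_trans (ltry K); apply: le_trans gK.
rewrite le_eqVlt; apply/orP; left; apply/eqP.
by apply: eq_integral => w _ /=; rewrite ger0_norm.
Qed.

Lemma integrable_le (f g : Omega -> R) :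
  measurable_fun setT f -> P.-integrable setT (EFin \o g) ->
  (forall w, `|f w| <= 1 + g w) -> P.-integrable setT (EFin \o f).
Proof.
move=> mf ig fg.
apply: (@le_integrable _ _ _ _ _ _ _ (cst 1%E \+ (EFin \o g))%E) => //.
- exact/measurable_EFinP.
- move=> w _ /=; rewrite lee_fin; apply: le_trans (ler_norm _); exact: fg.
- by apply: integrableD => //; exact: finite_measure_integrable_cst.
Qed.

Lemma ae_bounded_integrable (f : Omega -> R) (K : R) : measurable_fun setT f ->
  {ae P, forall w, `|f w| <= K} -> P.-integrable setT (EFin \o f).
Proof.
move=> mf fK; have mfE : measurable_fun setT (EFin \o f) by exact/measurable_EFinP.
apply/integrableP; split=> //; apply: (@le_lt_trans _ _ (\int[P]_w `|K|%:E)%E).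
  apply: ae_ge0_le_integral => //; first exact: measurableT_comp.
  apply: filterS fK => w fw _ /=; rewrite lee_fin; apply: le_trans fw _; exact: ler_norm.
by rewrite integral_cst// [X in (_ * X)%E]probability_setT mule1 ltry.
Qed.

Lemma integrable_sqr_expR (f : Omega -> R) (K : R) : measurable_fun setT f ->
  (\int[P]_w (f w ^+ 2 * expR `|f w|)%:E <= K%:E)%E ->
  P.-integrable setT (EFin \o (fun w => f w ^+ 2 * expR `|f w|)).
Proof.
move=> mf; apply: ge0_integrable => [|w]; last by rewrite mulr_ge0 ?sqr_ge0 ?expR_ge0.
apply: measurable_funM; first exact: measurable_funX.
by apply: measurableT_comp => //; apply: measurableT_comp.
Qed.

Lemma prob_markov (g : Omega -> R) (c b : R) :
  measurable_fun setT g -> (forall w, 0 <= g w) -> 0 < c ->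
  (\int[P]_w (g w)%:E <= b%:E)%E -> (P [set w | (c <= g w)%R] <= (b / c)%:E)%E.
Proof.
move=> mg g0 c0 gb; set A := [set w | _].
have mA : measurable A.
  rewrite -[A]setTI (_ : A = g @^-1` `[c, +oo[%classic); first exact: mg.
  by apply/seteqP; split => w /=; rewrite in_itv/= andbT.
have : (c%:E * P A <= b%:E)%E.
  apply: le_trans gb; rewrite -integral_cst//.
  apply: le_trans (_ : \int[P]_(w in A) (g w)%:E <= _)%E.
    apply: ge0_le_integral => //.
    - by move=> w _; rewrite lee_fin ltW.
    - by apply/measurable_EFinP; exact: measurable_funTS.
  apply: ge0_subset_integral => //; first exact/measurable_EFinP.
  by move=> w _; rewrite lee_fin.
have /fineK <- : P A \is a fin_num by exact: fin_num_measure.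
by rewrite -EFinM !lee_fin ler_pdivlMr// mulrC.
Qed.

End real_integrals.

Section deviations.
Context {d d' : measure_display} (Omega : measurableType d) (R : realType)
  (P : probability Omega R) (T : measurableType d') (N n : nat).
Variables (Z : 'I_N -> Omega -> T) (h : 'I_n -> 'I_N) (f : T -> R) (K : R) (t0 : T).
Hypothesis mZ : forall i, measurable_fun setT (Z i).
Hypothesis indZ : mutually_independent P Z.
Hypothesis h_inj : injective h.
Hypothesis mf : measurable_fun setT f.
Hypothesis f_mean : forall i, (\int[P]_w (f (Z (h i) w))%:E = 0)%E.
Hypothesis f_exp : forall i,
  (\int[P]_w (f (Z (h i) w) ^+ 2 * expR `|f (Z (h i) w)|)%:E <= K%:E)%E.

Let mfZ i : measurable_fun setT (fun w => f (Z i w)).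
Proof. exact: measurableT_comp (mf) (mZ i). Qed.

Let int_exp i : P.-integrable setT
  (EFin \o (fun w => f (Z (h i) w) ^+ 2 * expR `|f (Z (h i) w)|)).
Proof. exact: integrable_sqr_expR (f_exp i). Qed.

Let int_f i : P.-integrable setT (EFin \o (fun w => f (Z (h i) w))).
Proof. by apply: integrable_le (int_exp i) _ => // w; exact: norm_le_sqr_expR. Qed.

Lemma mgf_le t i : `|t| <= 1 ->
  (\int[P]_w (expR (t * f (Z (h i) w)))%:E <= (expR (K * t ^+ 2))%:E)%E.
Proof.
move=> t1.
pose g w := f (Z (h i) w) ^+ 2 * expR `|f (Z (h i) w)|.
have it : P.-integrable setT (fun w => (t%:E * (f (Z (h i) w))%:E)%E).
  by apply: integrableZl => //; exact: int_f.
have ig : P.-integrable setT (fun w => ((t ^+ 2)%:E * (g w)%:E)%E).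
  by apply: integrableZl => //; exact: int_exp.
have i1 : P.-integrable setT (cst (1%:E : \bar R)).
  exact: finite_measure_integrable_cst.
have itg := integrableD measurableT it ig.
apply: (@le_trans _ _ (\int[P]_w (1%:E + (t%:E * (f (Z (h i) w))%:E +
   (t ^+ 2)%:E * (g w)%:E)))%E).
  apply: ge0_le_integral => //.
  - by apply/measurable_EFinP; apply: measurableT_comp => //; exact: measurable_funM.
  - exact: measurable_int (integrableD measurableT i1 itg).
  - move=> w _; rewrite -!EFinM -!EFinD lee_fin /g; set x := f _.
    apply: le_trans (expR_taylor1 _) _; rewrite addrA lerD2l exprMn -mulrA.
    rewrite ler_wpM2l ?sqr_ge0// ler_wpM2l ?sqr_ge0// ler_expR normrM.
    by rewrite ler_piMl.
rewrite integralD// integralD//.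
have -> : (\int[P]__ 1%:E = 1)%E by rewrite integral_cst// mul1e; exact: probability_setT.
rewrite integralZl//; last exact: int_f.
rewrite f_mean mule0 add0e integralZl//; last exact: int_exp.
apply: (@le_trans _ _ (1%:E + (t ^+ 2)%:E * K%:E)%E).
  by rewrite leeD2l// lee_wpmul2l ?lee_fin ?sqr_ge0//; exact: f_exp.
by rewrite -EFinM -EFinD lee_fin [K * _]mulrC; exact: expR_ge1Dx.
Qed.

Lemma mgf_sum_le t : `|t| <= 1 ->
  (\int[P]_w (expR (t * \sum_i f (Z (h i) w)))%:E <=
   (expR (n%:R * (K * t ^+ 2)))%:E)%E.
Proof.
move=> t1; have mg : measurable_fun setT (fun x => expR (t * f x)).
  by apply: measurableT_comp => //; exact: measurable_funM.
have := expectation_prod mZ indZ (r := [seq h i | i <- enum 'I_n]) t0 _ mg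
  (fun x => expR_ge0 _).
rewrite map_inj_uniq ?enum_uniq// => /(_ isT) E.
have -> : (\int[P]_w (expR (t * \sum_i f (Z (h i) w)))%:E =
   \int[P]_w (\prod_(i <- [seq h i | i <- enum 'I_n]) expR (t * f (Z i w)))%:E)%E.
  apply: eq_integral => w _.
  by rewrite mulr_sumr expR_sum big_map big_enum.
rewrite E big_map big_enum/=.
apply: (@le_trans _ _ (\prod_(i < n) (expR (K * t ^+ 2))%:E)%E).
  apply: (@proj2 (0 <= \prod_(i in 'I_n) \int[P]_w (expR (t * f (Z (h i) w)))%:E)%E).
  apply: (big_ind2 (fun x y : \bar R => (0 <= x)%E /\ (x <= y)%E)) => //.
  - by move=> x1 x2 y1 y2 [? ?] [? ?]; split; [rewrite mule_ge0|exact: lee_pmul].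
  - move=> i _; split; last exact: mgf_le.
    by apply: integral_ge0 => w _; rewrite lee_fin expR_ge0.
by rewrite prodEFin big_const_ord iter_mulr_1 expRM_natl.
Qed.

Let S w := \sum_i f (Z (h i) w).

Let mS : measurable_fun setT S.
Proof. by apply: measurable_sum => i. Qed.

(** Chernoff: the exponent is n K t^2 - n delta t, and K t <= delta / 2 leaves half of the linear
    term. *)
Lemma upper_deviation (delta t : R) : 0 < t -> t <= 1 -> K * t <= delta / 2 ->
  (P [set w | (n%:R * delta <= S w)%R] <= (expR (- (n%:R * delta * t / 2)))%:E)%E.
Proof.
move=> t0' t1 Kt; have tn : `|t| <= 1 by rewrite ger0_norm// ltW.
have -> : [set w | n%:R * delta <= S w] =
  [set w | expR (t * (n%:R * delta)) <= expR (t * S w)].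
  by apply/seteqP; split => w /=; rewrite ler_expR ler_pM2l.
apply: le_trans (prob_markov _ _ _ (mgf_sum_le tn)) _; rewrite ?expR_gt0//.
- by apply: measurableT_comp => //; exact: measurable_funM.
rewrite lee_fin -expRN -expRD ler_expR.
have := ler_wpM2l (ler0n R n) (ler_wpM2r (ltW t0') Kt); lra.
Qed.

(** The inequality x^2 <= 4 exp |x| is used at x = S / sqrt n, where the exponential moments of both
    signs are at most exp K. *)
Lemma second_moment : (0 < n)%N ->
  (\int[P]_w (S w ^+ 2)%:E <= (8 * n%:R * expR K)%:E)%E.
Proof.
move=> n0; have n0R : 0 < n%:R :> R by rewrite ltr0n.
pose t := (Num.sqrt (n%:R : R))^-1.
have t1 : `|t| <= 1.
  rewrite ger0_norm ?invr_ge0 ?sqrtr_ge0// invf_le1 ?sqrtr_gt0//.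
  by rewrite -[leLHS]sqrtr1 ler_sqrt// ler1n.
have tt : t ^+ 2 = n%:R^-1 by rewrite exprVn sqr_sqrtr ?ltW.
have b (u : R) : `|u| = `|t| -> (\int[P]_w (expR (u * S w))%:E <= (expR K)%:E)%E.
  move=> ut; apply: le_trans (mgf_sum_le _) _; first by rewrite ut.
  rewrite -[u ^+ 2]real_normK ?num_real// ut real_normK ?num_real// tt.
  by rewrite mulrCA divff ?mulr1// gt_eqF.
have m (u : R) : measurable_fun setT (fun w => (expR (u * S w))%:E).
  by apply/measurable_EFinP; apply: measurableT_comp => //; exact: measurable_funM.
apply: (@le_trans _ _ (\int[P]_w ((4 * n%:R)%:E * ((expR (t * S w))%:E + (expR (- t * S w))%:E)))%E).
  apply: ge0_le_integral => //.
  - by move=> w _; rewrite lee_fin sqr_ge0.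
  - by apply/measurable_EFinP; exact: measurable_funX.
  - by apply: emeasurable_funM => //; apply: emeasurable_funD; exact: m.
  - move=> w _; rewrite -EFinD -EFinM lee_fin.
    have := sqr_le_expR (normr_ge0 (t * S w)); rewrite real_normK ?num_real//.
    rewrite exprMn tt [_^-1 * _]mulrC ler_pdivrMr// => /le_trans; apply.
    rewrite mulrAC ler_wpM2l ?mulr_ge0//.
    have [x0|x0] := leP 0 (t * S w).
      by rewrite ger0_norm// lerDl expR_ge0.
    by rewrite ltr0_norm// mulNr lerDr expR_ge0.
rewrite ge0_integralZl//; last 2 first.
- by apply: emeasurable_funD; exact: m.
- by move=> w _; rewrite adde_ge0// lee_fin expR_ge0.
rewrite ge0_integralD//; try exact: m; try by move=> w _; rewrite lee_fin expR_ge0.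
rewrite (_ : 8 * n%:R * expR K = 4 * n%:R * (expR K + expR K)); last by ring.
rewrite [leRHS]EFinM; apply: lee_wpmul2l; first by rewrite lee_fin mulr_ge0.
by rewrite EFinD; apply: leeD; apply: b => //; rewrite normrN.
Qed.

End deviations.

Lemma deviation {d d' : measure_display} (Omega : measurableType d)
    (R : realType) (P : probability Omega R) (T : measurableType d') (N n : nat)
    (Z : 'I_N -> Omega -> T) (h : 'I_n -> 'I_N) (f : T -> R) (K : R) (t0 : T)
    (delta t : R) :
  (forall i, measurable_fun setT (Z i)) -> mutually_independent P Z ->
  injective h -> measurable_fun setT f ->
  (forall i, (\int[P]_w (f (Z (h i) w))%:E = 0)%E) ->
  (forall i, (\int[P]_w (f (Z (h i) w) ^+ 2 * expR `|f (Z (h i) w)|)%:E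
              <= K%:E)%E) ->
  0 < t -> t <= 1 -> K * t <= delta / 2 ->
  (P [set w | (n%:R * delta <= `|\sum_i f (Z (h i) w)|)%R] <=
   (2 * expR (- (n%:R * delta * t / 2)))%:E)%E.
Proof.
move=> mZ indZ h_inj mf f_mean f_exp t_gt0 t_le1 Kt.
have mN : measurable_fun setT (fun x => - f x) by exact: measurable_funN.
have N_mean i : (\int[P]_w (- f (Z (h i) w))%:E = 0)%E.
  have mfi : measurable_fun setT (fun w => f (Z (h i) w)).
    exact: measurableT_comp mf (mZ _).
  have fi : P.-integrable setT (EFin \o (fun w => f (Z (h i) w))).
    apply: integrable_le (integrable_sqr_expR mfi (f_exp i)) _ => // w.
    exact: norm_le_sqr_expR.
  under eq_integral do rewrite -mulN1r EFinM.
  by rewrite integralZl// f_mean mule0.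
have N_exp i : (\int[P]_w ((- f (Z (h i) w)) ^+ 2 * expR `|- f (Z (h i) w)|)%:E
              <= K%:E)%E.
  by under eq_integral do rewrite sqrrN normrN.
have mS g (mg : measurable_fun setT (g : T -> R)) :
  measurable [set w | n%:R * delta <= \sum_i g (Z (h i) w)].
  apply: measurable_set_le => //.
  by apply: measurable_sum => i; exact: measurableT_comp mg (mZ _).
have U := upper_deviation t0 mZ indZ h_inj mf f_mean f_exp t_gt0 t_le1 Kt.
have V := upper_deviation t0 mZ indZ h_inj mN N_mean N_exp t_gt0 t_le1 Kt.
rewrite [2 * _]mulr_natl mulr2n EFinD; apply: le_trans (leeD U V).
apply: le_trans (measureU2 _ (mS _ mf) (mS _ mN)); apply: le_measure.
- rewrite inE; apply: measurable_set_le => //; apply: measurableT_comp => //.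
  by apply: measurable_sum => i; exact: measurableT_comp mf (mZ _).
- by rewrite inE; apply: measurableU; [exact: mS mf|exact: mS mN].
move=> w /=; rewrite ler_normr => /orP[]; [left|right] => //.
by rewrite sumrN.
Qed.

Lemma mxvec_index_inj m n (i : 'I_m) : injective (@mxvec_index m n i).
Proof.
by move=> j j' /(congr1 (@nat_of_ord _))/= /ord_inj/enum_rank_inj[].
Qed.

(** Given f the mean over g vanishes. As [indep_decouple] is for nonnegative functions, the positive
    and the negative part are decoupled separately and then compared. *)
Lemma indep_mean0 d d1 d2 (Omega : measurableType d) (R : realType)
    (P : probability Omega R) (T1 : measurableType d1) (T2 : measurableType d2)
    (f : Omega -> T1) (g : Omega -> T2) (h : (T1 * T2)%type -> R) :
  measurable_fun setT f -> measurable_fun setT g -> independent_pair P f g ->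
  measurable_fun setT h ->
  P.-integrable setT (fun w => (h (f w, g w))%:E) ->
  (forall x, P.-integrable setT (fun w => (h (x, g w))%:E)) ->
  (forall x, \int[P]_w (h (x, g w))%:E = 0)%E ->
  (\int[P]_w (h (f w, g w))%:E = 0)%E.
Proof.
move=> mf mg fg mh ifg ig g0.
have mhE : measurable_fun setT (EFin \o h) by exact/measurable_EFinP.
have key : (\int[P]_w ((EFin \o h)^\+ (f w, g w)) =
            \int[P]_w ((EFin \o h)^\- (f w, g w)))%E.
  rewrite (indep_decouple mf mg fg (h := (EFin \o h)^\+%E)); last 2 first.
  - exact: measurable_funepos.
  - by move=> x; exact: funepos_ge0.
  rewrite (indep_decouple mf mg fg (h := (EFin \o h)^\-%E)); last 2 first.
  - exact: measurable_funeneg.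
  - by move=> x; exact: funeneg_ge0.
  apply: eq_integral => w _; have := g0 (f w); rewrite integralE => /eqP.
  rewrite sube_eq ?add0e; last 2 first.
  - by apply: integral_fune_fin_num => //; exact: integrable_funepos.
  - exact: fin_num_adde_defr.
  move/eqP => E; apply: etrans (etrans _ E) _; apply: eq_integral => w' _.
    by rewrite !funeposE.
  by rewrite !funenegE.
rewrite integralE; apply/eqP; rewrite sube_eq ?add0e.
- apply/eqP; apply: etrans (etrans _ key) _; apply: eq_integral => w _.
    by rewrite !funeposE.
  by rewrite !funenegE.
- by apply: integral_fune_fin_num => //; exact: integrable_funepos.
- exact: fin_num_adde_defr.
Qed.

(** * Moments and deviations for one sample with a fixed ordering *)

Section sample.
Context {d : measure_display} (Omega : measurableType d) (R : realType)
  (P : probability Omega R) (n p : nat).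
Local Notation N := (3 * n)%N.
Local Notation T := (p.-tuple R * R)%type.
Variables (Z : 'I_N -> Omega -> T) (beta : 'cV[R]_p) (sigma B : R)
  (Sig : nat -> nat -> R).

(** The noise as a function of the observation, so that samples carry only covariates and
    responses. *)
Definition resid (z : T) : R := z.2 - \sum_j tnth z.1 j * beta j 0.

(** What is retained of the model after a permutation of the observations. Independence of the
    pairs, of the noises, and of the noises from all covariates are separate fields, because each
    serves a different resampling or moment argument. *)
Record good_sample : Prop := GoodSample {
  gs_meas : forall i, measurable_fun setT (Z i);
  gs_ind : mutually_independent P Z;
  gs_noise_ind : mutually_independent P (fun i w => resid (Z i w));
  gs_normal : forall i, is_normal P (fun w => resid (Z i w)) sigma;
  gs_indep : independent_pair P (fun w => [tuple (Z i w).1 | i < N])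
                                (fun w => [tuple resid (Z i w) | i < N]);
  gs_bound : forall i j, {ae P, forall w, `|tnth (Z i w).1 j| <= B};
  gs_cross : forall i (j l : 'I_p),
    (\int[P]_w (tnth (Z i w).1 j * tnth (Z i w).1 l)%:E = (Sig j l)%:E)%E
}.

Lemma measurable_coord j : measurable_fun setT (fun z : T => tnth z.1 j).
Proof. exact: measurableT_comp (measurable_tnth j) measurable_fst. Qed.

Lemma measurable_resid : measurable_fun setT resid.
Proof.
apply: measurable_funB; first exact: measurable_snd.
by apply: measurable_sum => j; apply: measurable_funM => //; exact: measurable_coord.
Qed.

Hypothesis good : good_sample.
Hypothesis sigma0 : 0 < sigma.
Hypothesis B0 : 0 < B.

Let mZ := gs_meas good.
Let me i : measurable_fun setT (fun w => resid (Z i w)).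
Proof. exact: measurableT_comp measurable_resid (mZ i). Qed.
Let mx i j : measurable_fun setT (fun w => tnth (Z i w).1 j).
Proof. exact: measurableT_comp (measurable_coord j) (mZ i). Qed.

Lemma gs_bound_all i : {ae P, forall w, forall j, `|tnth (Z i w).1 j| <= B}.
Proof. by apply: filter_forall => j; exact: gs_bound. Qed.

Variable b1 : R.
Hypothesis beta_le : \sum_j `|beta j 0| <= b1.
(** Constant part of the common envelope A + e^2 / (8 sigma^2), with e the noise, under which all
    centred statistics below are kept. Doubling its quadratic part gives e^2 / (4 sigma^2), which
    still has a finite exponential moment. *)
Definition exp_shift (b : R) : R :=
  2 * B ^+ 2 * b + 2 * B ^+ 2 * sigma ^+ 2 + 2 * B ^+ 2 + 1.
(** Bound on the mean of f^2 exp |f| under the envelope: 4 comes from f^2 <= 4 exp |f|, and sqrt 2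
    is the mean of exp (e^2 / (4 sigma^2)). *)
Definition exp_const b : R := 4 * Num.sqrt 2 * expR (2 * exp_shift b).

Section exponential_moment.
Variables (f : T -> R).
Hypothesis mf : measurable_fun setT f.
Hypothesis f_le : forall i, {ae P, forall w, `|f (Z i w)| <=
  exp_shift b1 + resid (Z i w) ^+ 2 / (8 * sigma ^+ 2)}.

Lemma exponential_moment i :
  (\int[P]_w (f (Z i w) ^+ 2 * expR `|f (Z i w)|)%:E <= (exp_const b1)%:E)%E.
Proof.
set A := exp_shift b1.
have s2 : 0 < Num.sqrt (2 : R) * sigma by rewrite mulr_gt0 ?sqrtr_gt0.
have mfZ : measurable_fun setT (fun w => f (Z i w)) by exact: measurableT_comp mf (mZ i).
set t := Num.sqrt 2 * sigma in s2.
have tE : (sigma ^- 2 - t ^- 2) / 2 = (4 * sigma ^+ 2)^-1.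
  rewrite /t exprMn sqr_sqrtr// invfM; field; rewrite gt_eqF//.
have E := expect_exp_sq (me i) (gs_normal good i) sigma0 s2.
rewrite tE in E.
apply: (@le_trans _ _ (\int[P]_w ((4 * expR (2 * A))%:E * (expR ((4 * sigma ^+ 2)^-1 * resid (Z i w) ^+ 2))%:E))%E).
  apply: ae_ge0_le_integral => //.
  - by move=> w _; rewrite lee_fin mulr_ge0 ?sqr_ge0 ?expR_ge0.
  - apply/measurable_EFinP; apply: measurable_funM; first exact: measurable_funX.
    by apply: measurableT_comp => //; apply: measurableT_comp.
  - apply/measurable_EFinP; apply: measurable_funM => //; apply: measurableT_comp => //.
    by apply: measurable_funM => //; exact: measurable_funX.
  - apply: filterS (f_le i) => w fw _; rewrite -EFinM lee_fin.
    have := sqr_le_expR (normr_ge0 (f (Z i w))).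
    rewrite real_normK ?num_real// => h.
    apply: le_trans (ler_wpM2r (expR_ge0 _) h) _.
    rewrite -!mulrA ler_pM2l// -!expRD ler_expR.
    apply: (@le_trans _ _ (2 * (A + resid (Z i w) ^+ 2 / (8 * sigma ^+ 2)))); first by move: fw; rewrite -/A; lra.
    by rewrite le_eqVlt; apply/orP; left; apply/eqP; field; rewrite gt_eqF.
rewrite ge0_integralZl//; last first.
  apply/measurable_EFinP; apply: measurableT_comp => //.
  by apply: measurable_funM => //; exact: measurable_funX.
rewrite E -EFinM lee_fin /exp_const -/A /t mulfK ?gt_eqF// le_eqVlt; apply/orP; left.
by apply/eqP; ring.
Qed.

Hypothesis f_mean : forall i, (\int[P]_w (f (Z i w))%:E = 0)%E.

Lemma sample_deviation (h : 'I_n -> 'I_N) (delta t : R) :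
  injective h -> 0 < t -> t <= 1 -> exp_const b1 * t <= delta / 2 ->
  (P [set w | (n%:R * delta <= `|\sum_i f (Z (h i) w)|)%R] <=
   (2 * expR (- (n%:R * delta * t / 2)))%:E)%E.
Proof.
move=> hi t0 t1 Kt; apply: (deviation _ mZ (gs_ind good) hi mf _ _ t0 t1 Kt) => //.
- exact: ([tuple 0 | i < p], 0).
- by move=> i; exact: exponential_moment.
Qed.

Lemma sample_second_moment (h : 'I_n -> 'I_N) : (0 < n)%N -> injective h ->
  (\int[P]_w ((\sum_i f (Z (h i) w)) ^+ 2)%:E <=
   (8 * n%:R * expR (exp_const b1))%:E)%E.
Proof.
move=> n0 hi; apply: (second_moment _ mZ (gs_ind good) hi mf _ _ n0) => //.
- exact: ([tuple 0 | i < p], 0).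
- by move=> i; exact: exponential_moment.
Qed.

End exponential_moment.

Section statistics.
Hypothesis Sig_le : forall j l : 'I_p, `|Sig j l| <= B ^+ 2.

Definition pop_marginal (j : nat) : R := \sum_(l < p) beta l 0 * Sig l j.

Definition centered_cross (j l : 'I_p) (z : T) : R :=
  tnth z.1 j * tnth z.1 l - Sig j l.
Definition noise_cross (j : 'I_p) (z : T) : R := resid z * tnth z.1 j.
Definition centered_marginal (j : 'I_p) (z : T) : R :=
  z.2 * tnth z.1 j - pop_marginal j.
(** Dividing by 8 sigma^2 brings the squared noise under the common envelope. *)
Definition centered_var (z : T) : R := (resid z ^+ 2 - sigma ^+ 2) / (8 * sigma ^+ 2).

Lemma measurable_centered_cross j l : measurable_fun setT (centered_cross j l).
Proof.
by apply: measurable_funB => //; apply: measurable_funM; exact: measurable_coord.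
Qed.

Lemma measurable_noise_cross j : measurable_fun setT (noise_cross j).
Proof.
by apply: measurable_funM; [exact: measurable_resid|exact: measurable_coord].
Qed.

Lemma measurable_centered_marginal j : measurable_fun setT (centered_marginal j).
Proof.
apply: measurable_funB => //; apply: measurable_funM; last exact: measurable_coord.
exact: measurable_snd.
Qed.

Lemma measurable_centered_var : measurable_fun setT centered_var.
Proof.
apply: measurable_funM => //; apply: measurable_funB => //.
by apply: measurable_funX; exact: measurable_resid.
Qed.

Let b10 : 0 <= b1. Proof. by apply: le_trans beta_le; exact: sumr_ge0. Qed.
Let B20 : 0 <= B ^+ 2. Proof. exact: sqr_ge0. Qed.
Let s20 : 0 < sigma ^+ 2. Proof. by rewrite exprn_gt0. Qed.
Let B2b : 0 <= B ^+ 2 * b1. Proof. by rewrite mulr_ge0. Qed.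
Let B2s : 0 <= B ^+ 2 * sigma ^+ 2. Proof. by rewrite mulr_ge0// ltW. Qed.

Let amgm (e : R) : B * `|e| <= 2 * B ^+ 2 * sigma ^+ 2 + e ^+ 2 / (8 * sigma ^+ 2).
Proof.
have : 0 <= (`|e| - 4 * B * sigma ^+ 2) ^+ 2 / (8 * sigma ^+ 2).
  by rewrite divr_ge0 ?sqr_ge0// mulr_ge0// ltW.
rewrite -[e ^+ 2]real_normK ?num_real//.
have -> : (`|e| - 4 * B * sigma ^+ 2) ^+ 2 / (8 * sigma ^+ 2) =
  `|e| ^+ 2 / (8 * sigma ^+ 2) - B * `|e| + 2 * B ^+ 2 * sigma ^+ 2.
  by field; rewrite gt_eqF.
lra.
Qed.

Let e2_ge0 (e : R) : 0 <= e ^+ 2 / (8 * sigma ^+ 2).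
Proof. by rewrite divr_ge0 ?sqr_ge0// mulr_ge0// ltW. Qed.

Lemma centered_cross_le j l i : {ae P, forall w, `|centered_cross j l (Z i w)| <=
  exp_shift b1 + resid (Z i w) ^+ 2 / (8 * sigma ^+ 2)}.
Proof.
apply: filterS2 (gs_bound good i j) (gs_bound good i l) => w xj xl.
apply: le_trans (ler_normB _ _) _; rewrite normrM.
have := ler_pM (normr_ge0 _) (normr_ge0 _) xj xl.
have := Sig_le j l; have := e2_ge0 (resid (Z i w)); rewrite /exp_shift.
have := B2b; have := B2s; set q := _ / (8 * _); lra.
Qed.

Lemma noise_cross_le j i : {ae P, forall w, `|noise_cross j (Z i w)| <=
  exp_shift b1 + resid (Z i w) ^+ 2 / (8 * sigma ^+ 2)}.
Proof.
apply: filterS (gs_bound good i j) => w xj; rewrite normrM.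
have := ler_wpM2l (normr_ge0 (resid (Z i w))) xj.
have := amgm (resid (Z i w)); rewrite /exp_shift.
have := B2b; have := B2s; have := B20; set q := _ / (8 * _); lra.
Qed.

Lemma pop_marginal_le j : (j < p)%N -> `|pop_marginal j| <= b1 * B ^+ 2.
Proof.
move=> jp; apply: le_trans (ler_norm_sum _ _ _) _.
apply: le_trans (_ : \sum_(l < p) `|beta l 0| * B ^+ 2 <= _).
  apply: ler_sum => l _; rewrite normrM ler_wpM2l//.
  exact: (Sig_le l (Ordinal jp)).
by rewrite -mulr_suml ler_wpM2r.
Qed.

Lemma centered_marginal_le j i : {ae P, forall w, `|centered_marginal j (Z i w)| <=
  exp_shift b1 + resid (Z i w) ^+ 2 / (8 * sigma ^+ 2)}.
Proof.
apply: filterS (gs_bound_all i) => w xb.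
apply: le_trans (ler_normB _ _) _; rewrite normrM.
have Ey : (Z i w).2 = \sum_j tnth (Z i w).1 j * beta j 0 + resid (Z i w).
  by rewrite addrC subrK.
have y_le : `|(Z i w).2| <= B * b1 + `|resid (Z i w)|.
  rewrite Ey; apply: le_trans (ler_normD _ _) _; rewrite lerD2r.
  apply: le_trans (ler_norm_sum _ _ _) _.
  apply: le_trans (_ : \sum_j B * `|beta j 0| <= _).
    by apply: ler_sum => l _; rewrite normrM ler_wpM2r.
  by rewrite -mulr_sumr ler_wpM2l// ltW.
have := ler_pM (normr_ge0 _) (normr_ge0 _) y_le (xb j).
have := pop_marginal_le (ltn_ord j).
have := amgm (resid (Z i w)); rewrite /exp_shift.
have := B2b; have := B2s; have := B20; set q := _ / (8 * _); lra.
Qed.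

Lemma centered_var_le i : {ae P, forall w, `|centered_var (Z i w)| <=
  exp_shift b1 + resid (Z i w) ^+ 2 / (8 * sigma ^+ 2)}.
Proof.
apply: aeW => w; rewrite /centered_var mulrBl.
have -> : sigma ^+ 2 / (8 * sigma ^+ 2) = 8^-1 by field; rewrite gt_eqF.
apply: le_trans (ler_normB _ _) _; rewrite (ger0_norm (e2_ge0 _)).
rewrite (_ : `|8^-1| = 8^-1 :> R) ?ger0_norm// /exp_shift.
have := B2b; have := B2s; have := B20; set q := _ / (8 * _); lra.
Qed.

Let mean_sub (u : Omega -> R) (c : R) : P.-integrable setT (EFin \o u) ->
  (\int[P]_w (u w)%:E = c%:E)%E -> (\int[P]_w (u w - c)%:E = 0)%E.
Proof.
move=> iu E; under eq_integral do rewrite EFinB.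
rewrite integralB//; last exact: finite_measure_integrable_cst.
by rewrite E integral_cst// [X in (_ * X)%E]probability_setT mule1 subee.
Qed.

Let int_cross i j l : P.-integrable setT
  (EFin \o (fun w => tnth (Z i w).1 j * tnth (Z i w).1 l)).
Proof.
apply: (@ae_bounded_integrable _ _ _ _ _ (B * B)); first exact: measurable_funM.
apply: filterS2 (gs_bound good i j) (gs_bound good i l) => w xj xl.
by rewrite normrM ler_pM.
Qed.

Lemma centered_cross_mean j l i : (\int[P]_w (centered_cross j l (Z i w))%:E = 0)%E.
Proof. by apply: mean_sub; [exact: int_cross|exact: gs_cross]. Qed.

Let int_noise i : P.-integrable setT (EFin \o (fun w => resid (Z i w))).
Proof. exact: normal_integrable (me i) (gs_normal good i) sigma0. Qed.

Let int_noise_cross i j : P.-integrable setT (EFin \o (fun w => noise_cross j (Z i w))).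
Proof.
have m := measurableT_comp (measurable_noise_cross j) (mZ i).
apply: (@integrable_le _ _ _ _ _ _ m
  (integrable_sqr_expR m (exponential_moment (measurable_noise_cross j)
     (noise_cross_le j) i))) => w.
exact: norm_le_sqr_expR.
Qed.

Lemma noise_cross_mean j i : (\int[P]_w (noise_cross j (Z i w))%:E = 0)%E.
Proof.
have ind : independent_pair P (fun w => tnth (Z i w).1 j) (fun w => resid (Z i w)).
  rewrite (_ : (fun w => tnth (Z i w).1 j) = (fun x : N.-tuple (p.-tuple R) =>
    tnth (tnth x i) j) \o (fun w => [tuple (Z i w).1 | i < N])); last first.
    by apply/funext => w /=; rewrite tnth_mktuple.
  rewrite (_ : (fun w => resid (Z i w)) = (fun e : N.-tuple R => tnth e i) \o
    (fun w => [tuple resid (Z i w) | i < N])); last first.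
    by apply/funext => w /=; rewrite tnth_mktuple.
  apply: indep_comp (gs_indep good); last exact: measurable_tnth.
  exact: measurableT_comp (measurable_tnth j) (measurable_tnth i).
have := indep_mean0 (mx i j) (me i) ind (h := fun z : R * R => z.2 * z.1).
apply => /=.
- by apply: measurable_funM.
- exact: int_noise_cross.
- move=> x; under [X in P.-integrable _ X]eq_fun do rewrite mulrC EFinM.
  by apply: integrableZl => //; exact: int_noise.
- move=> x; under eq_integral do rewrite mulrC EFinM.
  rewrite integralZl//; last exact: int_noise.
  by rewrite (expect_normal (me i) (gs_normal good i) sigma0) mule0.
Qed.

Lemma centered_marginal_mean j i : (\int[P]_w (centered_marginal j (Z i w))%:E = 0)%E.
Proof.
have E w : centered_marginal j (Z i w) =
   \sum_l beta l 0 * centered_cross l j (Z i w) + noise_cross j (Z i w).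
  rewrite /centered_marginal /centered_cross /noise_cross /resid mulrBl.
  under eq_bigr do rewrite mulrBr.
  rewrite sumrB -/(pop_marginal j) mulr_suml.
  rewrite (_ : \sum_l beta l 0 * _ = \sum_l tnth (Z i w).1 l * beta l 0 * tnth (Z i w).1 j); last first.
    by apply: eq_bigr => l _; rewrite mulrA [beta _ _ * _]mulrC.
  by rewrite addrACA addrC addrA; set a := \sum_l _; ring.
under eq_integral do rewrite E EFinD -sumEFin.
have ic l : P.-integrable setT (EFin \o (fun w => centered_cross l j (Z i w))).
  rewrite (_ : EFin \o _ = (EFin \o (fun w => (tnth (Z i w).1 l * tnth (Z i w).1 j)%R)) \- cst (Sig l j)%:E)%E//.
  by apply: integrableB => //; exact: finite_measure_integrable_cst.
have il l : P.-integrable setT (fun w => (beta l 0 * centered_cross l j (Z i w))%:E).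
  by under [X in P.-integrable _ X]eq_fun do rewrite EFinM; apply: integrableZl => //; exact: ic.
rewrite integralD//; last 2 first.
- by apply: integrable_sum.
- exact: int_noise_cross.
rewrite noise_cross_mean adde0 integral_sum// big1// => l _.
under eq_integral do rewrite EFinM.
by rewrite integralZl//; [rewrite centered_cross_mean mule0|exact: ic].
Qed.

Lemma centered_var_mean i : (\int[P]_w (centered_var (Z i w))%:E = 0)%E.
Proof.
have ie : P.-integrable setT (EFin \o (fun w => resid (Z i w) ^+ 2)).
  apply: (@ge0_integrable _ _ _ _ _ (sigma ^+ 2)).
  - exact: measurable_funX.
  - by move=> w; exact: sqr_ge0.
  - by rewrite (expect_sq (me i) (gs_normal good i) sigma0).
under eq_integral do rewrite /centered_var mulrC EFinM.
rewrite integralZl//; last first.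
  under [X in P.-integrable _ X]eq_fun do rewrite EFinB.
  by apply: integrableB => //; exact: finite_measure_integrable_cst.
rewrite (mean_sub ie) ?mule0//.
exact: expect_sq (me i) (gs_normal good i) sigma0.
Qed.

End statistics.

End sample.

(** * From observations to permuted samples *)

Section laws.
Context {d d' : measure_display} (Omega : measurableType d) (R : realType)
  (P : probability Omega R) (T : measurableType d').

Lemma same_law_ge0_integral (f g : Omega -> T) (h : T -> \bar R) :
  measurable_fun setT f -> measurable_fun setT g -> same_law P f g ->
  measurable_fun setT h -> (forall x, 0 <= h x)%E ->
  (\int[P]_w h (f w) = \int[P]_w h (g w))%E.
Proof.
move=> mf mg fg mh h0.
have [F FE] := exists_mfun mf; have [G GE] := exists_mfun mg; subst f g.
have pf (U : {mfun Omega >-> T}) :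
    (\int[P]_w h (U w) = \int[pushforward P U]_y h y)%E.
  by rewrite ge0_integral_pushforward.
rewrite !pf.
by apply: eq_measure_integral => A mA _; exact: fg.
Qed.

Lemma same_law_integral (f g : Omega -> T) (h : T -> R) :
  measurable_fun setT f -> measurable_fun setT g -> same_law P f g ->
  measurable_fun setT h ->
  (\int[P]_w (h (f w))%:E = \int[P]_w (h (g w))%:E)%E.
Proof.
move=> mf mg fg mh; have mhE : measurable_fun setT (EFin \o h) by exact/measurable_EFinP.
rewrite integralE [RHS]integralE; congr (_ - _)%E.
  have E := same_law_ge0_integral mf mg fg (measurable_funepos mhE) (funepos_ge0 _).
  by apply: etrans (etrans _ E) _; apply: eq_integral => w _; rewrite !funeposE.
have E := same_law_ge0_integral mf mg fg (measurable_funeneg mhE) (funeneg_ge0 _).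
by apply: etrans (etrans _ E) _; apply: eq_integral => w _; rewrite !funenegE.
Qed.

Lemma same_law_integrable (f g : Omega -> T) (h : T -> R) :
  measurable_fun setT f -> measurable_fun setT g -> same_law P f g ->
  measurable_fun setT h -> P.-integrable setT (fun w => (h (f w))%:E) ->
  P.-integrable setT (fun w => (h (g w))%:E).
Proof.
move=> mf mg fg mh /integrableP[_ ih]; apply/integrableP; split.
  by apply/measurable_EFinP; exact: measurableT_comp mh mg.
apply: le_lt_trans ih; rewrite le_eqVlt; apply/orP; left; apply/eqP; apply/esym.
apply: (same_law_ge0_integral mf mg fg (h := fun x => `|(h x)%:E|%E)) => //.
by apply: measurableT_comp => //; exact/measurable_EFinP.
Qed.

End laws.

(** Indices outside the image of h receive the trivial constraint [setT]. *)
Lemma mutually_independent_inj d d' (Omega : measurableType d) (R : realType)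
    (P : probability Omega R) (T : measurableType d') n N
    (f : 'I_N -> Omega -> T) (h : 'I_n -> 'I_N) : injective h ->
  mutually_independent P f -> mutually_independent P (fun i => f (h i)).
Proof.
move=> hi ind J D mD.
pose D' i := if [pick j | h j == i] is Some j then D j else setT.
have D'E j : D' (h j) = D j.
  rewrite /D'; case: pickP => [j' /eqP /hi ->//|/(_ j)]; by rewrite eqxx.
have mD' i : measurable (D' i) by rewrite /D'; case: pickP.
have := ind [set h i | i in J]%SET D' mD'.
rewrite big_imset/=; last by move=> x y _ _ /hi.
under eq_bigr do rewrite D'E.
move=> <-; congr (P _); apply/seteqP; split => w /= H i.
  by move=> /imsetP[j jJ ->]; rewrite D'E; exact: H.
by move=> iJ; have := H (h i) (imset_f _ iJ); rewrite D'E.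
Qed.

Section permuted_sample.
Context {d : measure_display} (Omega : measurableType d) (R : realType)
  (P : probability Omega R) (n p : nat) (o : observations P n p)
  (beta : 'cV[R]_p) (sigma B : R) (Sig : nat -> nat -> R).
Local Notation N := (3 * n)%N.
Local Notation T := (p.-tuple R * R)%type.

Definition sample (pi : 'S_N) (i : 'I_N) (w : Omega) : T :=
  (covar o (pi i) w, response o (pi i) w).

Hypothesis iid : iid_observations o.
Hypothesis model : linear_model o beta sigma.
Hypothesis bounded : bounded_standardized o B.
Hypothesis cross : forall i (j l : 'I_p),
  (\int[P]_w (tnth (covar o i w) j * tnth (covar o i w) l)%:E = (Sig j l)%:E)%E.

Lemma measurable_sample pi i : measurable_fun setT (sample pi i).
Proof. by apply: measurable_fun_pair. Qed.

Lemma resid_sample pi i w : resid beta (sample pi i w) = noise o (pi i) w.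
Proof. by case: model => /(_ (pi i) w) E _ _ _; rewrite /resid/= E addrC addKr. Qed.

Lemma sample_good pi : good_sample P (sample pi) beta sigma B Sig.
Proof.
case: (model) => _ nrm nind ind; split.
- exact: measurable_sample.
- exact: (mutually_independent_inj (@perm_inj _ pi) iid.1).
- have -> : (fun i w => resid beta (sample pi i w)) = (fun i w => noise o (pi i) w).
    by apply/funext => i; apply/funext => w; exact: resid_sample.
  exact: (mutually_independent_inj (@perm_inj _ pi) nind).
- move=> i D mD; rewrite -(nrm (pi i) D mD); congr (P _).
  by apply/seteqP; split => w /=; rewrite resid_sample.
- rewrite (_ : (fun w => [tuple (sample pi i w).1 | i < N]) =
    (fun x : N.-tuple (p.-tuple R) => [tuple tnth x (pi i) | i < N]) \o
    (fun w => [tuple covar o i w | i < N])); last first.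
    by apply/funext => w /=; apply: eq_from_tnth => i; rewrite !tnth_mktuple.
  rewrite (_ : (fun w => [tuple resid beta (sample pi i w) | i < N]) =
    (fun x : N.-tuple R => [tuple tnth x (pi i) | i < N]) \o
    (fun w => [tuple noise o i w | i < N])); last first.
    apply/funext => w /=; apply: eq_from_tnth => i.
    by rewrite !tnth_mktuple resid_sample.
  apply: indep_comp ind.
    apply/measurable_fun_tnthP => i; rewrite (_ : _ \o _ = (@tnth _ _)^~ (pi i)).
      exact: measurable_tnth.
    by apply/funext => x /=; rewrite tnth_mktuple.
  apply/measurable_fun_tnthP => i; rewrite (_ : _ \o _ = (@tnth _ _)^~ (pi i)).
    exact: measurable_tnth.
  by apply/funext => x /=; rewrite tnth_mktuple.
- by move=> i j; case: (bounded (pi i) j).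
- by move=> i j l; exact: cross.
Qed.

Hypothesis split : random_split o.

Definition pair_data (w : Omega) : N.-tuple T :=
  [tuple sample (allocation o w) i w | i < N].

Definition design_of (g : 'I_3) (t : N.-tuple T) : 'M[R]_(n, p) :=
  \matrix_(i, j) tnth (tnth t (mxvec_index g i)).1 j.

Definition responses_of (g : 'I_3) (t : N.-tuple T) : 'cV[R]_n :=
  \col_i (tnth t (mxvec_index g i)).2.

Lemma design_data g w : design o g w = design_of g (pair_data w).
Proof. by apply/matrixP => i j; rewrite !mxE tnth_mktuple. Qed.

Lemma responses_data g w : responses o g w = responses_of g (pair_data w).
Proof. by apply/matrixP => i j; rewrite !mxE tnth_mktuple. Qed.

Lemma data_le (H : set (N.-tuple T)) (b : R) : measurable H -> 0 <= b ->
  (forall pi, P [set w | H (tup (sample pi) w)] <= b%:E)%E ->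
  measurable [set w | H (pair_data w)] /\ (P [set w | H (pair_data w)] <= b%:E)%E.
Proof. by move=> mH b0 Hb; exact: (alloc_le split mH b0 Hb). Qed.

Lemma measurable_pair_data : measurable_fun setT pair_data.
Proof.
move=> _ H mH; rewrite setTI.
have [] // := @data_le H 1 mH ler01; move=> pi; apply: probability_le1.
have := measurable_tup (fun i => measurable_sample pi i).
by move=> /(_ measurableT _ mH); rewrite setTI.
Qed.

(** Every permutation has positive probability and is independent of the data, so an event that is
    null for the allocated data is null for each permuted sample. This carries the rank condition
    over to fixed orderings. *)
Lemma data_null (H : set (N.-tuple T)) pi : measurable H ->
  P [set w | H (pair_data w)] = 0 -> P [set w | H (tup (sample pi) w)] = 0.
Proof.
move=> mH H0; case: (split 1%g) => _ _ _; case: (split pi) => mpi Ppi ind.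
pose H' := [set t : N.-tuple T | H [tuple tnth t (pi i) | i < N]].
have mH' : measurable H'.
  apply: measurable_preimage mH; apply/measurable_fun_tnthP => i.
  rewrite (_ : _ \o _ = (@tnth _ _)^~ (pi i)); first exact: measurable_tnth.
  by apply/funext => x /=; rewrite tnth_mktuple.
have := ind _ mH'; rewrite Ppi /=.
set A := allocation o @^-1` _ `&` _.
have -> : P A = 0.
  apply/eqP; rewrite eq_le measure_ge0 andbT -H0; apply: le_measure.
  - rewrite inE; apply: measurableI => //.
    apply: measurable_preimage mH'; apply/measurable_fun_tnthP => i.
    rewrite (_ : _ \o _ = sample 1%g i); first exact: measurable_sample.
    by apply/funext => x /=; rewrite tnth_mktuple /sample perm1.
  - by rewrite inE; apply: measurable_preimage mH; exact: measurable_pair_data.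
  - move=> w [/= al]; rewrite /H'/= /pair_data al.
    congr H; apply: eq_from_tnth => i; rewrite !tnth_mktuple//.
move=> /esym/eqP; rewrite mule_eq0 => /orP[|/eqP E0].
  by rewrite eqe invr_eq0 pnatr_eq0 eqn0Ngt fact_gt0.
rewrite -E0; congr (P _); apply/seteqP; split => w /=; congr H;
  apply: eq_from_tnth => i; rewrite !tnth_mktuple//.
Qed.

(** One inequality comes from averaging over permutations; applied to the complement it gives the
    other. *)
Lemma allocated_law i i0 : same_law P (fun w => tnth (pair_data w) i) (sample 1%g i0).
Proof.
have le (A : set T) : measurable A ->
    (P ((fun w => tnth (pair_data w) i) @^-1` A) <= P (sample 1%g i0 @^-1` A))%E.
  move=> mA; have fin : P (sample 1%g i0 @^-1` A) \is a fin_num.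
    by apply: fin_num_measure; apply: measurable_preimage mA; exact: measurable_sample.
  have mH : measurable [set t : N.-tuple T | A (tnth t i)].
    exact: measurable_preimage (measurable_tnth i) mA.
  have [] := @data_le _ (fine (P (sample 1%g i0 @^-1` A))) mH.
  - exact: fine_ge0.
  - move=> pi; rewrite fineK//.
    rewrite (iid.2 ((1%g : 'S_N) i0) (pi i))//.
    rewrite le_eqVlt; apply/orP; left; apply/eqP; congr (P _).
    by apply/seteqP; split => w /=; rewrite /tup tnth_mktuple.
  by rewrite fineK.
have mD : measurable_fun setT (fun w => tnth (pair_data w) i).
  exact: measurableT_comp (measurable_tnth i) measurable_pair_data.
move=> A mA; apply/eqP; rewrite eq_le le//=.
have : (P (~` ((fun w => tnth (pair_data w) i) @^-1` A)) <=
  P (~` (sample 1%g i0 @^-1` A)))%E := le _ (measurableC mA).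
have mDA := measurable_preimage mD mA.
have mSA := measurable_preimage (measurable_sample 1%g i0) mA.
rewrite !probability_setC//.
have /fineK <- := fin_num_measure P _ mDA; have /fineK <- := fin_num_measure P _ mSA.
by rewrite -!EFinB !lee_fin lerD2l lerN2.
Qed.

End permuted_sample.

Lemma prob_exists_le d (Omega : measurableType d) (R : realType)
    (P : probability Omega R) (I : finType) (F : I -> set Omega) (r : R) :
  (forall i, measurable (F i) /\ (P (F i) <= r%:E)%E) ->
  measurable [set w | exists i, F i w] /\
  (P [set w | exists i, F i w] <= (#|I|%:R * r)%:E)%E.
Proof.
move=> FP; have mE : measurable [set w | exists i, F i w].
  by apply: measurable_exists => i; case: (FP i).
split=> //; apply: le_trans (@prob_le_sum _ _ _ P _ _ F mE _ _) _ => //.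
  by move=> i; case: (FP i).
apply: le_trans (_ : \sum_(i : I) r%:E <= _)%E.
  by apply: lee_sum => i _; case: (FP i).
by rewrite sumEFin sumr_const mulr_natl.
Qed.

Section fixed_size.
Context {d : measure_display} (Omega : measurableType d) (R : realType)
  (P : probability Omega R) (n p : nat) (o : observations P n p)
  (beta : 'cV[R]_p) (sigma B b1 : R) (Sig : nat -> nat -> R).
Local Notation N := (3 * n)%N.
Local Notation T := (p.-tuple R * R)%type.
Hypothesis iid : iid_observations o.
Hypothesis split : random_split o.
Hypothesis model : linear_model o beta sigma.
Hypothesis bounded : bounded_standardized o B.
Hypothesis cross : forall i (j l : 'I_p),
  (\int[P]_w (tnth (covar o i w) j * tnth (covar o i w) l)%:E = (Sig j l)%:E)%E.
Hypothesis n_gt0 : (0 < n)%N.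
Hypothesis sigma0 : 0 < sigma.
Hypothesis B0 : 0 < B.
Hypothesis beta_le : \sum_j `|beta j 0| <= b1.
Hypothesis Sig_le : forall j l : 'I_p, `|Sig j l| <= B ^+ 2.

Let good pi := sample_good iid model bounded cross pi.
Let n0 : 0 < n%:R :> R. Proof. by rewrite ltr0n. Qed.

(** Each allocated observation has the law of a fixed one, and integrability of the product of
    response and covariate follows from that of its centred version. *)
Lemma mean_marginalE j : mean_marginal o j = pop_marginal beta Sig j.
Proof.
pose h (z : T) := z.2 * tnth z.1 j.
have mh : measurable_fun setT h.
  by apply: measurable_funM; [exact: measurable_snd|exact: measurable_coord].
pose i0 : 'I_N := mxvec_index group_screen (Ordinal n_gt0).
have ms : measurable_fun setT (sample o 1%g i0) by exact: measurable_sample.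
have ic : P.-integrable setT (EFin \o (fun w => centered_marginal beta Sig j (sample o 1%g i0 w))).
  have mc := measurable_centered_marginal beta Sig j.
  have mcs := measurableT_comp mc ms.
  apply: (@integrable_le _ _ _ _ _ _ mcs (integrable_sqr_expR mcs
    (exponential_moment (good 1%g) sigma0 mc
     (centered_marginal_le (good 1%g) sigma0 B0 beta_le Sig_le j) i0))) => w.
  exact: norm_le_sqr_expR.
have ih : P.-integrable setT (EFin \o (fun w => h (sample o 1%g i0 w))).
  rewrite (_ : EFin \o _ = (EFin \o (fun w => centered_marginal beta Sig j (sample o 1%g i0 w)))
    \+ cst (pop_marginal beta Sig j)%:E)%E.
    by apply: integrableD => //; exact: finite_measure_integrable_cst.
  by apply/funext => w /=; rewrite -EFinD subrK.
have Eh : (\int[P]_w (h (sample o 1%g i0 w))%:E = (pop_marginal beta Sig j)%:E)%E.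
  have := centered_marginal_mean (good 1%g) sigma0 beta_le j i0.
  under eq_integral do rewrite /centered_marginal EFinB.
  rewrite integralB//; last exact: finite_measure_integrable_cst.
  rewrite integral_cst// [X in (_ * X)%E]probability_setT mule1.
  move=> /eqP; rewrite sube_eq ?add0e; [by move/eqP| |exact: fin_num_adde_defr].
  by apply: integral_fune_fin_num.
have md i : measurable_fun setT (fun w => tnth (pair_data o w) i).
  exact: measurableT_comp (measurable_tnth i) (measurable_pair_data split).
have ia i : P.-integrable setT (fun w => (h (tnth (pair_data o w) i))%:E).
  apply: (same_law_integrable ms (md i) _ mh ih) => A mA.
  by apply/esym; exact: (allocated_law iid split).
have Ea i : (\int[P]_w (h (tnth (pair_data o w) i))%:E = (pop_marginal beta Sig j)%:E)%E.
  by rewrite -Eh; apply: same_law_integral => //; exact: (allocated_law iid split).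
rewrite /mean_marginal unlock.
have -> : (\int[P]_w (marginal (design o group_screen w) (responses o group_screen w) j)%:E =
   \int[P]_w ((n%:R^-1)%:E * \sum_(i < n) (h (tnth (pair_data o w) (mxvec_index group_screen i)))%:E))%E.
  apply: eq_integral => w _; rewrite /marginal EFinM -sumEFin; congr (_ * _)%E.
  by apply: eq_bigr => i _; rewrite design_data responses_data !mxE.
rewrite integralZl//; last by apply: integrable_sum => // i _; exact: ia.
rewrite integral_sum//.
under eq_bigr do rewrite Ea.
rewrite sumEFin sumr_const card_ord -EFinM/= -[X in _ * X]mulr_natr mulrCA mulVf ?mulr1//.
by rewrite gt_eqF.
Qed.

Section one_statistic.
Variables (f : T -> R).
Hypothesis mf : measurable_fun setT f.
Hypothesis f_le : forall pi i, {ae P, forall w, `|f (sample o pi i w)| <=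
  exp_shift sigma B b1 + resid beta (sample o pi i w) ^+ 2 / (8 * sigma ^+ 2)}.
Hypothesis f_mean : forall pi i, (\int[P]_w (f (sample o pi i w))%:E = 0)%E.

Lemma data_deviation g (delta t : R) : 0 < t -> t <= 1 ->
  exp_const sigma B b1 * t <= delta / 2 ->
  let E := [set w | n%:R * delta <=
    `|\sum_(i < n) f (tnth (pair_data o w) (mxvec_index g i))|] in
  measurable E /\ (P E <= (2 * expR (- (n%:R * delta * t / 2)))%:E)%E.
Proof.
move=> t0 t1 Kt E.
pose H := [set z : N.-tuple T | n%:R * delta <= `|\sum_(i < n) f (tnth z (mxvec_index g i))|].
have mH : measurable H.
  apply: measurable_set_le => //; apply: measurableT_comp => //.
  by apply: measurable_sum => i; exact: measurableT_comp mf (measurable_tnth _).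
apply: (data_le split mH); first by rewrite mulr_ge0 ?expR_ge0.
move=> pi; rewrite /H /=.
under eq_set do under eq_bigr do rewrite /tup tnth_mktuple.
apply: (sample_deviation (good pi) sigma0 mf _ _ _ t0 t1 Kt) => //.
exact: mxvec_index_inj.
Qed.

End one_statistic.

Section events.
Variables (eta t : R) (q : nat).
Hypothesis t0 : 0 < t.
Hypothesis t1 : t <= 1.
Hypothesis Kt : exp_const sigma B b1 * t <= eta / 2.
Let rate := 2 * expR (- (n%:R * eta * t / 2)).

Let scale (a : R) (x : 'I_n -> R) : eta < `|n%:R^-1 * \sum_i x i - a| ->
  n%:R * eta <= `|\sum_i (x i - a)|.
Proof.
rewrite sumrB sumr_const card_ord -[a *+ n]mulr_natl => /ltW H.
rewrite (_ : _ - _ = n%:R * (n%:R^-1 * \sum_i x i - a)).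
  by rewrite normrM gtr0_norm// ler_pM2l.
by rewrite mulrBr mulrA divff ?mul1r// gt_eqF.
Qed.

Lemma marginal_close_prob : exists2 F, measurable F /\
  (P F <= (p%:R * rate)%:E)%E &
  forall w, ~ F w -> forall j, `|marginal (design o group_screen w)
     (responses o group_screen w) j - pop_marginal beta Sig j| <= eta.
Proof.
pose G (j : 'I_p) := [set w | n%:R * eta <= `|\sum_(i < n)
  centered_marginal beta Sig j (tnth (pair_data o w) (mxvec_index group_screen i))|].
have GP j : measurable (G j) /\ (P (G j) <= rate%:E)%E.
  apply: data_deviation => //; first exact: measurable_centered_marginal.
  - by move=> pi i; exact (centered_marginal_le (good pi) sigma0 B0 beta_le Sig_le j i).
  - by move=> pi i; exact (centered_marginal_mean (good pi) sigma0 beta_le j i).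
have [mF PF] := prob_exists_le GP; rewrite card_ord in PF.
exists [set w | exists j, G j w] => // w nF j; rewrite leNgt; apply/negP => /scale H.
apply: nF; exists j; rewrite /G/=; apply: le_trans H _.
rewrite le_eqVlt; apply/orP; left; apply/eqP; congr `|_|; apply: eq_bigr => i _.
by rewrite design_data responses_data !mxE.
Qed.

Lemma entries_close_prob g : (q <= p)%N -> exists2 F, measurable F /\
  (P F <= ((q * q + q)%:R * rate)%:E)%E &
  forall w, ~ F w -> entries_close Sig q eta (design o g w)
     (responses o g w - design o g w *m beta).
Proof.
move=> qp; pose wd := widen_ord qp.
pose G (a : 'I_q * 'I_q + 'I_q) := match a with
  | inl (j, l) => [set w | n%:R * eta <= `|\sum_(i < n)
      centered_cross Sig (wd j) (wd l) (tnth (pair_data o w) (mxvec_index g i))|]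
  | inr j => [set w | n%:R * eta <= `|\sum_(i < n)
      noise_cross beta (wd j) (tnth (pair_data o w) (mxvec_index g i))|]
  end.
have GP a : measurable (G a) /\ (P (G a) <= rate%:E)%E.
  case: a => [[j l]|j]; apply: data_deviation => //.
  - exact: measurable_centered_cross.
  - by move=> pi i; exact (centered_cross_le (good pi) sigma0 beta_le Sig_le (wd j) (wd l) i).
  - by move=> pi i; exact (centered_cross_mean (good pi) (wd j) (wd l) i).
  - exact: measurable_noise_cross.
  - by move=> pi i; exact (noise_cross_le (good pi) sigma0 beta_le (wd j) i).
  - by move=> pi i; exact (noise_cross_mean (good pi) sigma0 beta_le (wd j) i).
have [mF PF] := prob_exists_le GP; rewrite card_sum card_prod !card_ord in PF.
exists [set w | exists a, G a w] => // w nF.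
have wdK (j : 'I_p) (jq : (j < q)%N) : wd (Ordinal jq) = j by apply: val_inj.
split=> [j l jq lq|j jq]; rewrite leNgt; apply/negP => H; apply: nF.
  move: H => /scale H; exists (inl (Ordinal jq, Ordinal lq)); rewrite /G/= !wdK.
  apply: le_trans H _; rewrite le_eqVlt; apply/orP; left; apply/eqP; congr `|_|.
  by apply: eq_bigr => i _; rewrite design_data !mxE.
rewrite -[X in _ < `|X|]subr0 in H; move: H => /scale H.
exists (inr (Ordinal jq)); rewrite /G/= !wdK.
apply: le_trans H _; rewrite le_eqVlt; apply/orP; left; apply/eqP; congr `|_|.
apply: eq_bigr => i _; rewrite design_data responses_data subr0 !mxE mulrC /noise_cross /resid.
by congr ((_ - _) * _); apply: eq_bigr => l _; rewrite !mxE.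
Qed.

End events.

End fixed_size.

(** * Statements with high probability and their rates *)

Section high_probability.
Context {d : measure_display} (Omega : measurableType d) (R : realType)
  (P : probability Omega R).

(** Failure is covered by a measurable set, so Q itself need not be measurable. The level a_n and a
    vanishing error b_n are kept apart, so that one notion serves both convergence to 1 and the
    bounds by alpha. *)
Definition whp (a : nat -> R) (Q : nat -> Omega -> Prop) : Prop :=
  exists2 b : nat -> R, b @ \oo --> (0 : R) &
  \forall n \near \oo, exists2 F, measurable F /\ (P F <= (a n + b n)%:E)%E &
    forall w, ~ F w -> Q n w.

Lemma whp_mono a (Q Q' : nat -> Omega -> Prop) : whp a Q ->
  (\forall n \near \oo, forall w, Q n w -> Q' n w) -> whp a Q'.
Proof.
move=> [b b0 H] QQ; exists b => //.
by apply: filterS2 H QQ => n [F FP FQ] imp; exists F => // w /FQ; exact: imp.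
Qed.

Lemma whpI a a' (Q Q' : nat -> Omega -> Prop) : whp a Q -> whp a' Q' ->
  whp (fun n => a n + a' n) (fun n w => Q n w /\ Q' n w).
Proof.
move=> [b b0 H] [b' b'0 H']; exists (fun n => b n + b' n).
  by rewrite -[0]addr0; exact: cvgD.
apply: filterS2 H H' => n [F [mF PF] FQ] [F' [mF' PF'] FQ'].
exists (F `|` F'); last first.
  by move=> w nF; split; [apply: FQ|apply: FQ'] => Fw; apply: nF; [left|right].
split; first exact: measurableU.
apply: le_trans (measureU2 _ mF mF') _; rewrite addrACA EFinD; exact: leeD.
Qed.

Lemma whpI0 a (Q Q' : nat -> Omega -> Prop) : whp a Q -> whp (cst 0) Q' ->
  whp a (fun n w => Q n w /\ Q' n w).
Proof.
move=> H H'; have [b b0 HH] := whpI H H'; exists b => //.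
by apply: filterS HH => n; rewrite /cst addr0.
Qed.

Lemma prob_whp a (A : nat -> set Omega) : (forall n, measurable (A n)) -> whp a A ->
  exists2 b : nat -> R, b @ \oo --> (0 : R) &
  \forall n \near \oo, (P (~` A n) <= (a n + b n)%:E)%E.
Proof.
move=> mA [b b0 H]; exists b => //; apply: filterS H => n [F [mF PF] FA].
apply: le_trans PF; apply: le_measure; rewrite ?inE//; first exact: measurableC.
by move=> w nA; apply: contrapT => /FA.
Qed.

Lemma cvg_prob1 (A : nat -> set Omega) : (forall n, measurable (A n)) ->
  whp (cst 0) A -> (fun n => P (A n)) @ \oo --> 1%E.
Proof.
move=> mA /(prob_whp mA)[b b0 H].
apply: (@squeeze_cvge _ _ _ _ (fun n => (1 - b n)%:E) _ (cst 1%E)).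
- apply: filterS H => n; rewrite /cst add0r probability_setC// => H.
  rewrite probability_le1// andbT.
  have /fineK E := fin_num_measure P _ (mA n); rewrite -E in H *.
  by move: H; rewrite -EFinB !lee_fin; lra.
- apply: cvg_EFin; first by near=> n.
  rewrite (_ : fine \o _ = fun n => 1 - b n); last by apply/funext.
  by rewrite -[X in _ --> X]subr0; apply: cvgB => //; exact: cvg_cst.
- exact: cvg_cst.
Unshelve. all: by end_near. Qed.

(** The way back from probability to deterministic facts: once the failure probability is below 1,
    some outcome is good. *)
Lemma whp_ex (Q : nat -> Omega -> Prop) (D : nat -> Prop) : whp (cst 0) Q ->
  (\forall n \near \oo, D n) -> exists n w, D n /\ Q n w.
Proof.
move=> [b b0 H] HD.
have b1 : \forall n \near \oo, b n < 1.
  by move/cvgr_lt : b0 => /(_ 1 ltr01).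
near \oo => n; exists n.
have : D n by near: n.
have : exists2 F, measurable F /\ (P F <= (cst 0 n + b n)%:E)%E & forall w, ~ F w -> Q n w.
  by near: n.
have : b n < 1 by near: n.
move=> bn [F [mF PF] FQ] Dn.
have [w nF] : exists w, ~ F w.
  apply: contrapT => /forallNP H'; have FT : F = setT.
    by apply/seteqP; split => // w _; exact: contrapT (H' w).
  move: PF; rewrite FT probability_setT /cst add0r lee_fin.
  by rewrite leNgt bn.
by exists w; split=> //; exact: FQ.
Unshelve. all: by end_near. Qed.

(** The intersections of E over all indices from m on increase to an almost sure event, so their
    probabilities tend to 1 by continuity from below. *)
Lemma whp_ae (E : nat -> set Omega) : (forall n, measurable (E n)) ->
  {ae P, forall w, \forall n \near \oo, E n w} -> whp (cst 0) E.
Proof.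
move=> mE aeE.
pose F m := \bigcap_(n in [set n | (m <= n)%N]) E n.
have mF m : measurable (F m) by apply: bigcap_measurable => //; exists m => /=.
have ndF : nondecreasing_seq F.
  move=> m1 m2 m12; apply/subsetPset => w Fw n /= m2n; apply: Fw => /=.
  exact: leq_trans m2n.
have PU : P (\bigcup_n F n) = 1%E.
  have mU : measurable (\bigcup_n F n) by exact: bigcup_measurable.
  apply/eqP; rewrite eq_le probability_le1//=.
  have : P (~` \bigcup_n F n) = 0.
    apply/negligibleP; first exact: measurableC.
    apply: negligibleS aeE => w nU [m _ Hm]; apply: nU.
    by exists m => // n /= mn; exact: Hm.
  rewrite probability_setC// => /eqP; rewrite sube_eq//.
  by rewrite add0e => /eqP <-.
have cF : (P \o F) @ \oo --> 1%E.
  rewrite -PU; apply: nondecreasing_cvg_mu => //.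
  exact: bigcup_measurable.
exists (fun n => fine (P (~` F n))).
  have -> : (fun n => fine (P (~` F n))) = (fun n => 1 - fine (P (F n))).
    apply/funext => n; rewrite probability_setC//.
    by have /fineK <- := fin_num_measure P _ (mF n).
  rewrite -[0](subrr 1); apply: cvgB; first exact: cvg_cst.
  exact: (fine_cvg (cF : (P \o F) @ \oo --> (1%R)%:E)).
apply: nearW => n; exists (~` F n).
  split; first exact: measurableC.
  by rewrite /cst add0r fineK// fin_num_measure//; exact: measurableC.
by move=> w /contrapT; apply => /=.
Qed.

End high_probability.

Section exponential_rates.
Context {R : realType}.

Lemma cvg_exp_rate (A c : R) : 0 < c ->
  (fun n : nat => A * expR (- (c * n%:R))) @ \oo --> (0 : R).
Proof.
move=> c0; rewrite -[X in _ --> X](mulr0 A); apply: cvgM; first exact: cvg_cst.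
apply: (@squeeze_cvgr _ _ _ _ (cst 0) (fun n : nat => c^-1 * (n%:R : R)^-1) _).
- near=> n; rewrite expR_ge0/= expRN -invfM lef_pV2 ?posrE ?expR_gt0//; last first.
    by rewrite mulr_gt0// ltr0n; near: n; exists 1%N.
  by apply: le_trans (expR_ge1Dx _); lra.
- exact: cvg_cst.
- rewrite -[X in _ --> X](mulr0 c^-1); apply: cvgM; first exact: cvg_cst.
  by apply/gtr0_cvgV0; [near=> n; rewrite ltr0n; near: n; exists 1%N|exact: cvgr_idn].
Unshelve. all: by end_near. Qed.

Lemma ln_pinfty (A : R) : \forall n \near \oo, A <= ln (n%:R : R).
Proof.
have : \forall n \near \oo, expR A <= n%:R :> R by exact: nbhs_infty_ger.
apply: filterS => n h; rewrite -[A]expRK ler_ln// ?posrE ?expR_gt0//.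
exact: lt_le_trans (expR_gt0 _) h.
Qed.

Lemma powR_le_linear (c2 c : R) : 0 <= c2 -> c2 < 1 -> 0 < c ->
  \forall n \near \oo, (n%:R : R) `^ c2 <= c * n%:R.
Proof.
move=> c20 c21 c0; have := ln_pinfty (- ln c / (1 - c2)).
apply: filterS2 (nbhs_infty_gt 0) => n n0 h.
have nR : 0 < n%:R :> R by rewrite ltr0n.
rewrite -ler_ln ?posrE ?powR_gt0 ?mulr_gt0// ln_powR lnM ?posrE//.
move: h; rewrite ler_pdivrMr ?subr_gt0//; lra.
Qed.

(** Since c2 < 1, the exponent n^c2 of the dimension is eventually at most half of c n. *)
Lemma cvg_union_rate (p : nat -> nat) (c1 c2 A c : R) :
  0 <= c1 -> 0 <= c2 -> c2 < 1 -> 0 < c -> 0 <= A ->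
  (forall n, (0 < n)%N -> (p n)%:R <= c1 * expR (n%:R `^ c2)) ->
  (fun n => (p n)%:R * (A * expR (- (c * n%:R)))) @ \oo --> (0 : R).
Proof.
move=> c10 c20 c21 c0 A0 p_le.
apply: (@squeeze_cvgr _ _ _ _ (cst 0) (fun n => c1 * A * expR (- (c / 2 * n%:R))) _).
- have ch : 0 < c / 2 by rewrite divr_gt0.
  apply: filterS2 (nbhs_infty_gt 0) (powR_le_linear c20 c21 ch) => n n0 h.
  rewrite /cst !mulr_ge0 ?expR_ge0//=.
  apply: le_trans (ler_wpM2r _ (p_le n n0)) _; first by rewrite mulr_ge0 ?expR_ge0.
  rewrite mulrACA.
  rewrite ler_wpM2l ?mulr_ge0// -expRD ler_expR; lra.
- exact: cvg_cst.
- by apply: cvg_exp_rate; rewrite divr_gt0.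
Qed.

End exponential_rates.

(** * Measurability and uniqueness of the cross-validated set *)

Lemma measurable_invr (R : realType) : measurable_fun setT (fun x : R => x^-1).
Proof.
have -> : [set: R] = [set 0] `|` [set~ 0] by rewrite setUv.
apply/measurable_funU => //; first exact: measurableC.
split; first exact: measurable_fun_set1.
apply: open_continuous_measurable_fun; first apply: closed_openC.
  exact: (accessible_closed_set1 (hausdorff_accessible (@norm_hausdorff _ _))).
by move=> x; rewrite inE => /= /eqP x0; exact: inv_continuous.
Qed.

Lemma measurable_sqrtr (R : realType) : measurable_fun setT (@Num.sqrt R).
Proof. by apply: continuous_measurable_fun; exact: sqrt_continuous. Qed.

Section measurable_matrices.
Context {d : measure_display} (T : measurableType d) (R : realType).

Definition measurable_mx m n (f : T -> 'M[R]_(m, n)) :=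
  forall i j, measurable_fun setT (fun t => f t i j).

Lemma measurable_mxM m n r (f : T -> 'M[R]_(m, n)) (g : T -> 'M[R]_(n, r)) :
  measurable_mx f -> measurable_mx g -> measurable_mx (fun t => f t *m g t).
Proof.
move=> mf mg i j; under eq_fun do rewrite mxE.
by apply: measurable_sum => l; exact: measurable_funM.
Qed.

Lemma measurable_mxD m n (f g : T -> 'M[R]_(m, n)) :
  measurable_mx f -> measurable_mx g -> measurable_mx (fun t => f t + g t).
Proof. by move=> mf mg i j; under eq_fun do rewrite mxE; exact: measurable_funD. Qed.

Lemma measurable_mxB m n (f g : T -> 'M[R]_(m, n)) :
  measurable_mx f -> measurable_mx g -> measurable_mx (fun t => f t - g t).
Proof. by move=> mf mg i j; under eq_fun do rewrite !mxE; exact: measurable_funB. Qed.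

Lemma measurable_mx_cst m n (A : 'M[R]_(m, n)) : measurable_mx (fun _ => A).
Proof. by move=> i j; exact: measurable_cst. Qed.

Lemma measurable_mx_tr m n (f : T -> 'M[R]_(m, n)) :
  measurable_mx f -> measurable_mx (fun t => (f t)^T).
Proof. by move=> mf i j; under eq_fun do rewrite mxE; exact: mf. Qed.

Lemma measurable_mx_cols n p (f : T -> 'M[R]_(n, p)) M :
  measurable_mx f -> measurable_mx (fun t => submx_cols (f t) M).
Proof. by move=> mf i j; under eq_fun do rewrite mxE; exact: mf. Qed.

Lemma measurable_det n (f : T -> 'M[R]_n) :
  measurable_mx f -> measurable_fun setT (fun t => \det (f t)).
Proof.
move=> mf; apply: measurable_sum => s; apply: measurable_funM => //.
by apply: measurable_prod => i _; exact: mf.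
Qed.

Lemma measurable_mx_inv n (f : T -> 'M[R]_n) :
  measurable_mx f -> measurable_mx (fun t => invmx (f t)).
Proof.
move=> mf i j; have md := measurable_det mf.
rewrite (_ : (fun t => _) = fun t => if \det (f t) == 0 then f t i j else
    (\det (f t))^-1 * \adj (f t) i j); last first.
  apply/funext => t; rewrite /invmx unitmxE unitfE; case: eqP => //= _.
  by rewrite !mxE.
apply: measurable_fun_ifT => //.
- apply: (measurable_fun_bool true); rewrite setTI.
  rewrite (_ : _ @^-1` _ = [set t | \det (f t) = 0]).
    by apply: measurable_set_eq.
  by apply/seteqP; split => t /= /eqP.
- apply: measurable_funM; first exact: (measurableT_comp (@measurable_invr R) md).
  under eq_fun do rewrite mxE /cofactor; apply: measurable_funM => //.
  by apply: measurable_det => k l; under eq_fun do rewrite !mxE; exact: mf.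
Qed.

Lemma measurable_sqn n (f : T -> 'cV[R]_n) :
  measurable_mx f -> measurable_fun setT (fun t => sqn (f t)).
Proof. by move=> mf; apply: measurable_sum => i; apply: measurable_funM. Qed.

End measurable_matrices.

Section measurable_statistics.
Context {d : measure_display} (T : measurableType d) (R : realType) (n p : nat).
Variables (X : T -> 'M[R]_(n, p)) (Y : T -> 'cV[R]_n).
Hypotheses (mX : measurable_mx X) (mY : measurable_mx Y).

Lemma measurable_ols M : measurable_mx (fun t => ols (X t) (Y t) M).
Proof.
have mC := measurable_mx_cols (M := M) mX; have mCt := measurable_mx_tr mC.
apply: measurable_mxM; last exact: measurable_mxM.
by apply: measurable_mx_inv; exact: measurable_mxM.
Qed.

Lemma measurable_ols_ext M : measurable_mx (fun t => ols_ext (X t) (Y t) M).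
Proof.
move=> i j; rewrite (_ : (fun t => _) = fun t =>
    \sum_k (if enum_val k == i then ols (X t) (Y t) M k 0 else 0)); last first.
  by apply/funext => t; rewrite mxE big_mkcond.
by apply: measurable_sum => k; case: (enum_val k == i); [exact: measurable_ols|exact: measurable_cst].
Qed.

Lemma measurable_marginal j : measurable_fun setT (fun t => marginal (X t) (Y t) j).
Proof.
apply: measurable_funM => //; apply: measurable_sum => i.
by apply: measurable_funM; [exact: mY|exact: mX].
Qed.

Lemma measurable_t_stat (M : {set 'I_p}) (k : 'I_#|M|) :
  measurable_fun setT (fun t => @t_stat R n p (X t) (Y t) M k).
Proof.
have mo : measurable_mx (fun t => ols (X t) (Y t) M) by exact: measurable_ols.
have mC := measurable_mx_cols (M := M) mX; have mCt := measurable_mx_tr mC.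
apply: measurable_funM; first exact: mo.
apply: measurableT_comp (@measurable_invr R) _; apply: measurable_funM.
  apply: measurableT_comp (@measurable_sqrtr R) _; apply: measurable_funM => //.
  apply: measurable_sum => i; apply: measurable_funX.
  have := measurable_mxB mY (measurable_mxM mC mo); exact.
apply: measurableT_comp (@measurable_sqrtr R) _.
have := measurable_mx_inv (measurable_mxM mCt mC); exact.
Qed.

Lemma measurable_clean M (alpha : R) S :
  measurable [set t | clean (X t) (Y t) M alpha = S].
Proof.
pose c := normal_upper_quantile (alpha / (2 * #|M|%:R)).
pose K := {set 'I_#|M|}.
rewrite (_ : [set t | _] = [set t | exists A : K, [set enum_val k | k in A]%SET = S /\
    forall k, (k \in A) = (c < `|@t_stat R n p (X t) (Y t) M k|)]); last first.
  apply/seteqP; split => t /=.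
    move=> <-; exists [set k | c < `|@t_stat R n p (X t) (Y t) M k|]%SET; split.
      by apply/setP => j; apply/imsetP/imsetP => -[k kA ->]; exists k => //;
        rewrite !finset.inE in kA *.
    by move=> k; rewrite finset.inE.
  move=> [A [<- HA]]; apply/setP => j; apply/imsetP/imsetP => -[k kA ->]; exists k => //;
    by move: kA; rewrite HA finset.inE.
apply: measurable_exists => A.
have [AS|AS] := pselect ([set enum_val k | k in A]%SET = S); last first.
  by rewrite (_ : (fun t => _) = set0)//; apply/seteqP; split => t // [].
rewrite (_ : (fun t => _) = [set t | forall k, (k \in A) = (c < `|@t_stat R n p (X t) (Y t) M k|)]).
  apply: measurable_forall => k.
  have mk : measurable_fun setT (fun t => `|@t_stat R n p (X t) (Y t) M k|).
    by apply: measurableT_comp => //; exact: measurable_t_stat.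
  case: (k \in A).
    rewrite (_ : (fun t => _) = [set t | c < `|@t_stat R n p (X t) (Y t) M k|]).
      exact: measurable_set_lt.
    by apply/seteqP; split => t /= => [<-|->].
  rewrite (_ : (fun t => _) = [set t | `|@t_stat R n p (X t) (Y t) M k| <= c]).
    exact: measurable_set_le.
  by apply/seteqP; split => t /=; rewrite leNgt; [move=> <-|move=> /negbTE ->].
by apply/seteqP; split => t /=; [case|].
Qed.

End measurable_statistics.

Section optimal_sets.
Context {R : realType} (n p : nat) (X1 X2 : 'M[R]_(n, p)) (Y1 Y2 : 'cV[R]_n).

(** The sets obtained by thresholding, described without the threshold. They range over a finite
    type, which makes optimality a measurable condition. *)
Definition prefix_set (M : {set 'I_p}) : Prop :=
  forall j j', j \in M -> j' \notin M -> `|marginal X1 Y1 j'| < `|marginal X1 Y1 j|.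

Lemma screen_prefix lam : prefix_set (screen X1 Y1 lam).
Proof.
move=> j j'; rewrite !finset.inE -ltNge => lj lj'.
exact: lt_le_trans lj' lj.
Qed.

(** The threshold is the smallest absolute marginal in M, or anything above all marginals when M is
    empty. *)
Lemma prefix_screen M : prefix_set M -> exists lam, screen X1 Y1 lam = M.
Proof.
move=> HM; have [->|[j0 j0M]] := set_0Vmem M.
  exists (1 + \sum_j `|marginal X1 Y1 j|); apply/setP => j; rewrite !finset.inE.
  apply/negbTE; rewrite -ltNge (bigD1 j)//= addrCA ltrDl.
  by rewrite ltr_pwDl// sumr_ge0.
case: (@Order.TotalTheory.arg_minP _ _ _ j0 (mem M) (fun j => `|marginal X1 Y1 j|) j0M).
move=> j jM jmin; exists `|marginal X1 Y1 j|; apply/setP => i; rewrite finset.inE.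
have [iM|iM] := boolP (i \in M); first exact: jmin.
by apply/negbTE; rewrite -ltNge; exact: HM.
Qed.

Definition cv_set (M : {set 'I_p}) : R :=
  n%:R^-1 * \sum_(i < n) (Y2 i 0 - (X2 *m ols_ext X1 Y1 M) i 0) ^+ 2.

(** Cross-validation as a minimisation over finitely many sets: whichever minimising threshold is
    chosen, it selects such a set. *)
Definition cv_optimal k M : Prop :=
  [/\ prefix_set M, (#|M| <= k)%N &
      forall M', prefix_set M' /\ (#|M'| <= k)%N -> cv_set M <= cv_set M'].

Lemma minimizer_optimal k lam :
  minimizes (admissible X1 Y1 k) (cv_loss X1 Y1 X2 Y2) lam ->
  cv_optimal k (screen X1 Y1 lam).
Proof.
move=> [adm opt]; split; [exact: screen_prefix|exact: adm|].
by move=> M' [/prefix_screen[lam' <-] kM']; exact: opt.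
Qed.

End optimal_sets.

Section measurable_optimal.
Context {d : measure_display} (T : measurableType d) (R : realType) (n p : nat).
Variables (X1 X2 : T -> 'M[R]_(n, p)) (Y1 Y2 : T -> 'cV[R]_n).
Hypotheses (mX1 : measurable_mx X1) (mY1 : measurable_mx Y1)
  (mX2 : measurable_mx X2) (mY2 : measurable_mx Y2).

Lemma measurable_prefix_set M : measurable [set t | prefix_set (X1 t) (Y1 t) M].
Proof.
apply: measurable_forall => j; apply: measurable_forall => j'.
apply: measurable_cst_imp; apply: measurable_cst_imp.
apply: measurable_set_lt; apply: measurableT_comp => //; exact: measurable_marginal.
Qed.

Lemma measurable_cv_set M :
  measurable_fun setT (fun t => cv_set (X1 t) (X2 t) (Y1 t) (Y2 t) M).
Proof.
apply: measurable_funM => //; apply: measurable_sum => i; apply: measurable_funX.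
apply: measurable_funB; first exact: mY2.
apply: (measurable_mxM (g := fun x => ols_ext (X1 x) (Y1 x) M) mX2).
exact: measurable_ols_ext.
Qed.

Lemma measurable_cv_optimal k M :
  measurable [set t | cv_optimal (X1 t) (X2 t) (Y1 t) (Y2 t) k M].
Proof.
have [kM|kM] := leqP #|M| k; last first.
  rewrite (_ : [set t | _] = set0)//; apply/seteqP; split => t //= -[_].
  by rewrite leqNgt kM.
rewrite (_ : [set t | _] = [set t | prefix_set (X1 t) (Y1 t) M] `&`
  [set t | forall M', prefix_set (X1 t) (Y1 t) M' /\ (#|M'| <= k)%N ->
     cv_set (X1 t) (X2 t) (Y1 t) (Y2 t) M <= cv_set (X1 t) (X2 t) (Y1 t) (Y2 t) M']).
  apply: measurableI; first exact: measurable_prefix_set.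
  apply: measurable_forall => M'; apply: measurable_imp.
    have [kM'|kM'] := leqP #|M'| k.
      rewrite (_ : (fun t => _) = [set t | prefix_set (X1 t) (Y1 t) M']).
        exact: measurable_prefix_set.
      by apply/seteqP; split => t /=; [case|].
    by rewrite (_ : (fun t => _) = set0)//; apply/seteqP; split => t // [_].
  by apply: measurable_set_le; exact: measurable_cv_set.
by apply/seteqP; split => t /= [] //; move=> H1 H2; split.
Qed.

End measurable_optimal.

Lemma is_normal_point d (Omega : measurableType d) (R : realType)
    (P : probability Omega R) (e : Omega -> R) (s c : R) :
  is_normal P e s -> 0 < s -> P [set w | e w = c] = 0%E.
Proof.
move=> ne s0; rewrite (_ : [set w | _] = e @^-1` [set c])// ne//.
have := @normal_prob_dominates R 0 s; move=> /null_content_dominatesP; apply => //.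
exact: lebesgue_measure_set1.
Qed.

Section noise_resampling.
Context {d : measure_display} (Omega : measurableType d) (R : realType)
  (P : probability Omega R) (n p : nat).
Local Notation N := (3 * n)%N.
Local Notation T := (p.-tuple R * R)%type.
Variables (Z : 'I_N -> Omega -> T) (beta : 'cV[R]_p) (sigma B : R)
  (Sig : nat -> nat -> R).
Hypothesis good : good_sample P Z beta sigma B Sig.
Hypothesis sigma0 : 0 < sigma.

Definition covs (w : Omega) : N.-tuple (p.-tuple R) := [tuple (Z i w).1 | i < N].
Definition noises (w : Omega) : N.-tuple R := [tuple resid beta (Z i w) | i < N].
Definition design_x (g : 'I_3) (x : N.-tuple (p.-tuple R)) : 'M[R]_(n, p) :=
  \matrix_(i, j) tnth (tnth x (mxvec_index g i)) j.
Definition noise_e (g : 'I_3) (e : N.-tuple R) : 'cV[R]_n :=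
  \col_i tnth e (mxvec_index g i).
Definition group_indices (g : 'I_3) : {set 'I_N} :=
  [set mxvec_index g i | i : 'I_n]%SET.

Lemma mxvec_index_neq (g g' : 'I_3) (i i' : 'I_n) : g != g' ->
  mxvec_index g i != mxvec_index g' i'.
Proof.
by apply: contra_neq => /(congr1 (@nat_of_ord _))/= /ord_inj/enum_rank_inj[].
Qed.

Lemma splice_group_in (U : Type) (g : 'I_3) (a b : N.-tuple U) i :
  tnth [tuple if i \in group_indices g then tnth b i else tnth a i | i < N]
    (mxvec_index g i) = tnth b (mxvec_index g i).
Proof. by rewrite tnth_mktuple imset_f. Qed.

Lemma splice_group_out (U : Type) (g g' : 'I_3) (a b : N.-tuple U) i : g' != g ->
  tnth [tuple if i \in group_indices g then tnth b i else tnth a i | i < N]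
    (mxvec_index g' i) = tnth a (mxvec_index g' i).
Proof.
move=> gg; rewrite tnth_mktuple; case: imsetP => // -[i' _ E].
by have := mxvec_index_neq i i' gg; rewrite E eqxx.
Qed.

Lemma design_tup g w : design_of g (tup Z w) = design_x g (covs w).
Proof. by apply/matrixP => i j; rewrite !mxE !tnth_mktuple. Qed.

Lemma responses_tup g w :
  responses_of g (tup Z w) = design_x g (covs w) *m beta + noise_e g (noises w).
Proof.
apply/matrixP => i j; rewrite !mxE !tnth_mktuple /resid addrC.
rewrite [X in _ = _ + X](eq_bigr (fun j => tnth (Z (mxvec_index g i) w).1 j * beta j 0)).
  by rewrite subrK.
by move=> l _; rewrite !mxE tnth_mktuple ord1.
Qed.

Let me i : measurable_fun setT (fun w => resid beta (Z i w)).
Proof. exact: measurableT_comp (measurable_resid beta) (gs_meas good i). Qed.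

Lemma measurable_covs : measurable_fun setT covs.
Proof.
apply/measurable_fun_tnthP => i; rewrite (_ : _ \o _ = fst \o Z i).
  exact: measurableT_comp measurable_fst (gs_meas good i).
by apply/funext => w /=; rewrite tnth_mktuple.
Qed.

Lemma measurable_noises : measurable_fun setT noises.
Proof. exact: measurable_tup me. Qed.

(** All covariates are frozen, and only the noise of group g is redrawn. *)
Lemma resample_noise (g : 'I_3) (H : set (N.-tuple (p.-tuple R) * N.-tuple R)%type)
    (b : \bar R) : measurable H -> (0 <= b)%E ->
  {ae P, forall w,
    (P [set w' | H (covs w, splice (group_indices g) (noises w) (noises w'))] <= b)%E} ->
  (P [set w | H (covs w, noises w)] <= b)%E.
Proof.
move=> mH b0 Hb.
exact: (prob_resample_snd me (gs_noise_ind good) (0 : R) measurable_covs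
  (gs_indep good) mH b0 Hb).
Qed.

Lemma noise_splice_in g a b : noise_e g (splice (group_indices g) a b) = noise_e g b.
Proof. by apply/matrixP => i j; rewrite !mxE splice_group_in. Qed.

Lemma noise_splice_out g g' a b : g' != g ->
  noise_e g' (splice (group_indices g) a b) = noise_e g' a.
Proof. by move=> gg; apply/matrixP => i j; rewrite !mxE splice_group_out. Qed.

Let e g (i : 'I_n) w := resid beta (Z (mxvec_index g i) w).

Let dotE' g (a : 'cV[R]_n) w : dot a (noise_e g (noises w)) =
  \sum_(i <- index_enum 'I_n) a i 0 * e g i w.
Proof. by apply: eq_bigr => i _; rewrite mxE tnth_mktuple. Qed.

Lemma noise_dot_normal g (a : 'cV[R]_n) : sqn a != 0 ->
  is_normal P (fun w => dot a (noise_e g (noises w))) (Num.sqrt (sqn a) * sigma).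
Proof.
move=> a0; rewrite (_ : (fun w => _) = fun w => \sum_(i <- index_enum 'I_n) a i 0 * e g i w).
  rewrite sqnE; apply: is_normal_sum => //.
  - by move=> i; exact: me.
  - exact: mutually_independent_inj (@mxvec_index_inj _ _ g) (gs_noise_ind good).
  - by move=> i; exact: (gs_normal good (mxvec_index g i)).
  - exact: index_enum_uniq.
by apply/funext => w; rewrite dotE'.
Qed.

Lemma measurable_noise_dot g (a : 'cV[R]_n) :
  measurable_fun setT (fun w => dot a (noise_e g (noises w))).
Proof.
rewrite (_ : (fun w => _) = fun w => \sum_(i <- index_enum 'I_n) a i 0 * e g i w).
  by apply: measurable_sum => i; apply: measurable_funM => //; exact: me.
by apply/funext => w; rewrite dotE'.
Qed.

Let sd0 (a : 'cV[R]_n) : sqn a != 0 -> 0 < Num.sqrt (sqn a) * sigma.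
Proof. by move=> a0; rewrite mulr_gt0// sqrtr_gt0 lt_def a0 sqn_ge0. Qed.

Lemma noise_dot_null g (a : 'cV[R]_n) c : sqn a != 0 ->
  P [set w | dot a (noise_e g (noises w)) = c] = 0%E.
Proof. by move=> a0; exact: is_normal_point (noise_dot_normal g a0) (sd0 a0). Qed.

Lemma noise_dot_sq g (a : 'cV[R]_n) :
  (\int[P]_w (dot a (noise_e g (noises w)) ^+ 2)%:E = (sigma ^+ 2 * sqn a)%:E)%E.
Proof.
have [a0|a0] := eqVneq (sqn a) 0.
  have /eqP -> : a == 0 by rewrite -sqn_eq0 a0.
  under eq_integral do rewrite dot0l expr0n.
  by rewrite integral0 (_ : sqn 0 = 0) ?mulr0//; apply/eqP; rewrite sqn_eq0.
rewrite (expect_sq (measurable_noise_dot g a) (noise_dot_normal g a0) (sd0 a0)).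
by rewrite exprMn sqr_sqrtr ?sqn_ge0// mulrC.
Qed.

Lemma noise_dot_tail g (a : 'cV[R]_n) c : sqn a != 0 -> 0 <= c ->
  P [set w | sigma * Num.sqrt (sqn a) * c < `|dot a (noise_e g (noises w))|] =
  (2 * tail c)%:E.
Proof.
move=> a0 c0; have s0 := sd0 a0; set s := Num.sqrt (sqn a) * sigma in s0.
have si : s^-1 != 0 by rewrite invr_eq0 gt_eqF.
have := is_normal_scale (measurable_noise_dot g a) (noise_dot_normal g a0) si.
rewrite -/s gt_eqF// => /(_ isT); rewrite gtr0_norm ?invr_gt0// mulVf ?gt_eqF// => nrm.
rewrite -normal_prob_abs// -nrm; last first.
  by apply: measurable_set_lt => //; exact: measurableT_comp.
congr (P _); apply/seteqP; split => w /=.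
  by rewrite normrM gtr0_norm ?invr_gt0// ltr_pdivlMl// [sigma * _]mulrC.
by rewrite normrM gtr0_norm ?invr_gt0// ltr_pdivlMl// [sigma * _]mulrC.
Qed.

End noise_resampling.

(** * The cleaning stage *)

Section full_rank.
Context {R : realType} (n p : nat).

(** Sizes up to n include the union of two selected sets, as 2 k <= n. *)
Definition full_rank (X : 'M[R]_(n, p)) : Prop :=
  forall M : {set 'I_p}, (#|M| <= n)%N ->
    (submx_cols X M)^T *m submx_cols X M \in unitmx.

Lemma full_rank_inj X (M : {set 'I_p}) v : full_rank X -> (#|M| <= n)%N ->
  supported M v -> X *m v = 0 -> v = 0.
Proof.
move=> fX Mn sv Xv; apply/eqP; rewrite -sqn_eq0 -(sqn_restrict sv) sqn_eq0.
have : (submx_cols X M)^T *m submx_cols X M *m restrict_to M v = 0.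
  by rewrite -mulmxA (submx_restrict X sv) Xv mulmx0.
by move=> /(congr1 (mulmx (invmx ((submx_cols X M)^T *m submx_cols X M))));
  rewrite mulKmx ?fX// mulmx0 => ->.
Qed.

Lemma sparse_eig_full_rank X : (n <= p)%N -> 0 < sparse_eig_min X n -> full_rank X.
Proof.
move=> np X0 M Mn; apply: submx_unit => v sv Xv; apply/eqP.
have := @sparse_eig_min_le _ _ _ X M n v; rewrite Mn np => /(_ isT sv).
rewrite Xv (_ : sqn 0 = 0); last by apply/eqP; rewrite sqn_eq0.
rewrite mulr0 pmulr_rle0// => H.
by rewrite -sqn_eq0 eq_le H sqn_ge0.
Qed.

Lemma cv_setE (X1 X2 : 'M[R]_(n, p)) (Y1 Y2 : 'cV[R]_n) M :
  cv_set X1 X2 Y1 Y2 M = n%:R^-1 * sqn (Y2 - X2 *m ols_ext X1 Y1 M).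
Proof.
by rewrite /cv_set sqnE; congr (_ * _); apply: eq_bigr => i _; rewrite !mxE.
Qed.

Lemma coef_row_neq0 m (W : 'M[R]_(n, m)) k : W^T *m W \in unitmx ->
  sqn (row k (invmx (W^T *m W) *m W^T))^T != 0.
Proof.
move=> A; rewrite sqn_eq0; apply/eqP => /(congr1 (fun x => x^T *m W)).
rewrite trmxK -row_mul -mulmxA mulVmx// trmx0 mul0mx => /matrixP/(_ 0 k)/eqP.
by rewrite !mxE eqxx oner_eq0.
Qed.

Definition gram_dev (Sig : nat -> nat -> R) (X : 'M[R]_(n, p)) (M : {set 'I_p}) : R :=
  \sum_(j in M) \sum_(l in M) (n%:R^-1 * (\sum_i X i j * X i l) - Sig j l) ^+ 2.

(* By Cauchy-Schwarz, the two quadratic forms differ by at most the Frobenius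
   norm of the difference. *)
Lemma gram_dev_lb (Sig : nat -> nat -> R) (X : 'M[R]_(n, p)) M (kappa : R) v :
  0 < kappa -> kappa * sqn v <= pop_form Sig v ->
  gram_dev Sig X M <= kappa ^+ 2 / 4 -> supported M v ->
  kappa / 2 * sqn v <= n%:R^-1 * sqn (X *m v).
Proof.
move=> k0 lb dev sv; have [v0|v0] := eqVneq (sqn v) 0.
  by rewrite v0 mulr0 mulr_ge0 ?invr_ge0 ?sqn_ge0.
have S0 : 0 < sqn v by rewrite lt_def v0 sqn_ge0.
pose Dl j l := n%:R^-1 * (\sum_i X i j * X i l) - Sig j l.
have supp_sum (f : 'I_p -> R) : (forall j, j \notin M -> f j = 0) ->
    \sum_j f j = \sum_(j in M) f j.
  by move=> f0; rewrite (bigID (mem M))/= [X in _ + X]big1 ?addr0.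
have E : n%:R^-1 * sqn (X *m v) - pop_form Sig v =
    \sum_(j in M) \sum_(l in M) v j 0 * v l 0 * Dl j l.
  transitivity (\sum_j \sum_l v j 0 * v l 0 * Dl j l).
    rewrite gram_form /pop_form -sumrB; apply: eq_bigr => j _; rewrite -sumrB.
    by apply: eq_bigr => l _; rewrite -mulrBr.
  rewrite supp_sum => [|j jM].
    apply: eq_bigr => j jM; rewrite supp_sum// => l lM.
    by rewrite (sv l lM) mulr0 mul0r.
  by rewrite big1// => l _; rewrite (sv j jM) !mul0r.
have S2 : \sum_(j in M) \sum_(l in M) v j 0 ^+ 2 * v l 0 ^+ 2 = sqn v ^+ 2.
  have SE : \sum_(l in M) v l 0 ^+ 2 = sqn v.
    by rewrite sqnE [RHS]supp_sum// => j jM; rewrite (sv j jM) expr0n.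
  rewrite (eq_bigr (fun j => v j 0 ^+ 2 * sqn v)) => [|j _]; last by rewrite -mulr_sumr SE.
  by rewrite -mulr_suml SE expr2.
have : - (kappa / 2 * sqn v) <= \sum_(j in M) \sum_(l in M) v j 0 * v l 0 * Dl j l.
  (* Young's inequality with weights for which each of the two parts sums to at most kappa / 4 times
     the squared norm of v. *)
  apply: (@le_trans _ _ (\sum_(j in M) \sum_(l in M)
     - (kappa / (4 * sqn v) * (v j 0 ^+ 2 * v l 0 ^+ 2) + sqn v / kappa * Dl j l ^+ 2))).
    have SS (a b : R) (x y : 'I_p -> 'I_p -> R) :
        \sum_(j in M) \sum_(l in M) - (a * x j l + b * y j l) =
        - (a * (\sum_(j in M) \sum_(l in M) x j l) +
           b * \sum_(j in M) \sum_(l in M) y j l).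
      rewrite !mulr_sumr -big_split -sumrN; apply: eq_bigr => j _.
      by rewrite !mulr_sumr -big_split -sumrN.
    rewrite SS S2 lerN2.
    have -> : kappa / (4 * sqn v) * sqn v ^+ 2 = kappa / 4 * sqn v by field.
    have : sqn v / kappa * gram_dev Sig X M <= sqn v / kappa * (kappa ^+ 2 / 4).
      by rewrite ler_wpM2l// divr_ge0 ?ltW.
    have -> : sqn v / kappa * (kappa ^+ 2 / 4) = kappa / 4 * sqn v.
      by field; rewrite gt_eqF.
    rewrite /gram_dev; lra.
  apply: ler_sum => j _; apply: ler_sum => l _; rewrite lerNl.
  set a := v j 0 * v l 0; set z := Dl j l.
  have -> : v j 0 ^+ 2 * v l 0 ^+ 2 = a ^+ 2 by rewrite exprMn.
  have -> : kappa / (4 * sqn v) * a ^+ 2 + sqn v / kappa * z ^+ 2 =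
     - (a * z) + (kappa * a + 2 * sqn v * z) ^+ 2 / (4 * sqn v * kappa).
    by field; rewrite v0 gt_eqF.
  by rewrite lerDl divr_ge0 ?sqr_ge0 ?mulr_ge0// ltW.
rewrite -E; lra.
Qed.

End full_rank.

Lemma measurable_full_rank d (T : measurableType d) (R : realType) n p
    (X : T -> 'M[R]_(n, p)) : measurable_mx X -> measurable [set t | full_rank (X t)].
Proof.
move=> mX; apply: measurable_forall => M; apply: measurable_cst_imp.
rewrite (_ : (fun t => _) = ~` [set t | \det ((submx_cols (X t) M)^T *m submx_cols (X t) M) = 0]).
  apply: measurableC; apply: measurable_set_eq => //; apply: measurable_det.
  have mC := measurable_mx_cols (M := M) mX.
  by apply: measurable_mxM => //; exact: measurable_mx_tr.
by apply/seteqP; split => t /=; rewrite unitmxE unitfE; move/eqP.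
Qed.

Lemma ae_not d (T : measurableType d) (R : realType) (P : probability T R) (A : set T) :
  measurable A -> (P A <= 0)%E -> {ae P, forall w, ~ A w}.
Proof.
move=> mA A0; exists A; split=> //; last by move=> w /contrapT.
by apply/eqP; rewrite eq_le A0 measure_ge0.
Qed.

(** * Almost sure uniqueness of the cross-validated set *)

Section uniqueness.
Context {d : measure_display} (Omega : measurableType d) (R : realType)
  (P : probability Omega R) (n p : nat).
Local Notation N := (3 * n)%N.
Local Notation T := (p.-tuple R * R)%type.
Variables (Z : 'I_N -> Omega -> T) (beta : 'cV[R]_p) (sigma B : R)
  (Sig : nat -> nat -> R).
Hypothesis good : good_sample P Z beta sigma B Sig.
Hypothesis sigma0 : 0 < sigma.
Hypothesis n_gt0 : (0 < n)%N.

Local Notation U := (N.-tuple (p.-tuple R) * N.-tuple R)%type.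
Let X_ g (z : U) := design_x g z.1.
Let E_ g (z : U) := noise_e g z.2.
Let Y_ g (z : U) := X_ g z *m beta + E_ g z.

Lemma measurable_X g : measurable_mx (X_ g).
Proof.
move=> i j; rewrite /X_ /design_x; under eq_fun do rewrite mxE.
apply: measurableT_comp (measurable_tnth j) _.
exact: measurableT_comp (measurable_tnth _) measurable_fst.
Qed.

Lemma measurable_E g : measurable_mx (E_ g).
Proof.
move=> i j; rewrite /E_ /noise_e; under eq_fun do rewrite mxE.
exact: measurableT_comp (measurable_tnth _) measurable_snd.
Qed.

Lemma measurable_Y g : measurable_mx (Y_ g).
Proof.
apply: measurable_mxD; last exact: measurable_E.
by apply: measurable_mxM; [exact: measurable_X|exact: measurable_mx_cst].
Qed.

Let data w : U := (covs Z w, noises Z beta w).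

Lemma measurable_xe : measurable_fun setT data.
Proof.
by apply/measurable_fun_pair; [exact: measurable_covs good|exact: measurable_noises good].
Qed.

Lemma measurable_resampled g (H : set U) w : measurable H ->
  measurable [set w' | H (covs Z w,
    splice (group_indices n g) (noises Z beta w) (noises Z beta w'))].
Proof.
move=> mH; apply: measurable_preimage mH; apply/measurable_fun_pair => //.
by apply: measurable_splice => //; exact: measurable_noises good.
Qed.

(** Given a design of full rank, each fitted coefficient is a nondegenerate Gaussian and avoids 0.
    Hence the support of a fit determines the set it was fitted on. *)
Lemma ae_coef_neq0 g (M : {set 'I_p}) (k : 'I_#|M|) : (#|M| <= n)%N ->
  {ae P, forall w, ~ (full_rank (X_ g (data w)) /\
    ols (X_ g (data w)) (Y_ g (data w)) M k 0 = 0)}.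
Proof.
move=> Mn; pose H := [set z | full_rank (X_ g z) /\ ols (X_ g z) (Y_ g z) M k 0 = 0].
have mH : measurable H.
  apply: measurableI; first exact: measurable_full_rank (measurable_X g).
  apply: measurable_set_eq => //.
  exact: (measurable_ols (measurable_X g) (measurable_Y g)).
apply: ae_not; first exact: measurable_preimage measurable_xe mH.
apply: (resample_noise good (g := g) (H := H)) => //; apply: aeW => w.
have [fX|nfX] := pselect (full_rank (design_x g (covs Z w))); last first.
  rewrite (_ : [set w' | _] = set0) ?measure0//.
  by apply/seteqP; split => w' // -[].
set X := design_x g (covs Z w) in fX.
pose W := submx_cols X M; pose G := invmx (W^T *m W) *m W^T.
have a0 : sqn (row k G)^T != 0 by apply: coef_row_neq0; exact: fX.
rewrite -(noise_dot_null good sigma0 g (- (G *m (X *m beta)) k 0) a0).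
apply: le_measure; rewrite ?inE.
- exact: measurable_resampled mH.
- by apply: measurable_set_eq => //; exact: measurable_noise_dot good g _.
move=> w' [_ /=]; rewrite /ols /Y_ /X_ /E_/= -/X -/W noise_splice_in.
rewrite mulmxA -/G mulmxDr mxE => /eqP; rewrite addrC addr_eq0 => /eqP <-.
by rewrite mxE /dot; apply: eq_bigr => i _; rewrite !mxE.
Qed.

(** Once the covariates and the first group are frozen, the difference of the two losses is affine
    in the noise of the second group, with slope proportional to the image of f' - f under X2. Full
    rank makes this image nonzero, because f' - f is supported on at most 2 k coordinates. *)
Lemma ae_no_tie k (M M' : {set 'I_p}) : (#|M| <= k)%N -> (#|M'| <= k)%N ->
  (2 * k <= n)%N ->
  {ae P, forall w, let X1 := X_ group_screen (data w) in
     let Y1 := Y_ group_screen (data w) in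
     let X2 := X_ group_validate (data w) in
     let Y2 := Y_ group_validate (data w) in
     ~ [/\ full_rank X2, ols_ext X1 Y1 M <> ols_ext X1 Y1 M' &
       cv_set X1 X2 Y1 Y2 M = cv_set X1 X2 Y1 Y2 M']}.
Proof.
move=> Mk M'k kn.
pose H := [set z : U | let X1 := X_ group_screen z in
     let Y1 := Y_ group_screen z in
     let X2 := X_ group_validate z in
     let Y2 := Y_ group_validate z in
     [/\ full_rank X2, ols_ext X1 Y1 M <> ols_ext X1 Y1 M' &
       cv_set X1 X2 Y1 Y2 M = cv_set X1 X2 Y1 Y2 M']].
have mX := measurable_X; have mY := measurable_Y.
have mf M0 : measurable_mx (fun z => ols_ext (X_ group_screen z) (Y_ group_screen z) M0).
  exact: measurable_ols_ext.
have mH : measurable H.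
  rewrite (_ : H = [set z | full_rank (X_ group_validate z)] `&`
     ~` [set z | forall j, ols_ext (X_ group_screen z) (Y_ group_screen z) M j 0 =
        ols_ext (X_ group_screen z) (Y_ group_screen z) M' j 0] `&`
     [set z | cv_set (X_ group_screen z) (X_ group_validate z) (Y_ group_screen z)
        (Y_ group_validate z) M = cv_set (X_ group_screen z) (X_ group_validate z)
        (Y_ group_screen z) (Y_ group_validate z) M']).
    apply: measurableI; last first.
      by apply: measurable_set_eq; exact: measurable_cv_set.
    apply: measurableI; first exact: measurable_full_rank (mX _).
    apply: measurableC; apply: measurable_forall => j.
    by apply: measurable_set_eq; exact: mf.
  apply/seteqP; split => z /= [].
    move=> h1 h2 h3; split=> //; split=> // h; apply: h2.
    by apply/matrixP => j i; rewrite ord1.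
  by move=> [h1 h2] h3; split=> // h; apply: h2 => j; rewrite h.
apply: ae_not; first exact: measurable_preimage measurable_xe mH.
apply: (resample_noise good (g := group_validate) (H := H)) => //; apply: aeW => w.
set X1 := design_x group_screen (covs Z w); set X2 := design_x group_validate (covs Z w).
pose Y1 := X1 *m beta + noise_e group_screen (noises Z beta w).
pose f := ols_ext X1 Y1 M; pose f' := ols_ext X1 Y1 M'.
have [[fX ff]|no] := pselect (full_rank X2 /\ f <> f'); last first.
  rewrite (_ : [set w' | _] = set0) ?measure0//.
  apply/seteqP; split => w' // -[h1 h2 _]; apply: no; split; first exact: h1.
  by move: h2; rewrite /Y_ /X_ /E_/= noise_splice_out.
have a0 : sqn (X2 *m (f' - f)) != 0.
  rewrite sqn_eq0; apply/eqP => X0; apply: ff.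
  apply/eqP; rewrite eq_sym -subr_eq0; apply/eqP.
  apply: (full_rank_inj (M := (M :|: M')%SET) fX _ _ X0).
    apply: leq_trans (leq_card_setU _ _) _; apply: leq_trans kn.
    by rewrite mul2n -addnn leq_add.
  move=> j; rewrite finset.inE negb_or => /andP[jM jM'].
  have f0 : f j 0 = 0 := supported_extend (ols X1 Y1 M) jM.
  have f'0 : f' j 0 = 0 := supported_extend (ols X1 Y1 M') jM'.
  by rewrite mxE [X in _ + X]mxE f0 f'0 subrr.
pose u := X2 *m (beta - f); pose u' := X2 *m (beta - f').
rewrite -(noise_dot_null good sigma0 group_validate ((sqn u' - sqn u) / 2) a0).
apply: le_measure; rewrite ?inE.
- exact: measurable_resampled mH.
- by apply: measurable_set_eq => //; exact: measurable_noise_dot good _ _.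
move=> w' [_ _ /=]; rewrite !cv_setE /Y_ /X_ /E_/= noise_splice_in noise_splice_out//.
rewrite -/X1 -/X2 -/Y1 -/f -/f'; set e := noise_e _ _.
have YE g0 : X2 *m beta + e - X2 *m g0 = e + X2 *m (beta - g0).
  by rewrite mulmxBr addrAC addrC.
have n0 : n%:R^-1 != 0 :> R by rewrite invr_eq0 pnatr_eq0 -lt0n.
(* After the squared norm of e cancels, a tie means that the inner product of u - u' and e is half
   of |u'|^2 - |u|^2, an event of probability 0. *)
rewrite !YE -/u -/u' => /(mulfI n0); rewrite !sqnD => E.
have -> : X2 *m (f' - f) = u - u' by rewrite /u /u' -mulmxBr; congr (_ *m _); rewrite opprB [RHS]addrC addrA subrK.
rewrite dotDl dotNl dotC [dot u' e]dotC; lra.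
Qed.

Hypothesis rank : forall g, {ae P, forall w, full_rank (design_x g (covs Z w))}.

(** Two optimal sets tie, hence have the same fit, and fits with no zero coefficient on their sets
    have the same support only if the sets coincide. *)
Lemma ae_unique_optimal k : (2 * k <= n)%N ->
  {ae P, forall w, forall M M',
    let optimal := cv_optimal (design_of group_screen (tup Z w))
      (design_of group_validate (tup Z w)) (responses_of group_screen (tup Z w))
      (responses_of group_validate (tup Z w)) k in
    optimal M -> optimal M' -> M = M'}.
Proof.
move=> kn; have kn' : (k <= n)%N by rewrite (leq_trans _ kn)// leq_pmull.
have coefs : {ae P, forall w, forall (M : {set 'I_p}) (k0 : 'I_#|M|), (#|M| <= n)%N ->
    ~ (full_rank (X_ group_screen (data w)) /\
    ols (X_ group_screen (data w)) (Y_ group_screen (data w)) M k0 0 = 0)}.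
  apply: filter_forall => M; apply: filter_forall => k0.
  have [Mn|Mn] := leqP #|M| n; last by apply: aeW.
  by apply: filterS (ae_coef_neq0 group_screen k0 Mn) => w H _.
have ties : {ae P, forall w, forall M M' : {set 'I_p}, (#|M| <= k)%N -> (#|M'| <= k)%N ->
    let X1 := X_ group_screen (data w) in let Y1 := Y_ group_screen (data w) in
    let X2 := X_ group_validate (data w) in let Y2 := Y_ group_validate (data w) in
     ~ [/\ full_rank X2, ols_ext X1 Y1 M <> ols_ext X1 Y1 M' &
       cv_set X1 X2 Y1 Y2 M = cv_set X1 X2 Y1 Y2 M']}.
  apply: filter_forall => M; apply: filter_forall => M'.
  have [Mk|Mk] := leqP #|M| k; last by apply: aeW.
  have [M'k|M'k] := leqP #|M'| k; last by apply: aeW.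
  by apply: filterS (ae_no_tie Mk M'k kn) => w H _ _.
apply: filterS2 (filterI (rank group_screen) (rank group_validate)) (filterI coefs ties).
move=> w [r1 r2] [Hc Ht] M M'; rewrite !design_tup !(responses_tup _ beta) => opt opt'.
have {Ht} := Ht M M'; rewrite /X_ /Y_ /E_ /= /X_ /= => Ht.
have Mk : (#|M| <= k)%N by case: opt.
have M'k : (#|M'| <= k)%N by case: opt'.
have cvE : cv_set (design_x group_screen (covs Z w)) (design_x group_validate (covs Z w))
   (design_x group_screen (covs Z w) *m beta + noise_e group_screen (noises Z beta w))
   (design_x group_validate (covs Z w) *m beta + noise_e group_validate (noises Z beta w)) M =
   cv_set (design_x group_screen (covs Z w)) (design_x group_validate (covs Z w))
   (design_x group_screen (covs Z w) *m beta + noise_e group_screen (noises Z beta w))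
   (design_x group_validate (covs Z w) *m beta + noise_e group_validate (noises Z beta w)) M'.
  case: opt => pM _ lM; case: opt' => pM' _ lM'.
  by apply/eqP; rewrite eq_le lM// lM'.
have sub (A A' : {set 'I_p}) : (#|A| <= k)%N ->
   ols_ext (design_x group_screen (covs Z w))
     (design_x group_screen (covs Z w) *m beta + noise_e group_screen (noises Z beta w)) A =
   ols_ext (design_x group_screen (covs Z w))
     (design_x group_screen (covs Z w) *m beta + noise_e group_screen (noises Z beta w)) A' ->
   A \subset A'.
  move=> Ak E; apply/fintype.subsetP => j jA; apply: contraT => jA'.
  have := Hc A (enum_rank_in jA j) (leq_trans Ak kn') => /not_andP[] //.
  rewrite /X_ /Y_ /E_ /= /X_ /=; set O := ols _ _ _ => O0; exfalso; apply: O0.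
  have <- : extend O j 0 = O (enum_rank_in jA j) 0.
    have := restrict_extend O => /matrixP/(_ (enum_rank_in jA j) 0).
    by rewrite mxE enum_rankK_in.
  exact: (etrans (congr1 (fun f : 'cV[R]_p => f j 0) E) (supported_extend _ jA')).
have [E|NE] := pselect (ols_ext (design_x group_screen (covs Z w))
     (design_x group_screen (covs Z w) *m beta + noise_e group_screen (noises Z beta w)) M =
   ols_ext (design_x group_screen (covs Z w))
     (design_x group_screen (covs Z w) *m beta + noise_e group_screen (noises Z beta w)) M').
  by apply/eqP; rewrite finset.eqEsubset sub//= sub.
by exfalso; exact: (Ht Mk M'k).
Qed.

End uniqueness.

Lemma expect_sum_le d (Omega : measurableType d) (R : realType)
    (P : probability Omega R) (I : eqType) (s : seq I) (F : I -> Omega -> R) (b : R) :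
  (forall i, measurable_fun setT (F i)) -> (forall i w, 0 <= F i w) ->
  (forall i, (\int[P]_w (F i w)%:E <= b%:E)%E) ->
  (\int[P]_w (\sum_(i <- s) F i w)%:E <= ((size s)%:R * b)%:E)%E.
Proof.
move=> mF F0 Fb; under eq_integral do rewrite -sumEFin.
rewrite ge0_integral_sum//; last 2 first.
- by move=> i; exact/measurable_EFinP.
- by move=> i w _; rewrite lee_fin.
elim: s => [|i s IH]; first by rewrite big_nil mul0r.
by rewrite big_cons/= -addn1 addnC natrD mulrDl mul1r EFinD leeD.
Qed.

(** * Cleaning errors for a fixed selected set *)

Section fixed_model.
Context {d : measure_display} (Omega : measurableType d) (R : realType)
  (P : probability Omega R) (n p : nat).
Local Notation N := (3 * n)%N.
Local Notation T := (p.-tuple R * R)%type.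
Variables (Z : 'I_N -> Omega -> T) (beta : 'cV[R]_p) (sigma B b1 : R)
  (Sig : nat -> nat -> R).
Hypothesis good : good_sample P Z beta sigma B Sig.
Hypothesis sigma0 : 0 < sigma.
Hypothesis n_gt0 : (0 < n)%N.
Hypothesis B0 : 0 < B.
Hypothesis beta_le : \sum_j `|beta j 0| <= b1.
Hypothesis Sig_le : forall j l : 'I_p, `|Sig j l| <= B ^+ 2.

Let n0 : 0 < n%:R :> R. Proof. by rewrite ltr0n. Qed.
Let K := exp_const sigma B b1.
Let mZ := gs_meas good.
Let g : 'I_3 := group_clean.
Let X w := design_x g (covs Z w).
Let e w := noise_e g (noises Z beta w).
Local Notation U := (N.-tuple (p.-tuple R) * N.-tuple R)%type.

Let entry (j l : 'I_p) w := (n%:R^-1 * (\sum_i X w i j * X w i l) - Sig j l) ^+ 2.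

Let mX : measurable_mx X.
Proof.
move=> i j; apply: measurableT_comp (measurable_X g i j) (measurable_xe good).
Qed.

Let me : measurable_mx e.
Proof.
move=> i j; apply: measurableT_comp (measurable_E g i j) (measurable_xe good).
Qed.

Let entry_mean j l : (\int[P]_w (entry j l w)%:E <= (8 * expR K / n%:R)%:E)%E.
Proof.
have E w : entry j l w =
    (n%:R ^+ 2)^-1 * (\sum_i centered_cross Sig j l (Z (mxvec_index g i) w)) ^+ 2.
  rewrite /entry /centered_cross sumrB sumr_const card_ord -[Sig j l *+ n]mulr_natl.
  rewrite -exprVn -exprMn mulrBr mulrA mulVf ?gt_eqF// mul1r.
  congr ((_ * _ - _) ^+ 2); apply: eq_bigr => i _.
  by rewrite /X /design_x !mxE tnth_mktuple.
under eq_integral do rewrite E EFinM.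
have mc := measurable_centered_cross Sig j l.
rewrite ge0_integralZl//; last 2 first.
- apply/measurable_EFinP; apply: measurable_funX; apply: measurable_sum => i.
  exact: measurableT_comp mc (mZ _).
- by move=> w _; rewrite lee_fin sqr_ge0.
apply: le_trans (_ : ((n%:R ^+ 2)^-1)%:E * (8 * n%:R * expR K)%:E <= _)%E.
  apply: lee_wpmul2l; first by rewrite lee_fin invr_ge0 sqr_ge0.
  apply: (sample_second_moment good sigma0 mc _ _ n_gt0 (@mxvec_index_inj _ _ g)).
    by move=> i; exact (centered_cross_le good sigma0 beta_le Sig_le j l i).
  by move=> i; exact (centered_cross_mean good j l i).
rewrite -EFinM lee_fin le_eqVlt; apply/orP; left; apply/eqP.
by field; rewrite gt_eqF.
Qed.

Let entry0 j l w : 0 <= entry j l w. Proof. exact: sqr_ge0. Qed.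

Let mentry j l : measurable_fun setT (entry j l).
Proof.
apply: measurable_funX; apply: measurable_funB => //; apply: measurable_funM => //.
by apply: measurable_sum => i; apply: measurable_funM; exact: mX.
Qed.

Let gram_devE M w : gram_dev Sig (X w) M =
  \sum_(a <- [seq (j, l) | j <- enum M, l <- enum M]) entry a.1 a.2 w.
Proof.
by rewrite big_allpairs_dep/= big_enum; apply: eq_bigr => j _; rewrite big_enum.
Qed.

Lemma measurable_gram_dev M : measurable_fun setT (fun w => gram_dev Sig (X w) M).
Proof.
under eq_fun do rewrite gram_devE.
by apply: measurable_sum => a; exact: mentry.
Qed.

(** Markov's inequality: each of the |M|^2 squared entries has mean O(1/n). *)
Lemma gram_dev_prob (M : {set 'I_p}) (theta : R) : 0 < theta ->
  (P [set w | (theta <= gram_dev Sig (X w) M)%R] <=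
   ((#|M| * #|M|)%:R * (8 * expR K / n%:R) / theta)%:E)%E.
Proof.
move=> t0; apply: prob_markov => //; first exact: measurable_gram_dev.
  by move=> w; rewrite gram_devE; exact: sumr_ge0.
under eq_integral do rewrite gram_devE.
apply: le_trans (@expect_sum_le _ _ _ P _ _ (fun a => entry a.1 a.2) _ _ _ _) _.
- by move=> a; exact: mentry.
- by move=> a w; exact: entry0.
- by move=> a; exact: entry_mean.
by rewrite size_allpairs -!cardE.
Qed.

Section noise_events.
Variables (M : {set 'I_p}) (kappa : R).
Hypothesis kappa0 : 0 < kappa.
Hypothesis Sig_lb : forall v : 'cV[R]_p, kappa * sqn v <= pop_form Sig v.

Let W w := submx_cols (X w) M.
Let A w := (W w)^T *m W w.
Let G w := invmx (A w) *m (W w)^T.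
(** Depends on the covariates only and makes the Gram matrix invertible. The noise events are
    intersected with it, so that after freezing the design they are either empty or about an
    invertible design. *)
Let ok w := gram_dev Sig (X w) M <= kappa ^+ 2 / 4.

Let A_unit w : ok w -> A w \in unitmx.
Proof.
move=> okw; apply: submx_unit => v sv Xv; apply/eqP; rewrite -sqn_eq0.
have := gram_dev_lb kappa0 (Sig_lb v) okw sv; rewrite Xv.
rewrite (_ : sqn 0 = 0); last by apply/eqP; rewrite sqn_eq0.
by rewrite mulr0 pmulr_rle0 ?divr_gt0// => H; rewrite eq_le H sqn_ge0.
Qed.

(** The same matrices as functions on the product of covariates and noises, the space on which
    resampling is stated. *)
Let XU (z : U) := design_x g z.1.
Let WU z := submx_cols (XU z) M.
Let AU z := (WU z)^T *m WU z.
Let GU z := invmx (AU z) *m (WU z)^T.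

Let mXU : measurable_mx XU := measurable_X g.
Let mWU : measurable_mx WU. Proof. exact: measurable_mx_cols. Qed.
Let mAU : measurable_mx AU.
Proof. by apply: measurable_mxM => //; exact: measurable_mx_tr. Qed.
Let mGU : measurable_mx GU.
Proof. by apply: measurable_mxM; [exact: measurable_mx_inv|exact: measurable_mx_tr]. Qed.
Let mEU : measurable_mx (fun z : U => noise_e g z.2) := measurable_E g.

Let okU : measurable [set z : U | gram_dev Sig (XU z) M <= kappa ^+ 2 / 4].
Proof.
apply: measurable_set_le => //; rewrite /gram_dev.
have -> : (fun z => \sum_(j in M) \sum_(l in M)
     (n%:R^-1 * (\sum_i XU z i j * XU z i l) - Sig j l) ^+ 2) =
   (fun z => \sum_(a <- [seq (j, l) | j <- enum M, l <- enum M])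
     (n%:R^-1 * (\sum_i XU z i a.1 * XU z i a.2) - Sig a.1 a.2) ^+ 2).
  apply/funext => z; rewrite big_allpairs_dep/= big_enum.
  by apply: eq_bigr => j _; rewrite big_enum.
apply: measurable_sum => a; apply: measurable_funX; apply: measurable_funB => //.
apply: measurable_funM => //.
by apply: measurable_sum => i; apply: measurable_funM; exact: mXU.
Qed.

(** Given the design, each coordinate of G e is exactly normal with deviation sigma times the root
    of the diagonal entry; a union bound over M gives the Bonferroni factor. *)
Lemma noise_coord_prob (c : R) : 0 <= c ->
  let F := [set w | ok w /\ exists k : 'I_#|M|,
     sigma * Num.sqrt (invmx (A w) k k) * c < `|(G w *m e w) k 0|] in
  measurable F /\ (P F <= (#|M|%:R * (2 * tail c))%:E)%E.
Proof.
move=> c0 F; pose H := [set z : U | gram_dev Sig (XU z) M <= kappa ^+ 2 / 4 /\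
  exists k : 'I_#|M|, sigma * Num.sqrt (invmx (AU z) k k) * c <
    `|(GU z *m noise_e g z.2) k 0|].
have mH : measurable H.
  apply: measurableI => //; apply: measurable_exists => k.
  apply: measurable_set_lt.
    apply: measurable_funM => //; apply: measurable_funM => //.
    apply: measurableT_comp (@measurable_sqrtr R) _.
    exact: (measurable_mx_inv mAU).
  apply: measurableT_comp => //.
  exact: (measurable_mxM mGU mEU).
split; first exact: measurable_preimage (measurable_xe good) mH.
apply: (resample_noise good (g := g) (H := H)) => //.
  by rewrite lee_fin !mulr_ge0// fine_ge0.
apply: aeW => w; have [okw|nok] := pselect (ok w); last first.
  rewrite (_ : [set w' | _] = set0) ?measure0 ?lee_fin ?mulr_ge0 ?fine_ge0//.
  by apply/seteqP; split => w' // -[].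
pose Fk (k : 'I_#|M|) := [set w' | sigma * Num.sqrt (sqn (row k (G w))^T) * c <
  `|dot (row k (G w))^T (e w')|].
have FP k : measurable (Fk k) /\ (P (Fk k) <= (2 * tail c)%:E)%E.
  split.
    apply: measurable_set_lt => //; apply: measurableT_comp => //.
    exact: measurable_noise_dot good _ _.
  by rewrite /Fk (noise_dot_tail good sigma0)//; apply: coef_row_neq0; exact: A_unit.
have [mE PE] := prob_exists_le FP; rewrite card_ord in PE.
apply: le_trans PE; apply: le_measure; rewrite ?inE//.
  exact (measurable_resampled good g w mH).
move=> w' [_ [k]]; rewrite /GU /AU /WU /XU /= noise_splice_in => Hk; exists k.
rewrite /Fk/= coef_row; last exact: A_unit.
by move: Hk; rewrite [X in `|X|]mxE; congr (_ < `|_|); apply: eq_bigr => i _; rewrite !mxE.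
Qed.

(** Given the design, the projected noise has mean squared norm sigma^2 times the trace of the hat
    matrix, that is sigma^2 |M|; then Markov. *)
Lemma noise_proj_prob (theta : R) : 0 < theta ->
  let F := [set w | ok w /\ theta <= sqn (W w *m G w *m e w)] in
  measurable F /\ (P F <= (sigma ^+ 2 * #|M|%:R / theta)%:E)%E.
Proof.
move=> t0 F; pose H := [set z : U | gram_dev Sig (XU z) M <= kappa ^+ 2 / 4 /\
  theta <= sqn (WU z *m GU z *m noise_e g z.2)].
have mH : measurable H.
  apply: measurableI => //; apply: measurable_set_le => //.
  by apply: measurable_sqn; apply: measurable_mxM => //; exact: measurable_mxM.
have b0 : 0 <= sigma ^+ 2 * #|M|%:R / theta.
  by rewrite divr_ge0 ?mulr_ge0 ?sqr_ge0// ltW.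
split; first exact: measurable_preimage (measurable_xe good) mH.
apply: (resample_noise good (g := g) (H := H)) => //.
apply: aeW => w; have [okw|nok] := pselect (ok w); last first.
  rewrite (_ : [set w' | _] = set0) ?measure0//.
  by apply/seteqP; split => w' // -[].
pose Hm := W w *m G w.
have E w' : sqn (Hm *m e w') = \sum_i dot (row i Hm)^T (e w') ^+ 2.
  rewrite sqnE; apply: eq_bigr => i _; congr (_ ^+ 2); rewrite mxE.
  by apply: eq_bigr => l _; rewrite !mxE.
have md i : measurable_fun setT (fun w' => dot (row i Hm)^T (e w') ^+ 2).
  by apply: measurable_funX; exact: measurable_noise_dot good _ _.
have mS : measurable_fun setT (fun w' => sqn (Hm *m e w')).
  by under eq_fun do rewrite E; apply: measurable_sum.
apply: le_trans (prob_markov (g := fun w' => sqn (Hm *m e w')) (b := sigma ^+ 2 * #|M|%:R) mS _ t0 _).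
- apply: le_measure; rewrite ?inE//.
  + exact (measurable_resampled good g w mH).
  + exact: measurable_set_le.
  + by move=> w' [_]; rewrite /GU /AU /WU /XU /= noise_splice_in.
- by move=> w'; exact: sqn_ge0.
under eq_integral do rewrite E -sumEFin.
rewrite ge0_integral_sum//; last 2 first.
- by move=> i; exact/measurable_EFinP.
- by move=> i w' _; rewrite lee_fin sqr_ge0.
rewrite (eq_bigr (fun i => (sigma ^+ 2 * sqn (row i Hm)^T)%:E)); last first.
  by move=> i _; exact: noise_dot_sq good sigma0 g _.
by rewrite sumEFin -mulr_sumr /Hm hat_rows//; exact: A_unit.
Qed.

End noise_events.

(** Chebyshev for the sum of [centered_var]; the 16 is its normalisation 8 times the 2 in delta /
    2. *)
Lemma noise_norm_prob (delta : R) : 0 < delta ->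
  let F := [set w | sigma ^+ 2 * n%:R * (delta / 2) <=
     `|sqn (e w) - n%:R * sigma ^+ 2|] in
  measurable F /\ (P F <= (8 * 16 ^+ 2 * expR K / (n%:R * delta ^+ 2))%:E)%E.
Proof.
move=> d0 F; have s20 : 0 < sigma ^+ 2 by rewrite exprn_gt0.
pose S w := \sum_i centered_var beta sigma (Z (mxvec_index g i) w).
have SE w : sqn (e w) - n%:R * sigma ^+ 2 = 8 * sigma ^+ 2 * S w.
  rewrite /S /centered_var -mulr_suml [RHS]mulrC divfK; last first.
    by rewrite mulf_neq0// gt_eqF.
  rewrite sumrB sumr_const card_ord mulr_natl sqnE; congr (_ - _).
  by apply: eq_bigr => i _; rewrite mxE tnth_mktuple.
have mc := measurable_centered_var beta sigma.
have mS : measurable_fun setT (fun w => S w ^+ 2).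
  by apply: measurable_funX; apply: measurable_sum => i; exact: measurableT_comp mc (mZ _).
have FE : F = [set w | (n%:R * delta / 16) ^+ 2 <= S w ^+ 2].
  rewrite /F; apply/funext => w /=; congr is_true.
  rewrite SE normrM gtr0_norm ?mulr_gt0//.
  rewrite -[S w ^+ 2]real_normK ?num_real// ler_sqr ?nnegrE ?divr_ge0 ?mulr_ge0 ?(ltW d0)//.
  rewrite (_ : _ * (delta / 2) = 8 * sigma ^+ 2 * (n%:R * delta / 16)); last by field.
  by rewrite ler_pM2l// mulr_gt0.
rewrite FE; split; first exact: measurable_set_le.
apply: le_trans (prob_markov mS _ _ (b := 8 * n%:R * expR K) _) _.
- by move=> w; exact: sqr_ge0.
- by rewrite exprn_gt0// divr_gt0// mulr_gt0.
- apply: (sample_second_moment good sigma0 mc _ _ n_gt0 (@mxvec_index_inj _ _ g)).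
    by move=> i; apply: centered_var_le.
  by move=> i; exact (centered_var_mean good sigma0 i).
rewrite lee_fin le_eqVlt; apply/orP; left; apply/eqP.
by field; rewrite !gt_eqF.
Qed.

Section cleaning_step.
Variables (M : {set 'I_p}) (kappa psi alpha delta : R).
Let D := active_set beta.
Let c := normal_upper_quantile (alpha / (2 * #|M|%:R)).
Hypothesis kappa0 : 0 < kappa.
Hypothesis Sig_lb : forall v : 'cV[R]_p, kappa * sqn v <= pop_form Sig v.
Hypothesis psi0 : 0 < psi.
Hypothesis D_psi : forall j : 'I_p, j \in D -> psi <= `|beta j 0|.
Hypothesis delta01 : 0 < delta < 1.
Hypothesis m_small : (2 * #|M| <= n)%N.
Hypothesis DM : D \subset M.
Hypothesis c0 : 0 <= c.
Hypothesis c_small : 9 * sigma ^+ 2 * c ^+ 2 < psi ^+ 2 * (n%:R * (kappa / 2)).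

(** The four terms are the failures of the hypotheses of [clean_exact]: coefficient noise, Gram
    matrix, projected noise and noise norm. Only the first is of the order of the level. *)
Lemma clean_prob :
  (P [set w | clean (X w) (X w *m beta + e w) M alpha <> D] <=
   (#|M|%:R * (2 * tail (c * (1 - delta)))
    + ((#|M| * #|M|)%:R * (8 * expR K / n%:R) / (kappa ^+ 2 / 4)
       + (2 * #|M|%:R / (n%:R * delta) + 8 * 16 ^+ 2 * expR K / (n%:R * delta ^+ 2))))%:E)%E.
Proof.
have /andP[d0 d1] := delta01.
have cd0 : 0 <= c * (1 - delta) by rewrite mulr_ge0// subr_ge0 ltW.
have k4 : 0 < kappa ^+ 2 / 4 by rewrite divr_gt0// exprn_gt0.
have t0 : 0 < sigma ^+ 2 * n%:R * (delta / 2) by rewrite !mulr_gt0// divr_gt0.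
have [mF1 PF1] := noise_coord_prob M kappa0 Sig_lb cd0.
have PF2 := gram_dev_prob M k4.
have [mF3 PF3] := noise_proj_prob M kappa0 Sig_lb t0.
have [mF4 PF4] := noise_norm_prob d0.
set F1 := [set w | _] in mF1 PF1.
set F2 := [set w | _] in PF2.
set F3 := [set w | _] in mF3 PF3.
set F4 := [set w | _] in mF4 PF4.
have mF2 : measurable F2.
  by apply: measurable_set_le => //; exact: measurable_gram_dev.
have PF3' : (P F3 <= (2 * #|M|%:R / (n%:R * delta))%:E)%E.
  apply: le_trans PF3 _; rewrite lee_fin le_eqVlt; apply/orP; left; apply/eqP.
  by field; rewrite !gt_eqF.
rewrite !EFinD; apply: le_trans (leeD PF1 (leeD PF2 (leeD PF3' PF4))).
apply: le_trans (leeD (lexx _) (leeD (lexx _) (measureU2 _ mF3 mF4))).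
apply: le_trans (leeD (lexx _) (measureU2 _ mF2 (measurableU _ _ mF3 mF4))).
apply: le_trans (measureU2 _ mF1 (measurableU _ _ mF2 (measurableU _ _ mF3 mF4))).
apply: le_measure; rewrite ?inE.
- apply: measurableC; apply: measurable_clean => //.
  by apply: measurable_mxD => //; apply: measurable_mxM.
- by apply: measurableU => //; apply: measurableU => //; exact: measurableU.
move=> w /= bad; apply: contrapT => /not_orP[nF1 /not_orP[nF2 /not_orP[nF3 nF4]]].
have ok : gram_dev Sig (X w) M <= kappa ^+ 2 / 4.
  by rewrite leNgt; apply/negP => /ltW.
apply: bad; apply: (clean_exact (sigma := sigma) (c := c) (delta := delta)
  (kap := kappa / 2) (psi := psi)) => //.
- by rewrite divr_gt0.
- by rewrite ltW.
- by move=> v sv; exact: gram_dev_lb kappa0 (Sig_lb v) ok sv.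
- move=> k; rewrite leNgt; apply/negP => H; apply: nF1; split=> //.
  by exists k; rewrite mulrA in H *.
- by rewrite leNgt; apply/negP => /ltW H; apply: nF3.
- by rewrite leNgt; apply/negP => /ltW H; apply: nF4.
Qed.

End cleaning_step.

End fixed_model.

(** * Random selected set and random allocation in the cleaning stage *)

Section bad_cleaning.
Context {R : realType} (n p k : nat) (beta : 'cV[R]_p) (alpha : R).
Local Notation N := (3 * n)%N.
Local Notation T := (p.-tuple R * R)%type.
Let D := active_set beta.

Definition optimal_of (t : N.-tuple T) (M : {set 'I_p}) : Prop :=
  cv_optimal (design_of group_screen t) (design_of group_validate t)
    (responses_of group_screen t) (responses_of group_validate t) k M.

(** Quantifying over optimal sets instead of using the chosen threshold makes the event a measurable
    function of the data alone, whatever rule picks the minimiser. *)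
Definition bad_cleaning (t : N.-tuple T) : Prop :=
  exists M, optimal_of t M /\ (D \subset M /\
    clean (design_of group_clean t) (responses_of group_clean t) M alpha <> D).

Lemma measurable_design_of g : measurable_mx (design_of (R := R) (n := n) (p := p) g).
Proof.
move=> i j; under eq_fun do rewrite mxE.
exact: measurableT_comp (measurable_coord j) (measurable_tnth _).
Qed.

Lemma measurable_responses_of g :
  measurable_mx (responses_of (R := R) (n := n) (p := p) g).
Proof.
move=> i j; under eq_fun do rewrite mxE.
exact: measurableT_comp measurable_snd (measurable_tnth _).
Qed.

Lemma measurable_bad_cleaning : measurable (bad_cleaning : set (N.-tuple T)).
Proof.
have mX := measurable_design_of; have mY := measurable_responses_of.
apply: measurable_exists => M; apply: measurableI.
  exact: measurable_cv_optimal.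
have [DM|DM] := boolP (D \subset M).
  rewrite (_ : (fun t => _) = ~` [set t | clean (design_of group_clean t)
    (responses_of group_clean t) M alpha = D]).
    by apply: measurableC; exact: measurable_clean.
  by apply/seteqP; split => t /=; [case|].
by rewrite (_ : (fun t => _) = set0)//; apply/seteqP; split => t // [].
Qed.

Lemma splice_design_in g (a b : N.-tuple T) :
  design_of g (splice (group_indices n g) a b) = design_of g b.
Proof. by apply/matrixP => i j; rewrite !mxE splice_group_in. Qed.

Lemma splice_design_out g g' (a b : N.-tuple T) : g' != g ->
  design_of g' (splice (group_indices n g) a b) = design_of g' a.
Proof. by move=> gg; apply/matrixP => i j; rewrite !mxE splice_group_out. Qed.

Lemma splice_responses_in g (a b : N.-tuple T) :
  responses_of g (splice (group_indices n g) a b) = responses_of g b.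
Proof. by apply/matrixP => i j; rewrite !mxE splice_group_in. Qed.

Lemma splice_responses_out g g' (a b : N.-tuple T) : g' != g ->
  responses_of g' (splice (group_indices n g) a b) = responses_of g' a.
Proof. by move=> gg; apply/matrixP => i j; rewrite !mxE splice_group_out. Qed.

Context {d : measure_display} (Omega : measurableType d) (P : probability Omega R)
  (Z : 'I_N -> Omega -> T) (sigma B : R) (Sig : nat -> nat -> R).
Hypothesis good : good_sample P Z beta sigma B Sig.
Hypothesis sigma0 : 0 < sigma.
Hypothesis n_gt0 : (0 < n)%N.
Hypothesis rank : forall g, {ae P, forall w, full_rank (design_of g (tup Z w))}.
Hypothesis kn : (2 * k <= n)%N.

(* The selected set depends on the first two groups only, so it may be treated
   as fixed when the third group is integrated out. *)
Lemma bad_cleaning_prob (b : R) : 0 <= b ->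
  (forall M : {set 'I_p}, D \subset M -> (#|M| <= k)%N ->
    (P [set w | clean (design_of group_clean (tup Z w))
       (responses_of group_clean (tup Z w)) M alpha <> D] <= b%:E)%E) ->
  (P [set w | bad_cleaning (tup Z w)] <= b%:E)%E.
Proof.
move=> b0 Hb; have t0 : T := ([tuple 0 | i < p], 0).
have rank' g : {ae P, forall w, full_rank (design_x g (covs Z w))}.
  by apply: filterS (rank g) => w; rewrite design_tup.
apply: (prob_resample (gs_meas good) (gs_ind good) t0 (K := group_indices n group_clean)
  (H := bad_cleaning)) => //; first exact: measurable_bad_cleaning.
have := ae_unique_optimal good sigma0 n_gt0 rank' kn.
apply: filterS => w /= uniq.
(* Redrawing the third group leaves optimality unchanged, so w determines the only set that can
   occur. *)
have optE w' M : optimal_of (splice (group_indices n group_clean) (tup Z w) (tup Z w')) M =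
   optimal_of (tup Z w) M.
  by rewrite /optimal_of !splice_design_out// !splice_responses_out.
have [[M [optM DM]]|no] := pselect (exists M, optimal_of (tup Z w) M /\ D \subset M).
  have kM : (#|M| <= k)%N by case: optM.
  apply: le_trans (Hb M DM kM); apply: le_measure; rewrite ?inE.
  - apply: measurable_preimage measurable_bad_cleaning.
    by apply: measurable_splice => //; exact: measurable_tup (gs_meas good).
  - have mC := measurable_clean (measurable_design_of group_clean)
      (measurable_responses_of group_clean) M alpha D.
    exact: measurable_preimage (measurable_tup (gs_meas good)) (measurableC mC).
  move=> w' [M' [+ [DM']]]; rewrite optE splice_design_in splice_responses_in.
  by move=> optM'; rewrite (uniq M' M).
rewrite (_ : [set w' | _] = set0) ?measure0 ?lee_fin//.
apply/seteqP; split => w' // -[M']; rewrite optE => -[optM' [DM' _]].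
by apply: no; exists M'.
Qed.

End bad_cleaning.

Section allocated_cleaning.
Context {d : measure_display} (Omega : measurableType d) (R : realType)
  (P : probability Omega R) (n p k : nat) (o : observations P n p)
  (beta : 'cV[R]_p) (sigma B b1 kappa psi alpha delta L : R) (Sig : nat -> nat -> R).
Hypothesis iid : iid_observations o.
Hypothesis split : random_split o.
Hypothesis model : linear_model o beta sigma.
Hypothesis bounded : bounded_standardized o B.
Hypothesis cross : forall i (j l : 'I_p),
  (\int[P]_w (tnth (covar o i w) j * tnth (covar o i w) l)%:E = (Sig j l)%:E)%E.
Hypothesis rank : forall g, {ae P, forall w, 0 < sparse_eig_min (design o g w) n}.
Hypothesis n_gt0 : (0 < n)%N.
Hypothesis np : (n <= p)%N.
Hypothesis sigma0 : 0 < sigma.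
Hypothesis B0 : 0 < B.
Hypothesis beta_le : \sum_j `|beta j 0| <= b1.
Hypothesis Sig_le : forall j l : 'I_p, `|Sig j l| <= B ^+ 2.
Hypothesis kappa0 : 0 < kappa.
Hypothesis Sig_lb : forall v : 'cV[R]_p, kappa * sqn v <= pop_form Sig v.
Hypothesis psi0 : 0 < psi.
Hypothesis D_psi : forall j : 'I_p, j \in active_set beta -> psi <= `|beta j 0|.
Hypothesis kn : (2 * k <= n)%N.
Hypothesis alpha01 : 0 < alpha < 1.
Hypothesis delta01 : 0 < delta < 1.
Hypothesis L_ge0 : 0 <= L.
Hypothesis L_ub : 4 * k%:R <= alpha * expR (L / 4).
Hypothesis L_small : 9 * sigma ^+ 2 * L < psi ^+ 2 * (n%:R * (kappa / 2)).

Let good pi := sample_good iid model bounded cross pi.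
Let D := active_set beta.
Let K := exp_const sigma B b1.

Definition cleaning_error : R :=
  alpha * (1 + (2 * L + 1) * delta * expR (L * delta + 3 / 2)) +
  ((k * k)%:R * (8 * expR K / n%:R) / (kappa ^+ 2 / 4) +
   (2 * k%:R / (n%:R * delta) + 8 * 16 ^+ 2 * expR K / (n%:R * delta ^+ 2))).

Let a0 : 0 < alpha. Proof. by case/andP: alpha01. Qed.
Let d0 : 0 < delta. Proof. by case/andP: delta01. Qed.
Let nR : 0 < n%:R :> R. Proof. by rewrite ltr0n. Qed.

(** The rank condition is given for the allocated data; [data_null] passes it to each ordering. *)
Let sample_rank pi g : {ae P, forall w, full_rank (design_of g (tup (sample o pi) w))}.
Proof.
have mF := measurable_full_rank (measurable_design_of (R := R) (n := n) (p := p) g).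
have mN := measurableC mF.
have : {ae P, forall w, ~ (~` [set t | full_rank (design_of (R := R) (n := n) (p := p) g t)])
    (tup (sample o pi) w)}.
  apply: ae_not.
    by apply: measurable_preimage mN; apply: measurable_tup => i; exact: measurable_sample.
  rewrite (data_null split pi mN)//; apply/eqP; rewrite eq_le measure_ge0 andbT.
  have mNd := measurable_preimage (measurable_pair_data split) mN.
  rewrite -(measure0 P); have [A [mA A0 HA]] := rank g.
  rewrite measure0 -A0; apply: le_measure; rewrite ?inE// => w Hw; apply: HA => /= Hs.
  by apply: Hw => /=; rewrite -design_data; exact: sparse_eig_full_rank.
by apply: filterS => w /contrapT.
Qed.

(** L bounds the squared quantiles for all m up to k: exp (c^2 / 4) alpha / (2 m) <= 2 is compared
    with [L_ub]. The factor 2 L + 1 comes from c (c + 1) <= 2 c^2 + 1. *)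
Let L0 m : (0 < m <= k)%N -> normal_upper_quantile (alpha / (2 * m%:R)) ^+ 2 <= L /\
  [/\ 0 <= normal_upper_quantile (alpha / (2 * m%:R)) &
   m%:R * (2 * tail (normal_upper_quantile (alpha / (2 * m%:R)) * (1 - delta))) <=
   alpha * (1 + (2 * L + 1) * delta * expR (L * delta + 3 / 2))].
Proof.
move=> /andP[m0 mk]; set u := alpha / _; set c := normal_upper_quantile u.
have mR : 1 <= m%:R :> R by rewrite ler1n.
have u01 : 0 < u < 1 / 2.
  rewrite /u divr_gt0 ?mulr_gt0 ?ltr0n//= ltr_pdivrMr ?mulr_gt0 ?ltr0n//.
  by case/andP: alpha01 => _; lra.
have dd : 0 <= delta <= 1 by case/andP: delta01 => *; rewrite !ltW.
have [c0 cu ct] := normal_upper_quantile_bounds u01 dd; rewrite -/c in c0 cu ct.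
have um : u * (2 * m%:R) = alpha.
  by rewrite /u divfK// mulf_neq0// pnatr_eq0 -lt0n.
have cL : c ^+ 2 <= L.
  have : expR (c ^+ 2 / 4) <= expR (L / 4).
    rewrite -(ler_pM2l a0); apply: le_trans L_ub.
    rewrite -um mulrAC [u * _]mulrC.
    apply: le_trans (_ : 2 * (2 * m%:R) <= _).
      by rewrite ler_wpM2r// ?mulr_ge0.
    by rewrite mulrA -natrM ler_pM2l// ler_nat.
  by rewrite ler_expR; lra.
split=> //; split=> //.
have u0 : 0 <= u by case/andP: u01 => /ltW.
rewrite -um; apply: (@le_trans _ _ (m%:R * (2 * (u * (1 + c * (c + 1) * delta * expR (c ^+ 2 * delta + 3 / 2)))))).
  by rewrite !ler_wpM2l.
rewrite (_ : m%:R * (2 * (u * _)) = u * (2 * m%:R) * (1 + c * (c + 1) * delta * expR (c ^+ 2 * delta + 3 / 2))); last by ring.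
apply: ler_wpM2l; first by rewrite mulr_ge0// mulr_ge0.
rewrite lerD2l ler_pM//.
- by rewrite !mulr_ge0 ?(ltW d0)// addr_ge0.
- rewrite ler_wpM2r ?(ltW d0)//; have := sqr_ge0 (c - 1); nra.
by rewrite ler_expR lerD2r ler_wpM2r// ltW.
Qed.

Lemma cleaning_prob :
  measurable [set w | bad_cleaning k beta alpha (pair_data o w)] /\
  (P [set w | bad_cleaning k beta alpha (pair_data o w)] <= cleaning_error%:E)%E.
Proof.
have L00 : 0 <= 2 * L + 1 by rewrite addr_ge0// mulr_ge0.
have x0 : 0 <= (k * k)%:R * (8 * expR K / n%:R) / (kappa ^+ 2 / 4).
  by rewrite !(mulr_ge0, divr_ge0, invr_ge0, expR_ge0)// ?ltW// exprn_gt0.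
have y0 : 0 <= 2 * k%:R / (n%:R * delta).
  by rewrite divr_ge0// mulr_ge0// ltW.
have z0 : 0 <= 8 * 16 ^+ 2 * expR K / (n%:R * delta ^+ 2).
  by rewrite divr_ge0// mulr_ge0 ?expR_ge0 ?sqr_ge0 ?mulr_ge0 ?sqr_ge0.
have a10 : 0 <= alpha * (1 + (2 * L + 1) * delta * expR (L * delta + 3 / 2)).
  by rewrite mulr_ge0 ?(ltW a0)// addr_ge0// !mulr_ge0 ?expR_ge0 ?(ltW d0).
have e0 : 0 <= cleaning_error by rewrite /cleaning_error !addr_ge0.
apply: (data_le split _ e0); first exact: measurable_bad_cleaning.
move=> pi; apply: (bad_cleaning_prob (good pi) sigma0 n_gt0 (sample_rank pi) kn e0).
(* For empty M the level is divided by 0 and the quantile is a default value, but then D is empty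
   and nothing can be selected. *)
move=> M DM Mk; have [m0|m0] := posnP #|M|.
  rewrite (_ : [set w | _] = set0) ?measure0 ?lee_fin//.
  have M0 : M = finset.set0 by apply/eqP; rewrite -cards_eq0 m0.
  have DE : D = finset.set0 by apply/eqP; rewrite -finset.subset0 -M0.
  apply/seteqP; split => w // H; exfalso; apply: H; rewrite -/D DE.
  apply/setP => j; rewrite finset.in_set0; apply/negbTE/negP => /imsetP[[i im] _ _].
  by rewrite m0 in im.
have [cL [c0 ct]] := L0 (introT andP (conj m0 Mk)).
have m_small : (2 * #|M| <= n)%N by rewrite (leq_trans _ kn)// leq_mul2l Mk.
have c_small : 9 * sigma ^+ 2 * normal_upper_quantile (alpha / (2 * #|M|%:R)) ^+ 2 <
    psi ^+ 2 * (n%:R * (kappa / 2)).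
  by apply: le_lt_trans L_small; rewrite ler_wpM2l// mulr_ge0 ?sqr_ge0.
have := clean_prob (good pi) sigma0 n_gt0 beta_le Sig_le kappa0 Sig_lb psi0 D_psi
  delta01 m_small DM c0 c_small.
have -> : [set w | clean (design_of group_clean (tup (sample o pi) w))
     (responses_of group_clean (tup (sample o pi) w)) M alpha <> D] =
   [set w | clean (design_x group_clean (covs (sample o pi) w))
     (design_x group_clean (covs (sample o pi) w) *m beta +
      noise_e group_clean (noises (sample o pi) beta w)) M alpha <> active_set beta].
  by apply/funext => w /=; rewrite design_tup (responses_tup _ beta).
move=> /le_trans; apply; rewrite lee_fin /cleaning_error -/K.
have kR : #|M|%:R <= k%:R :> R by rewrite ler_nat.
apply: lerD => //; apply: lerD; last first.
  rewrite lerD2r ler_pM2r ?invr_gt0 ?mulr_gt0//; lra.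
rewrite ler_pM2r ?invr_gt0 ?divr_gt0 ?exprn_gt0// ler_wpM2r//.
by rewrite ler_nat leq_mul.
Qed.

End allocated_cleaning.

(** * Population covariance and asymptotics *)

Section limsup.
Context {R : realType}.
Implicit Types u : nat -> \bar R.

Lemma limn_esup_near_le u (c : \bar R) :
  (\forall n \near \oo, (u n <= c)%E) -> (limn_esup u <= c)%E.
Proof.
move=> H; rewrite /limn_esup limf_esupE.
apply: le_trans (_ : ereal_sup (u @` [set n | (u n <= c)%E]) <= _)%E.
  by apply: ereal_inf_lbound; exists [set n | (u n <= c)%E].
by apply: ge_ereal_sup => _ [n /= un <-].
Qed.

Lemma near_limn_esup u (c c' : \bar R) : (limn_esup u <= c)%E -> (c < c')%E ->
  \forall n \near \oo, (u n <= c')%E.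
Proof.
move=> uc cc'; have := le_lt_trans uc cc'; rewrite /limn_esup limf_esupE.
move=> /ereal_inf_lt[_ [V VF <-] Vc']; apply: filterS VF => n Vn.
by apply: le_trans (ltW Vc'); apply: ereal_sup_ubound; exists n.
Qed.

Lemma limn_einf_near_ge u (c : \bar R) :
  (\forall n \near \oo, (c <= u n)%E) -> (c <= limn_einf u)%E.
Proof.
move=> H; rewrite /limn_einf leeNr; apply: limn_esup_near_le.
by apply: filterS H => n; rewrite leeN2.
Qed.

Lemma near_limn_einf u (c c' : \bar R) : (c <= limn_einf u)%E -> (c' < c)%E ->
  \forall n \near \oo, (c' <= u n)%E.
Proof.
rewrite /limn_einf leeNr => uc cc'.
have cc : (- c < - c')%E by rewrite lteN2.
by have := near_limn_esup uc cc; apply: filterS => n; rewrite leeN2.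
Qed.

Lemma ln_le_linear (c : R) : 0 < c -> \forall n \near \oo, ln (n%:R : R) <= c * n%:R.
Proof.
move=> c0; have h2 : (0 : R) <= 2^-1 by [].
have h1 : (2^-1 : R) < 1 by lra.
have ch : 0 < c / 2 by rewrite divr_gt0.
apply: filterS2 (nbhs_infty_gt 0) (powR_le_linear h2 h1 ch) => n n0 H.
have nR : 0 < n%:R :> R by rewrite ltr0n.
have := @le_ln1Dx R ((n%:R : R) `^ 2^-1 - 1); rewrite addrCA subrr addr0 ln_powR.
have : 0 < (n%:R : R) `^ 2^-1 by rewrite powR_gt0.
move=> ? /(_ _); have X : -1 < (n%:R : R) `^ 2^-1 - 1 by lra.
move=> /(_ X); lra.
Qed.

End limsup.

Lemma big_ord_below (R : realType) (s p : nat) (F : nat -> R) :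
  (s <= p)%N -> (forall j, (s <= j)%N -> F j = 0) ->
  \sum_(j < p) F j = \sum_(j < s) F j.
Proof.
move=> sp F0; rewrite (big_ord_widen _ F sp) [RHS]big_mkcond/=.
by apply: eq_bigr => j _; case: ltnP => // /F0.
Qed.

Section sequence.
Context {d : measure_display} (Omega : measurableType d) (R : realType)
  (P : probability Omega R) (p : nat -> nat) (s : nat) (beta : nat -> R)
  (sigma : R) (o : forall n, observations P n (p n)) (c1 c2 C0 C1 kappa B : R).
Hypothesis p_gt : forall n, (0 < n)%N -> (n < p n)%N.
Hypothesis iid : forall n, iid_observations (o n).
Hypothesis splitting : forall n, random_split (o n).
Hypothesis only_dimension_varies : consistent_covariates o.
Hypothesis sigma_gt0 : 0 < sigma.
Hypothesis model : forall n, linear_model (o n) (coef beta (p n)) sigma.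
Hypothesis c1_gt0 : 0 < c1.
Hypothesis c2_ge0 : 0 <= c2.
Hypothesis c2_lt1 : c2 < 1.
Hypothesis p_le : forall n, (0 < n)%N -> (p n)%:R <= c1 * expR (n%:R `^ c2).
Hypothesis beta_support : forall j, (beta j != 0) = (j < s)%N.
Hypothesis s_le : forall n, (0 < n)%N -> (s <= p n)%N.
Hypothesis C0_gt0 : 0 < C0.
Hypothesis C1_gt0 : 0 < C1.
Hypothesis kappa_gt0 : 0 < kappa.
Hypothesis eigenvalues : sparse_eigenvalues o C0 C1 kappa.
Hypothesis B_gt0 : 0 < B.
Hypothesis bounded : forall n, bounded_standardized (o n) B.

Let beta0 j : (s <= j)%N -> beta j = 0.
Proof. by rewrite leqNgt -beta_support negbK => /eqP. Qed.

(* The covariance does not depend on n; it is read off at the first size for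
   which both coordinates exist. *)
Definition cov (j l : nat) : R :=
  let m := (maxn j l).+1 in
  let i : 'I_(3 * m) := mxvec_index group_screen (ord0 : 'I_m) in
  fine (\int[P]_w (nth 0 (covar (o m) i w) j * nth 0 (covar (o m) i w) l)%:E)%E.

Let mcov n i j : measurable_fun setT (fun w => tnth (covar (o n) i w) j).
Proof. exact: measurableT_comp (measurable_tnth j) (measurable_funPT _). Qed.

Let int_cross n i (j l : 'I_(p n)) : P.-integrable setT
  (fun w => (tnth (covar (o n) i w) j * tnth (covar (o n) i w) l)%:E).
Proof.
apply: (@ae_bounded_integrable _ _ _ _
  (fun w => tnth (covar (o n) i w) j * tnth (covar (o n) i w) l) (B * B)).
  exact: measurable_funM.
have [_ _ bj] := bounded i j; have [_ _ bl] := bounded i l.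
by apply: filterS2 bj bl => w xj xl; rewrite normrM ler_pM.
Qed.

(** The sizes n and r both contain the first r coordinates, where r is one more than the larger
    index; for size r this is p r > r. *)
Lemma cov_cross n i (j l : 'I_(p n)) :
  (\int[P]_w (tnth (covar (o n) i w) j * tnth (covar (o n) i w) l)%:E = (cov j l)%:E)%E.
Proof.
set r := (maxn j l).+1.
have jr : (j < r)%N by rewrite ltnS leq_maxl.
have lr : (l < r)%N by rewrite ltnS leq_maxr.
have h : (r <= p n)%N by rewrite /r gtn_max !ltn_ord.
have h' : (r <= p r)%N by rewrite ltnW// p_gt.
pose i' : 'I_(3 * r) := mxvec_index group_screen (ord0 : 'I_r).
pose F (x : r.-tuple R) := tnth x (Ordinal jr) * tnth x (Ordinal lr).
have mF : measurable_fun setT F by apply: measurable_funM; exact: measurable_tnth.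
have mfc m (g : (r <= p m)%N) a : measurable_fun setT (fun w => first_coords g (covar (o m) a w)).
  apply/measurable_fun_tnthP => k.
  rewrite (_ : _ \o _ = fun w => tnth (covar (o m) a w) (widen_ord g k)); first exact: mcov.
  by apply/funext => w /=; rewrite tnth_mktuple.
have E := same_law_integral (mfc n h i) (mfc r h' i') (only_dimension_varies i i' h h') mF.
have wj : widen_ord h (Ordinal jr) = j by apply: val_inj.
have wl : widen_ord h (Ordinal lr) = l by apply: val_inj.
have -> : (\int[P]_w (tnth (covar (o n) i w) j * tnth (covar (o n) i w) l)%:E =
   \int[P]_w (F (first_coords h (covar (o n) i w)))%:E)%E.
  by apply: eq_integral => w _; rewrite /F !tnth_mktuple wj wl.
rewrite E /cov -/r -/i' fineK.
  by apply: eq_integral => w _; rewrite /F !tnth_mktuple !(tnth_nth 0).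
under eq_integral do rewrite -[j : nat]/(widen_ord h' (Ordinal jr) : nat)
  -[l : nat]/(widen_ord h' (Ordinal lr) : nat) -!tnth_nth.
by apply: integrable_fin_num => //; exact: int_cross.
Qed.

Lemma cov_le (j l : nat) : `|cov j l| <= B ^+ 2.
Proof.
set r := (maxn j l).+1.
have h' : (r < p r)%N by rewrite p_gt.
have jr : (j < p r)%N by apply: leq_ltn_trans h'; rewrite ltnW// ltnS leq_maxl.
have lr : (l < p r)%N by apply: leq_ltn_trans h'; rewrite ltnW// ltnS leq_maxr.
pose i' : 'I_(3 * r) := mxvec_index group_screen (ord0 : 'I_r).
have := cov_cross i' (Ordinal jr) (Ordinal lr) => /= E.
rewrite -lee_fin -abse_EFin -E.
apply: le_trans (le_abse_integral _ _ _) _ => //.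
  by apply/measurable_EFinP; exact: measurable_funM.
apply: le_trans (_ : \int[P]_w (B ^+ 2)%:E <= _)%E.
  apply: ae_ge0_le_integral => //.
  - by apply: measurableT_comp => //; apply/measurable_EFinP; exact: measurable_funM.
  - by move=> w _; rewrite lee_fin sqr_ge0.
  - have [_ _ bj] := bounded i' (Ordinal jr); have [_ _ bl] := bounded i' (Ordinal lr).
    by apply: filterS2 bj bl => w xj xl _; rewrite /= lee_fin normrM ler_pM.
by rewrite integral_cst// [X in (_ * X)%E]probability_setT mule1.
Qed.

Definition beta_norm1 : R := \sum_(j < s) `|beta j|.

Lemma coef_norm1 n : (0 < n)%N -> \sum_j `|coef beta (p n) j 0| <= beta_norm1.
Proof.
move=> n0; rewrite (eq_bigr (fun j : 'I_(p n) => `|beta j|)) => [|j _]; last by rewrite mxE.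
rewrite (big_ord_below (F := fun j => `|beta j|) (s_le n0))// => j /beta0 ->.
by rewrite normr0.
Qed.

Definition gam (j : nat) : R := \sum_(l < s) beta l * cov l j.

Lemma pop_marginal_gam n j : (0 < n)%N -> pop_marginal (coef beta (p n)) cov j = gam j.
Proof.
move=> n0; rewrite /pop_marginal (eq_bigr (fun l : 'I_(p n) => beta l * cov l j)).
  by apply: (big_ord_below (F := fun l => beta l * cov l j) (s_le n0)) => l /beta0 ->; rewrite mul0r.
by move=> l _; rewrite mxE.
Qed.

(** The largest Chernoff parameter satisfying both t <= 1 and K t <= eta / 2. *)
Let rate_t (eta : R) := Num.min 1 (eta / 2 / exp_const sigma B beta_norm1).

Let K0 : 0 < exp_const sigma B beta_norm1.
Proof. by rewrite !mulr_gt0 ?sqrtr_gt0 ?expR_gt0. Qed.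

Let rate_tP eta : 0 < eta -> [/\ 0 < rate_t eta, rate_t eta <= 1 &
  exp_const sigma B beta_norm1 * rate_t eta <= eta / 2].
Proof.
move=> eta0; split.
- by rewrite lt_min ltr01 !divr_gt0.
- by rewrite ge_min lexx.
- by rewrite mulrC -ler_pdivlMr// ge_min lexx orbT.
Qed.

Lemma whp_entries q (eta : R) g : 0 < eta -> whp P (cst 0) (fun n w =>
  entries_close cov q eta (design (o n) g w)
    (responses (o n) g w - design (o n) g w *m coef beta (p n))).
Proof.
move=> eta0; have [t0 t1 Kt] := rate_tP eta0; set t := rate_t eta in t0 t1 Kt.
exists (fun n => (q * q + q)%:R * 2 * expR (- (eta * t / 2 * n%:R))).
  by apply: cvg_exp_rate; rewrite divr_gt0// mulr_gt0.
apply: filterS2 (nbhs_infty_gt 0) (nbhs_infty_ge q) => n n0 qn.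
have qp : (q <= p n)%N by rewrite (leq_trans qn)// ltnW// p_gt.
have [F FP FQ] := entries_close_prob (@iid n) (@splitting n) (@model n) (@bounded n)
  (@cov_cross n) n0 sigma_gt0 (coef_norm1 n0) (fun j l => cov_le j l) t0 t1 Kt g qp.
exists F => //; split; first by case: FP.
apply: le_trans FP.2 _; rewrite lee_fin /cst add0r mulrA le_eqVlt; apply/orP; left.
by apply/eqP; congr (_ * expR _); ring.
Qed.

Lemma whp_marginal (eta : R) : 0 < eta -> whp P (cst 0) (fun n w =>
  forall j : 'I_(p n), `|marginal (design (o n) group_screen w)
    (responses (o n) group_screen w) j - gam j| <= eta).
Proof.
move=> eta0; have [t0 t1 Kt] := rate_tP eta0; set t := rate_t eta in t0 t1 Kt.
exists (fun n => (p n)%:R * (2 * expR (- (eta * t / 2 * n%:R)))).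
  apply: (@cvg_union_rate _ _ c1 c2) => //; first exact: ltW.
  by rewrite divr_gt0// mulr_gt0.
apply: filterS (nbhs_infty_gt 0) => n n0.
have [F FP FQ] := marginal_close_prob (@iid n) (@splitting n) (@model n) (@bounded n)
  (@cov_cross n) n0 sigma_gt0 B_gt0 (coef_norm1 n0) (fun j l => cov_le j l) t0 t1 Kt.
exists F.
  split; first by case: FP.
  apply: le_trans FP.2 _; rewrite lee_fin /cst add0r le_eqVlt; apply/orP; left.
  by apply/eqP; congr (_ * (_ * expR _)); ring.
by move=> w nF j; rewrite -(pop_marginal_gam j n0); exact: FQ.
Qed.

Lemma measurable_design n g i j :
  measurable_fun setT (fun w => design (o n) g w i j).
Proof.
rewrite (_ : (fun w => _) = (fun z : (p n).-tuple R * R => tnth z.1 j) \o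
  (fun w => tnth (pair_data (o n) w) (mxvec_index g i))); last first.
  by apply/funext => w; rewrite design_data mxE.
apply: measurableT_comp (measurable_coord j) _.
exact: measurableT_comp (measurable_tnth _) (measurable_pair_data (@splitting n)).
Qed.

Lemma measurable_responses n g i :
  measurable_fun setT (fun w => responses (o n) g w i 0).
Proof.
rewrite (_ : (fun w => _) = (fun z : (p n).-tuple R * R => z.2) \o
  (fun w => tnth (pair_data (o n) w) (mxvec_index g i))); last first.
  by apply/funext => w; rewrite responses_data mxE.
apply: measurableT_comp; first exact: measurable_snd.
exact: measurableT_comp (measurable_tnth _) (measurable_pair_data (@splitting n)).
Qed.

(** * Spectral bounds on the population covariance *)

Section population_form.
Variables (q : nat) (v : nat -> R).

Let form := \sum_(j < q) \sum_(l < q) v j * v l * cov j l.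
Let S := \sum_(j < q) v j ^+ 2.
Let vec n : 'cV[R]_(p n) := \col_j (if (j < q)%N then v j else 0).
Let J n : {set 'I_(p n)} := [set j : 'I_(p n) | (j < q)%N]%SET.

Let vec_supp n : supported (J n) (vec n).
Proof. by move=> j; rewrite finset.inE !mxE => /negbTE ->. Qed.

Let S0 : 0 <= S. Proof. by apply: sumr_ge0 => j _; exact: sqr_ge0. Qed.

Let sqn_vec n : (q <= p n)%N -> sqn (vec n) = S.
Proof.
move=> qp; rewrite sqnE.
rewrite (eq_bigr (fun j : 'I_(p n) => (if (j < q)%N then v j else 0) ^+ 2)); last first.
  by move=> j _; rewrite mxE.
rewrite (big_ord_below (F := fun j => (if (j < q)%N then v j else 0) ^+ 2) qp).
  by apply: eq_bigr => j _; rewrite ltn_ord.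
by move=> j; rewrite ltnNge => ->; rewrite expr0n.
Qed.

Let form_vec n : (q <= p n)%N -> pop_form cov (vec n) = form.
Proof.
move=> qp; pose u j := if (j < q)%N then v j else 0.
rewrite /pop_form (eq_bigr (fun j : 'I_(p n) => \sum_(l < q) u j * u l * cov j l)).
  rewrite (big_ord_below (F := fun j => \sum_(l < q) u j * u l * cov j l) qp).
    by apply: eq_bigr => j _; apply: eq_bigr => l _; rewrite /u !ltn_ord.
  by move=> j; rewrite leqNgt => /negbTE jq; rewrite big1// => l _; rewrite /u jq !mul0r.
move=> j _; rewrite -(big_ord_below (F := fun l => u j * u l * cov j l) qp).
  by apply: eq_bigr => l _; rewrite !mxE.
by move=> l; rewrite leqNgt => /negbTE lq; rewrite /u lq mulr0 mul0r.
Qed.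

Let emp n w := n%:R^-1 * sqn (design (o n) group_screen w *m vec n).

Let measurable_emp n : measurable_fun setT (emp n).
Proof.
apply: measurable_funM => //; rewrite /sqn /dot; apply: measurable_sum => i.
have m : measurable_fun setT (fun w => (design (o n) group_screen w *m vec n) i 0).
  under eq_fun do rewrite mxE.
  by apply: measurable_sum => l; apply: measurable_funM => //; exact: measurable_design.
exact: measurable_funM.
Qed.

(** An almost sure eventual event and the closeness of the empirical form to the population form
    both have probability tending to 1, so they occur together at some n and some outcome. This
    turns (A4) into an inequality between constants. *)
Let transfer (eps : R) (E : nat -> set Omega) : 0 < eps ->
  (forall n, measurable (E n)) -> {ae P, forall w, \forall n \near \oo, E n w} ->
  exists n w, [/\ (q <= n)%N, E n w & `|emp n w - form| <= eps].
Proof.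
move=> e0 mE aeE; pose eta := eps / ((q%:R + 1) * (S + 1)).
have q1 : 0 < q%:R + 1 :> R by rewrite ltr_wpDl.
have S1 : 0 < S + 1 by rewrite ltr_wpDl.
have eta0 : 0 < eta by rewrite divr_gt0// mulr_gt0.
have nq : \forall n \near \oo, (0 < n)%N /\ (q <= n)%N.
  by apply: filterS2 (nbhs_infty_gt 0) (nbhs_infty_ge q).
have [n [w [[n0 qn] [Ec Ew]]]] := whp_ex
  (whpI0 (whp_entries q group_screen eta0) (whp_ae mE aeE)) nq.
have qp : (q <= p n)%N by rewrite (leq_trans qn)// ltnW// p_gt.
exists n, w; split=> //.
have := entries_close_form (ltW eta0) Ec (@vec_supp n).
rewrite form_vec// sqn_vec// => /le_trans; apply.
rewrite (_ : _ * _ * _ = eps * (q%:R * S) / ((q%:R + 1) * (S + 1))); last first.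
  by rewrite /eta; ring.
by rewrite ler_pdivrMr ?mulr_gt0// ler_pM2l// ler_pM// lerDl.
Qed.

Let slack (x : R) : 0 <= x -> x / (S + 1) * S <= x.
Proof.
move=> x0; rewrite mulrAC ler_pdivrMr ?ltr_wpDl//.
by rewrite ler_wpM2l// lerDl.
Qed.

Let measurable_event (A : R -> Prop) n : measurable [set x : R | A x] ->
  measurable [set w | (q <= n)%N -> A (emp n w)].
Proof.
move=> mA; case: (leqP q n) => qn.
  rewrite (_ : [set w | _] = emp n @^-1` [set x | A x]).
    exact: measurable_preimage.
  by apply/seteqP; split => w /=; [apply|].
by rewrite (_ : [set w | _] = setT)//; apply/seteqP; split.
Qed.

Lemma cov_form_le : form <= C0 * S.
Proof.
apply/ler_addgt0Pr => eps e0; have e2 : 0 < eps / 2 by rewrite divr_gt0.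
(* Strictly above C0, so that the upper limit forces the sparse eigenvalue below c eventually. Half
   of eps is spent here, the other half on the distance between the two forms. *)
pose c := C0 + eps / 2 / (S + 1).
have cS : c * S <= C0 * S + eps / 2 by rewrite /c mulrDl lerD2l slack// ltW.
have [||n [w [qn /(_ qn) Ew]]] := @transfer _ (fun n => [set w | (q <= n)%N -> emp n w <= c * S]) e2.
- move=> n; apply: (measurable_event (A := fun x => x <= c * S)).
  exact: measurable_set_le.
- have [ub _ _] := eigenvalues group_screen; apply: filterS ub => w ub.
  have cc : (C0%:E < c%:E)%E by rewrite lte_fin ltrDl divr_gt0// ltr_wpDl.
  apply: filterS2 (nbhs_infty_gt 0) (near_limn_esup ub cc) => n n0 + qn.
  rewrite lee_fin => Hn; have np := ltnW (p_gt n0).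
  apply: le_trans (sparse_eig_max_ge (M := J n) (r := n) _ _ (@vec_supp n)) _.
    by rewrite np (leq_trans (card_below _ _)).
  by rewrite sqn_vec ?ler_wpM2r// (leq_trans qn).
by rewrite ler_norml; lra.
Qed.

Lemma cov_form_ge : kappa * S <= form.
Proof.
apply/ler_addgt0Pr => eps e0; have e2 : 0 < eps / 2 by rewrite divr_gt0.
pose c := kappa - eps / 2 / (S + 1).
have cS : kappa * S - eps / 2 <= c * S by rewrite /c mulrBl lerD2l lerN2 slack// ltW.
have [||n [w [qn /(_ qn) Ew]]] := @transfer _ (fun n => [set w | (q <= n)%N -> c * S <= emp n w]) e2.
- move=> n; apply: (measurable_event (A := fun x => c * S <= x)).
  exact: measurable_set_le.
- have [_ lb _] := eigenvalues group_screen; apply: filterS lb => w lb.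
  have cc : (c%:E < kappa%:E)%E by rewrite lte_fin ltrBlDr ltrDl divr_gt0// ltr_wpDl.
  have C1i : 0 < C1^-1 by rewrite invr_gt0.
  (* Eventually C1 log n, rounded down, is at least q, so the support fits, and at most n < p n, so
     padding is possible. *)
  have rq := ln_pinfty (q%:R / C1).
  have rn := ln_le_linear C1i.
  apply: filterS2 (filterI (nbhs_infty_gt 0) (near_limn_einf lb cc)) (filterI rq rn).
  move=> n [n0 + ] [qln lnn] qn; rewrite lee_fin => Hn; have np := ltnW (p_gt n0).
  have l0 : 0 <= ln (n%:R : R) by rewrite ln_ge0// ler1n.
  have := @sparse_eig_min_le _ _ _ (design (o n) group_screen w) (J n)
    (Num.truncn (C1 * ln n%:R)) (vec n).
  rewrite sqn_vec ?(leq_trans qn)// => H; apply: (le_trans (ler_wpM2r S0 Hn)).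
  apply: H => //.
  rewrite (leq_trans (card_below _ _)); last first.
    by rewrite truncn_ge_nat ?mulr_ge0 ?(ltW C1_gt0)// mulrC -ler_pdivrMr.
  rewrite (leq_trans _ np)// truncn_le_nat.
  apply: (@le_lt_trans _ _ n%:R); last by rewrite ltr_nat.
  by rewrite mulrC -ler_pdivlMr// mulrC.
by rewrite ler_norml; lra.
Qed.

Lemma cov_form_bounds n : (q <= p n)%N ->
  kappa * sqn (vec n) <= pop_form cov (vec n) <= C0 * sqn (vec n).
Proof. by move=> qp; rewrite sqn_vec// form_vec// cov_form_ge cov_form_le. Qed.

End population_form.

(** At q = p n the support condition is void, and the bounds hold for all vectors without any
    sparsity. *)
Lemma supported_form_bounds q n (v : 'cV[R]_(p n)) : (q <= p n)%N ->
  supported [set j : 'I_(p n) | (j < q)%N]%SET v ->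
  kappa * sqn v <= pop_form cov v <= C0 * sqn v.
Proof.
move=> qp sv; pose f j := nth 0 [seq v i 0 | i <- enum 'I_(p n)] j.
have := cov_form_bounds f qp; rewrite (_ : (\col_j _) = v)//.
apply/matrixP => j i; rewrite !mxE ord1; case: ifPn => jq.
  by rewrite /f (nth_map j) ?size_enum_ord// nth_ord_enum.
by rewrite sv// finset.inE.
Qed.

Let covC j l : cov j l = cov l j.
Proof. by rewrite /cov maxnC; congr fine; apply: eq_integral => w _; rewrite mulrC. Qed.

Let gamE q j : (s <= q)%N -> gam j = \sum_(l < q) beta l * cov l j.
Proof.
move=> sq; rewrite (big_ord_below (F := fun l => beta l * cov l j) sq)//.
by move=> l /beta0 ->; rewrite mul0r.
Qed.

(* The form is nonnegative at [beta - gam / C0], where gam = Sigma beta. *)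
Lemma gam_sq_le q : (s <= q)%N ->
  \sum_(j < q) gam j ^+ 2 <= C0 ^+ 2 * \sum_(j < s) beta j ^+ 2.
Proof.
move=> sq; pose b (x y : nat -> R) := \sum_(j < q) \sum_(l < q) x j * y l * cov j l.
have bg (x : nat -> R) : b x beta = \sum_(j < q) x j * gam j.
  apply: eq_bigr => j _; rewrite (gamE _ sq) mulr_sumr.
  by apply: eq_bigr => l _; rewrite covC mulrA.
set G := \sum_(j < q) _; set b2 := \sum_(j < s) _.
have b2E : b2 = \sum_(j < q) beta j ^+ 2.
  by rewrite (big_ord_below (F := fun j => beta j ^+ 2) sq)// => j /beta0 ->; rewrite expr0n.
have ubb : b beta beta <= C0 * b2 by rewrite b2E; exact: cov_form_le.
have ugg : b gam gam <= C0 * G by exact: cov_form_le.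
have gb : b gam beta = G by rewrite bg; apply: eq_bigr => j _; rewrite expr2.
have bC : b beta gam = G.
  rewrite -gb /b exchange_big; apply: eq_bigr => j _; apply: eq_bigr => l _.
  by rewrite covC [beta _ * _]mulrC.
have : 0 <= b (fun j => beta j - C0^-1 * gam j) (fun j => beta j - C0^-1 * gam j).
  apply: le_trans (cov_form_ge _ _); rewrite mulr_ge0 ?(ltW kappa_gt0)//.
  by apply: sumr_ge0 => j _; exact: sqr_ge0.
have E a (x u : nat -> R) : b (fun j => x j - a * u j) (fun j => x j - a * u j) =
    b x x - a * b u x - a * b x u + a ^+ 2 * b u u.
  rewrite /b !mulr_sumr -!sumrB -big_split; apply: eq_bigr => j _ /=.
  rewrite !mulr_sumr -!sumrB -big_split; apply: eq_bigr => l _ /=. ring.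
rewrite E gb bC => H.
have Ci : 0 < C0^-1 by rewrite invr_gt0.
have H2 : C0^-1 ^+ 2 * b gam gam <= C0^-1 * G.
  apply: le_trans (ler_wpM2l (sqr_ge0 _) ugg) _.
  by rewrite expr2 -mulrA mulKf// gt_eqF.
have H3 : C0^-1 * G <= C0 * b2 by lra.
by move: H3; rewrite ler_pdivrMl// mulrA -expr2.
Qed.

Lemma gam_cvg0 : gam @ \oo --> (0 : R).
Proof.
have gc : cvgn (series (fun j => gam j ^+ 2)).
  apply: nondecreasing_is_cvgn.
    by apply: nondecreasing_series => n _ _; exact: sqr_ge0.
  exists (C0 ^+ 2 * \sum_(j < s) beta j ^+ 2) => _ [n _ <-].
  rewrite /series/= big_mkord; apply: le_trans (gam_sq_le (leq_maxl s n)).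
  rewrite -!(big_mkord xpredT (fun j => gam j ^+ 2)).
  rewrite (big_cat_nat (leq0n n) (leq_maxr s n))/= lerDl.
  by apply: sumr_ge0 => j _; exact: sqr_ge0.
have /cvgr_lt g0 := cvg_series_cvg_0 gc.
apply/cvgr0Pnorm_lt => e e0; have e2 : 0 < e ^+ 2 by rewrite exprn_gt0.
apply: filterS (g0 _ e2) => n.
by rewrite -[gam n ^+ 2]real_normK ?num_real// ltr_sqr ?nnegrE// ltW.
Qed.

(** * Screening, cross-validation and cleaning along the sequence *)

Section selection.
Variables (k : nat -> nat).
Hypothesis k_infty : k @ \oo --> \oo.
Hypothesis k_o : (fun n => (k n)%:R / Num.sqrt n%:R : R) @ \oo --> (0 : R).
Hypothesis gap : forall n, (0 < n)%N -> (0 < k n <= p n)%N ->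
  ((order_stat_abs (mean_marginal (o n)) (k n))%:E <
   min_abs (active_set (coef beta (p n))) (mean_marginal (o n)))%E.

Let k_le c : 0 < c -> \forall n \near \oo, (k n)%:R <= c * Num.sqrt (n%:R : R).
Proof.
move=> c0; have /cvgr_le /(_ c c0) := k_o.
apply: filterS2 (nbhs_infty_gt 0) => n n0.
by rewrite ler_pdivrMr// sqrtr_gt0 ltr0n.
Qed.

Let k_le_n : \forall n \near \oo, (k n <= n)%N.
Proof.
have := k_le ltr01; apply: filterS2 (nbhs_infty_gt 0) => n n0 H.
rewrite -(ler_nat R); apply: le_trans H _; rewrite mul1r.
have n1 : 1 <= n%:R :> R by rewrite ler1n.
rewrite -[leRHS]ger0_norm ?ler0n// -sqrtr_sqr ler_sqrt ?sqr_ge0//.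
by rewrite expr2 ler_peMl ?ler0n.
Qed.

Let k_ge m : \forall n \near \oo, (m <= k n)%N.
Proof. by have /cvgnyPge := k_infty; apply. Qed.

Let coef_active n (j : 'I_(p n)) : (j \in active_set (coef beta (p n))) = (j < s)%N.
Proof. by rewrite finset.inE mxE beta_support. Qed.

Let order_stat_ge0 q (v : 'I_q -> R) m : 0 <= order_stat_abs v m.
Proof.
rewrite /order_stat_abs; set S := sort _ _.
have [h|h] := ltnP m.-1 (size S); last by rewrite nth_default.
have := mem_nth 0 h; rewrite mem_sort => /mapP[j _ ->]; exact: normr_ge0.
Qed.

Let finite_lb r (f : nat -> R) : (forall j, (j < r)%N -> 0 < f j) ->
  exists2 m, 0 < m & forall j, (j < r)%N -> m <= f j.
Proof.
elim: r => [|r IH] H; first by exists 1.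
have [m m0 Hm] := IH (fun j jr => H j (ltnW jr)).
exists (Num.min m (f r)); first by rewrite lt_min m0 H.
move=> j; rewrite ltnS leq_eqVlt => /orP[/eqP ->|jr]; first by rewrite ge_min lexx orbT.
by rewrite ge_min Hm.
Qed.

(** An order statistic of absolute values is nonnegative, so the strict gap at one n with 0 < k_n <=
    n makes each gam_j with j in D nonzero; gam does not depend on n, and D is finite. *)
Lemma gam_lb : exists2 mu0, 0 < mu0 & forall j, (j < s)%N -> mu0 <= `|gam j|.
Proof.
have H : \forall n \near \oo, (0 < n)%N /\ (0 < k n <= n)%N.
  by apply: filterS3 (nbhs_infty_gt 0) (k_ge 1) k_le_n => n -> -> ->.
have [n [n0 /andP[k0 kn]]] := filter_ex H.
have kp : (0 < k n <= p n)%N by rewrite k0 (leq_trans kn)// ltnW// p_gt.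
have G := gap n0 kp; apply: finite_lb => j js.
have jp : (j < p n)%N by rewrite (leq_trans js)// s_le.
rewrite -lte_fin; apply: (@le_lt_trans _ _ (order_stat_abs (mean_marginal (o n)) (k n))%:E).
  by rewrite lee_fin order_stat_ge0.
apply: lt_le_trans G _; apply: ereal_inf_lbound; exists (Ordinal jp) => /=.
  by rewrite coef_active.
rewrite (mean_marginalE (@iid n) (@splitting n) (@model n) (@bounded n)
  (@cov_cross n) n0 sigma_gt0 B_gt0 (coef_norm1 n0) (fun j l => cov_le j l)).
by rewrite pop_marginal_gam.
Qed.

Lemma beta_lb : exists2 psi, 0 < psi & forall j, (j < s)%N -> psi <= `|beta j|.
Proof. by apply: finite_lb => j; rewrite -beta_support normr_gt0. Qed.

Lemma whp_selection : whp P (cst 0) (fun n w =>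
  let X1 := design (o n) group_screen w in
  let Y1 := responses (o n) group_screen w in
  let X2 := design (o n) group_validate w in
  let Y2 := responses (o n) group_validate w in
  let D := active_set (coef beta (p n)) in
  (forall lam, minimizes (admissible X1 Y1 (k n))
      (true_loss X1 Y1 (coef beta (p n))) lam -> D \subset screen X1 Y1 lam) /\
  (forall lam, minimizes (admissible X1 Y1 (k n)) (cv_loss X1 Y1 X2 Y2) lam ->
      D \subset screen X1 Y1 lam)).
Proof.
have [mu0 mu0_gt0 gam_mu] := gam_lb; have [psi psi_gt0 beta_psi] := beta_lb.
have mu2 : 0 < mu0 / 2 by rewrite divr_gt0.
have mu4 : 0 < mu0 / 4 by rewrite divr_gt0.
have [q0 _ Hq0] : \forall j \near \oo, `|gam j| < mu0 / 2.
  by have /cvgr0Pnorm_lt /(_ _ mu2) := gam_cvg0.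
(* Beyond q the marginals are below mu0 / 2, and D lies below q. *)
pose q := maxn s q0.
pose A := (10 + 8 * C0 / kappa) * (2 * q%:R / kappa).
have A0 : 0 <= A.
  by rewrite mulr_ge0// ?addr_ge0 ?divr_ge0 ?mulr_ge0// ?(ltW kappa_gt0) ?(ltW C0_gt0).
(* The two inner bounds give [small1] and [small2]; eta <= 1 allows eta^2 <= eta in the latter, and
   the summands + 1 avoid dividing by 0. *)
pose eta := Num.min 1 (Num.min (kappa / 2 / (q%:R + 1)) (kappa * psi ^+ 2 / 8 / (A + 1))).
have kp2 : 0 < kappa * psi ^+ 2 by rewrite mulr_gt0// exprn_gt0.
have q1 : 0 < q%:R + 1 :> R by rewrite ltr_wpDl.
have A1 : 0 < A + 1 by rewrite ltr_wpDl.
have eta0 : 0 < eta by rewrite !lt_min ltr01 !divr_gt0.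
have eta1 : eta <= 1 by rewrite ge_min lexx.
have small1 : q%:R * eta <= kappa / 2.
  have : eta <= kappa / 2 / (q%:R + 1) by rewrite !ge_min lexx orbT.
  rewrite ler_pdivlMr// => H; have := mulr_ge0 (ltW eta0) (ler0n R q); lra.
have small2 : (10 + 8 * C0 / kappa) * (2 * q%:R * eta ^+ 2 / kappa) < kappa * psi ^+ 2 / 4.
  have : eta <= kappa * psi ^+ 2 / 8 / (A + 1) by rewrite !ge_min lexx !orbT.
  rewrite ler_pdivlMr// => H.
  have -> : (10 + 8 * C0 / kappa) * (2 * q%:R * eta ^+ 2 / kappa) = A * eta ^+ 2.
    by rewrite /A; ring.
  have : A * eta ^+ 2 <= A * eta by rewrite ler_wpM2l// expr2 ler_piMl// ltW.
  lra.
apply: whp_mono (whpI0 (whpI0 (whp_entries q group_screen eta0)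
  (whp_entries q group_validate eta0)) (whp_marginal mu4)) _.
apply: filterS3 (nbhs_infty_gt 0) (k_ge q) (nbhs_infty_ge q) => n n0 qk qn w [[cl1 cl2] mg] X1 Y1 X2 Y2 D.
have qp : (q <= p n)%N by rewrite (leq_trans qn)// ltnW// p_gt.
set b := coef beta (p n) in D cl1 cl2 *.
(* The deterministic lemmas take the response as X b plus an error, here instantiated by Y - X b. *)
have YE (X : 'M[R]_(n, p n)) (Y : 'cV[R]_n) : X *m b + (Y - X *m b) = Y.
  by rewrite addrC subrK.
have lb (v : 'cV[R]_(p n)) : supported [set j : 'I_(p n) | (j < q)%N]%SET v ->
    kappa * sqn v <= pop_form cov v.
  by move=> sv; case/andP: (supported_form_bounds qp sv).
have ub (v : 'cV[R]_(p n)) : supported [set j : 'I_(p n) | (j < q)%N]%SET v ->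
    pop_form cov v <= C0 * sqn v.
  by move=> sv; case/andP: (supported_form_bounds qp sv).
have Dq (j : 'I_(p n)) : j \in D -> (j < q)%N.
  by rewrite coef_active => /leq_trans; apply; exact: leq_maxl.
have Dpsi (j : 'I_(p n)) : j \in D -> psi <= `|b j 0|.
  by rewrite coef_active mxE; exact: beta_psi.
have Dgam (j : 'I_(p n)) : j \in D -> mu0 <= `|gam j|.
  by rewrite coef_active; exact: gam_mu.
have gs (j : 'I_(p n)) : (q <= j)%N -> `|gam j| < mu0 / 2.
  by move=> qj; apply: Hq0 => /=; apply: leq_trans qj; exact: leq_maxr.
have mg' j : `|marginal X1 (X1 *m b + (Y1 - X1 *m b)) j - gam j| <= mu0 / 4.
  by rewrite YE; exact: mg.
split=> lam min.
  have := @true_loss_minimizer _ _ _ X1 (Y1 - X1 *m b) b cov gam q (k n) kappa C0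
    eta psi mu0.
  rewrite YE; apply => //; try exact: ltW.
have := @cv_loss_minimizer _ _ _ X1 X2 (Y1 - X1 *m b) (Y2 - X2 *m b) b cov gam q (k n)
  kappa C0 eta psi mu0.
rewrite !YE; apply => //; try exact: ltW.
Qed.

Section rates.
(** The unit of all rates: n = x^8, sqrt n = x^4, the relative error delta is x^-2, and L = 32 x
    bounds the squared quantile. *)
Let x (n : nat) : R := (n%:R : R) `^ 8^-1.

Let x_gt0 n : (0 < n)%N -> 0 < x n.
Proof. by move=> n0; rewrite powR_gt0// ltr0n. Qed.

Let x8 n : x n ^+ 8 = n%:R.
Proof.
by rewrite -powR_mulrn ?powR_ge0// -powRrM mulVf ?powRr1// pnatr_eq0.
Qed.

Let sqrtx n : Num.sqrt (n%:R : R) = x n ^+ 4.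
Proof.
rewrite -x8 (_ : x n ^+ 8 = (x n ^+ 4) ^+ 2); last by rewrite -exprM.
by rewrite sqrtr_sqr ger0_norm// exprn_ge0// powR_ge0.
Qed.

Let x_ge (A : R) : \forall n \near \oo, A <= x n.
Proof.
have [A0|A0] := leP A 0; first by apply: nearW => n; rewrite (le_trans A0)// powR_ge0.
have : \forall n \near \oo, A ^+ 8 <= n%:R :> R by exact: nbhs_infty_ger.
by apply: filterS => n; rewrite -x8 ler_pXn2r// ?nnegrE ?powR_ge0// ltW.
Qed.

Let y n := (x n)^-1.

Let y_cvg0 : y @ \oo --> (0 : R).
Proof.
apply/gtr0_cvgV0; first by apply: filterS (nbhs_infty_gt 0) => n; exact: x_gt0.
by apply/cvgryPge => A; exact: x_ge.
Qed.

Let r n := (k n)%:R / Num.sqrt n%:R : R.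

(** What [cleaning_error] adds to the level, with the factor alpha <= 1 dropped from its first part,
    written in y = 1 / x and r = k_n / sqrt n. *)
Let excess (C2 C4 : R) n := (64 * y n + y n ^+ 2) * expR (32 * y n + 3 / 2) +
  (r n ^+ 2 * C2 + (2 * r n * y n ^+ 2 + C4 * y n ^+ 4)).

Let excess_cvg0 C2 C4 : excess C2 C4 @ \oo --> (0 : R).
Proof.
have y2 : (fun n => y n ^+ 2) @ \oo --> (0 : R).
  by rewrite -[X in _ --> X](mulr0 0); apply: cvgM.
have r2 : (fun n => r n ^+ 2) @ \oo --> (0 : R).
  by rewrite -[X in _ --> X](mulr0 0); apply: cvgM.
have cy c : (fun n => c * y n) @ \oo --> (0 : R).
  by rewrite -[X in _ --> X](mulr0 c); apply: cvgM => //; exact: cvg_cst.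
rewrite -[X in _ --> X]addr0; apply: cvgD.
  rewrite -[X in _ --> X](mul0r (expR (0 + 3 / 2))); apply: cvgM.
    by rewrite -[X in _ --> X]addr0; exact: cvgD.
  apply: continuous_cvg; first exact: continuous_expR.
  by apply: cvgD => //; exact: cvg_cst.
rewrite -[X in _ --> X]addr0; apply: cvgD.
  by rewrite -[X in _ --> X](mul0r C2); apply: cvgM => //; exact: cvg_cst.
rewrite -[X in _ --> X]addr0; apply: cvgD.
  rewrite -[X in _ --> X](mulr0 (2 * 0)); apply: cvgM => //.
  by apply: cvgM => //; exact: cvg_cst.
rewrite -[X in _ --> X](mulr0 C4); apply: cvgM; first exact: cvg_cst.
rewrite (_ : (fun n => y n ^+ 4) = (fun n => y n ^+ 2 * y n ^+ 2)).
  by rewrite -[X in _ --> X](mulr0 0); apply: cvgM.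
by apply/funext => n; rewrite -exprD.
Qed.

(** The lower bound alpha_n >= 1 / sqrt n holds eventually both for a fixed level and for a level
    with sqrt n alpha_n tending to infinity, so both regimes are treated at once. *)
Lemma whp_clean (alpha : nat -> R) : (forall n, 0 < alpha n < 1) ->
  (\forall n \near \oo, 1 <= Num.sqrt n%:R * alpha n) ->
  whp P alpha (fun n w =>
    let X1 := design (o n) group_screen w in
    let Y1 := responses (o n) group_screen w in
    let D := active_set (coef beta (p n)) in
    forall lam, minimizes (admissible X1 Y1 (k n)) (cv_loss X1 Y1
        (design (o n) group_validate w) (responses (o n) group_validate w)) lam ->
      D \subset screen X1 Y1 lam ->
      clean (design (o n) group_clean w) (responses (o n) group_clean w)
        (screen X1 Y1 lam) (alpha n) = D).
Proof.
move=> alpha01 alpha_lb; have [psi psi_gt0 beta_psi] := beta_lb.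
pose K := exp_const sigma B beta_norm1.
exists (excess (8 * expR K / (kappa ^+ 2 / 4)) (8 * 16 ^+ 2 * expR K)).
  exact: excess_cvg0.
have kp2 : 0 < psi ^+ 2 * kappa by rewrite mulr_gt0// exprn_gt0.
have khalf : \forall n \near \oo, (k n)%:R <= 2^-1 * Num.sqrt (n%:R : R).
  by apply: k_le; rewrite invr_gt0.
have big_x : \forall n \near \oo, 2 <= x n /\
    9 * sigma ^+ 2 * 64 / (psi ^+ 2 * kappa) + 1 <= x n.
  by apply: filterI; exact: x_ge.
apply: filterS3 (filterI (nbhs_infty_gt 0) alpha_lb) khalf big_x.
move=> n [n0 al] kh [x2 xb].
have x0 : 0 < x n by exact: x_gt0.
have y0 : 0 < y n by rewrite invr_gt0.
have yx : y n * x n = 1 by rewrite mulVf// gt_eqF.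
have x1 : 1 <= x n by lra.
have np := ltnW (p_gt n0).
have kn : (2 * k n <= n)%N.
  rewrite -(ler_nat R) natrM; apply: (@le_trans _ _ (x n ^+ 4)); first by rewrite -sqrtx; lra.
  by rewrite -(x8 n) ler_weXn2l.
have d01 : 0 < y n ^+ 2 < 1.
  rewrite exprn_gt0//= exprVn invf_lt1 ?exprn_gt0//.
  by rewrite exprn_egt1//; lra.
have L0 : 0 <= 32 * x n by rewrite mulr_ge0// ltW.
(* As exp x >= (1 + x / 2)^2 >= 2 x, exp (8 x) is at least 2^8 x^8, and alpha x^4 >= 1 leaves at
   least 2^8 x^4, whereas 4 k_n <= 2 x^4. *)
have L_ub : 4 * (k n)%:R <= alpha n * expR (32 * x n / 4).
  have e8 : (2 * x n) ^+ 8 <= expR (32 * x n / 4).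
    rewrite (_ : 32 * x n / 4 = 8%:R * x n); last by field.
    rewrite expRM_natl ler_pXn2r ?nnegrE ?expR_ge0 ?mulr_ge0 ?(ltW x0)//.
    have h := expR_ge1Dx (x n / 2); have h2 : 0 <= 1 + x n / 2 by lra.
    have := ler_pM h2 h2 h h; rewrite -expRD -splitr.
    have := sqr_ge0 (1 - x n / 2); nra.
  apply: le_trans (ler_wpM2l (ltW (proj1 (andP (alpha01 n)))) e8).
  have x40 : 0 < x n ^+ 4 by rewrite exprn_gt0.
  rewrite -(ler_pM2l x40); rewrite sqrtx in al kh.
  apply: (@le_trans _ _ (x n ^+ 4 * (2 * x n ^+ 4))).
    by rewrite ler_wpM2l ?(ltW x40)//; lra.
  rewrite mulrA exprMn (_ : x n ^+ 8 = x n ^+ 4 * x n ^+ 4); last by rewrite -exprD.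
  set z := x n ^+ 4 in x40 al *.
  have zz0 : 0 <= z * z by rewrite mulr_ge0// ltW.
  apply: (@le_trans _ _ (2 ^+ 8 * (z * z))).
    rewrite (_ : z * 2 * z = 2 * (z * z)); last by ring.
    apply: ler_wpM2r => //; rewrite -[X in X <= _]expr1 ler_weXn2l// ler1n//.
  rewrite [leRHS]mulrA; apply: ler_peMl => //.
  by apply: mulr_ge0 => //; exact: exprn_ge0.
have L_small : 9 * sigma ^+ 2 * (32 * x n) < psi ^+ 2 * (n%:R * (kappa / 2)).
  have : 9 * sigma ^+ 2 * 64 / (psi ^+ 2 * kappa) < x n by lra.
  rewrite ltr_pdivrMr// => H; rewrite -(x8 n).
  have h1 : 9 * sigma ^+ 2 * 64 * x n < x n * (psi ^+ 2 * kappa) * x n by rewrite ltr_pM2r.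
  have h2 : x n ^+ 2 * (psi ^+ 2 * kappa) <= x n ^+ 8 * (psi ^+ 2 * kappa).
    by rewrite ler_wpM2r ?(ltW kp2)// ler_weXn2l.
  set z := x n ^+ 8 in h2 *; rewrite expr2 in h2; lra.
have lb (v : 'cV[R]_(p n)) : kappa * sqn v <= pop_form cov v.
  have [|//] := andP (@supported_form_bounds (p n) n v (leqnn _) _).
  by move=> j; rewrite finset.inE ltn_ord.
have Dpsi (j : 'I_(p n)) : j \in active_set (coef beta (p n)) ->
    psi <= `|coef beta (p n) j 0|.
  by rewrite coef_active mxE; exact: beta_psi.
have rank g : {ae P, forall w, 0 < sparse_eig_min (design (o n) g w) n}.
  by have [_ _ /(_ n n0)] := eigenvalues g.
have [mF PF] := cleaning_prob (@iid n) (@splitting n) (@model n) (@bounded n)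
  (@cov_cross n) rank n0 np sigma_gt0 (coef_norm1 n0) (fun j l => cov_le j l)
  kappa_gt0 lb psi_gt0 Dpsi kn (alpha01 n) d01 L0 L_ub L_small.
exists [set w | bad_cleaning (k n) (coef beta (p n)) (alpha n) (pair_data (o n) w)].
  split=> //; apply: le_trans PF _; rewrite lee_fin /cleaning_error /excess -/K.
  have xE : x n = (y n)^-1 by rewrite invrK.
  have yn0 : y n != 0 by rewrite gt_eqF.
  have -> : (2 * (32 * x n) + 1) * y n ^+ 2 = 64 * y n + y n ^+ 2.
    by rewrite xE; field.
  have -> : 32 * x n * y n ^+ 2 = 32 * y n by rewrite xE; field.
  set E := _ * expR _; have E0 : 0 <= E.
    by rewrite mulr_ge0 ?expR_ge0// addr_ge0 ?sqr_ge0// mulr_ge0// ltW.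
  have -> : (k n * k n)%:R * (8 * expR K / n%:R) / (kappa ^+ 2 / 4) =
      r n ^+ 2 * (8 * expR K / (kappa ^+ 2 / 4)).
    rewrite /r sqrtx -(x8 n) xE natrM; field.
    by rewrite yn0 gt_eqF.
  have -> : 2 * (k n)%:R / (n%:R * y n ^+ 2) = 2 * r n * y n ^+ 2.
    by rewrite /r sqrtx -(x8 n) xE; field.
  have -> : 8 * 16 ^+ 2 * expR K / (n%:R * (y n ^+ 2) ^+ 2) =
      8 * 16 ^+ 2 * expR K * y n ^+ 4.
    by rewrite -(x8 n) xE -!mulrA; congr (_ * (_ * (_ * _))); field.
  rewrite mulrDr mulr1 -addrA lerD2l lerD2r.
  by rewrite ler_piMl//; case/andP: (alpha01 n) => _ /ltW.
move=> w nF X1 Y1 D lam min DM; apply: contrapT => NE; apply: nF.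
exists (screen X1 Y1 lam); rewrite /optimal_of -!design_data -!responses_data.
by split; [exact: minimizer_optimal|].
Qed.

End rates.

End selection.

End sequence.

(** * From exact recovery to the five conclusions *)

Section random_selection.
Context {d : measure_display} (T : measurableType d) (R : realType) (n p : nat).
Variables (X X' : T -> 'M[R]_(n, p)) (Y Y' : T -> 'cV[R]_n) (lam : T -> R).
Hypotheses (mX : measurable_mx X) (mY : measurable_mx Y)
  (mX' : measurable_mx X') (mY' : measurable_mx Y') (mlam : measurable_fun setT lam).

Lemma measurable_screen S : measurable [set t | screen (X t) (Y t) (lam t) = S].
Proof.
rewrite (_ : [set t | _] = [set t | forall j,
    (lam t <= `|marginal (X t) (Y t) j|) = (j \in S)]); last first.
  apply/seteqP; split => t /= => [<- j|H]; first by rewrite finset.inE.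
  by apply/setP => j; rewrite finset.inE H.
apply: measurable_forall => j.
have mm : measurable_fun setT (fun t => `|marginal (X t) (Y t) j|).
  by apply: measurableT_comp => //; exact: measurable_marginal.
case: (j \in S).
  exact: measurable_set_le.
rewrite (_ : (fun t => _) = [set t | `|marginal (X t) (Y t) j| < lam t]).
  exact: measurable_set_lt.
by apply/funext => t /=; rewrite ltNge; apply/propext; split => [->|/negbTE].
Qed.

(** Both selected sets take finitely many values, so every property Q of the pair is a finite union
    of measurable events. *)
Lemma measurable_selection (Q : {set 'I_p} -> {set 'I_p} -> Prop) (alpha : R) :
  measurable [set t | Q (screen (X t) (Y t) (lam t))
    (clean (X' t) (Y' t) (screen (X t) (Y t) (lam t)) alpha)].
Proof.
rewrite (_ : [set t | _] = [set t | exists M, exists S,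
    Q M S /\ (screen (X t) (Y t) (lam t) = M /\ clean (X' t) (Y' t) M alpha = S)]); last first.
  apply/seteqP; split => t /=; last by move=> [M [S [QMS [-> ->]]]].
  by move=> Qt; exists (screen (X t) (Y t) (lam t)); eexists; split; first exact: Qt.
apply: measurable_exists => M; apply: measurable_exists => S.
have [QMS|nQ] := pselect (Q M S); last first.
  by rewrite (_ : (fun t => _) = set0)//; apply/seteqP; split => t // [].
rewrite (_ : (fun t => _) = [set t | screen (X t) (Y t) (lam t) = M] `&`
  [set t | clean (X' t) (Y' t) M alpha = S]).
  by apply: measurableI; [exact: measurable_screen|exact: measurable_clean].
by apply/seteqP; split => t /=; [case|].
Qed.

End random_selection.

Lemma whp_cvg0 d (Omega : measurableType d) (R : realType) (P : probability Omega R)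
    (a : nat -> R) Q : a @ \oo --> (0 : R) -> whp P a Q -> whp P (cst 0) Q.
Proof.
move=> a0 [b b0 H]; exists (fun n => a n + b n).
  by rewrite -[0]addr0; exact: cvgD.
by apply: filterS H => n; rewrite /cst add0r.
Qed.

Lemma sqrt_mul_infty (R : realType) (a : R) : 0 < a ->
  \forall n \near \oo, 1 <= Num.sqrt (n%:R : R) * a.
Proof.
move=> a0; have : \forall n \near \oo, a^-1 ^+ 2 <= n%:R :> R.
  exact: nbhs_infty_ger.
apply: filterS => n H; rewrite -ler_pdivrMr// mul1r.
by rewrite -[leLHS]ger0_norm ?invr_ge0 ?(ltW a0)// -sqrtr_sqr ler_sqrt.
Qed.

Theorem theorem4p6 (d : measure_display) (Omega : measurableType d)
    (R : realType) (P : probability Omega R)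
    (p : nat -> nat) (s : nat) (beta : nat -> R) (sigma : R)
    (o : forall n, observations P n (p n))
    (c1 c2 C0 C1 kappa B : R)
    (p_gt : forall n, (0 < n)%N -> (n < p n)%N)
    (iid : forall n, iid_observations (o n))
    (splitting : forall n, random_split (o n))
    (only_dimension_varies : consistent_covariates o)
    (sigma_gt0 : 0 < sigma)
    (model : forall n, linear_model (o n) (coef beta (p n)) sigma)
    (p_infty : p @ \oo --> \oo)
    (c1_gt0 : 0 < c1) (c2_ge0 : 0 <= c2) (c2_lt1 : c2 < 1)
    (p_le : forall n, (0 < n)%N -> (p n)%:R <= c1 * expR (n%:R `^ c2))
    (beta_support : forall j, (beta j != 0) = (j < s)%N)
    (s_le : forall n, (0 < n)%N -> (s <= p n)%N)
    (psi_gt0 : forall n, (0 < n)%N ->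
       (0 < min_abs (active_set (coef beta (p n)))
                   (fun j : 'I_(p n) => beta j))%E)
    (C0_gt0 : 0 < C0) (C1_gt0 : 0 < C1) (kappa_gt0 : 0 < kappa)
    (eigenvalues : sparse_eigenvalues o C0 C1 kappa)
    (B_gt0 : 0 < B)
    (bounded : forall n, bounded_standardized (o n) B)
    (k : nat -> nat)
    (k_infty : k @ \oo --> \oo)
    (k_o : (fun n => (k n)%:R / Num.sqrt n%:R : R) @ \oo --> (0 : R))
    (gap : forall n, (0 < n)%N -> (0 < k n <= p n)%N ->
       ((order_stat_abs (mean_marginal (o n)) (k n))%:E <
        min_abs (active_set (coef beta (p n))) (mean_marginal (o n)))%E)
    (lambda_star lambda_hat : nat -> {RV P >-> R}) :
  let X g (n : nat) w := design (o n) g w in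
  let Y g (n : nat) w := responses (o n) g w in
  let Sn (n : nat) w lambda :=
    screen (X group_screen n w) (Y group_screen n w) lambda in
  let Lambda (n : nat) w :=
    admissible (X group_screen n w) (Y group_screen n w) (k n) in
  let L (n : nat) w :=
    true_loss (X group_screen n w) (Y group_screen n w) (coef beta (p n)) in
  let Lhat (n : nat) w :=
    cv_loss (X group_screen n w) (Y group_screen n w)
            (X group_validate n w) (Y group_validate n w) in
  let Shat (n : nat) w := Sn n w (lambda_hat n w) in
  let Dhat alpha (n : nat) w :=
    clean (X group_clean n w) (Y group_clean n w) (Shat n w) alpha in
  let D (n : nat) := active_set (coef beta (p n)) in
  (forall n w, minimizes (Lambda n w) (L n w) (lambda_star n w)) ->
  (forall n w, minimizes (Lambda n w) (Lhat n w) (lambda_hat n w)) ->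
  [/\ (fun n => P [set w | D n \subset Sn n w (lambda_star n w)]) @ \oo
        --> 1%E,
      (fun n => P [set w | D n \subset Shat n w]) @ \oo
        --> 1%E,
      forall alpha : R, 0 < alpha < 1 ->
        (limn_esup (fun n =>
           P [set w | (~: D n :&: Dhat alpha n w)%SET != finset.set0])
         <= alpha%:E)%E,
      forall alpha : nat -> R, (forall n, 0 < alpha n < 1) ->
        alpha @ \oo --> (0 : R) ->
        (fun n => Num.sqrt n%:R * alpha n) @ \oo --> +oo ->
        (fun n => P [set w | Dhat (alpha n) n w = D n]) @ \oo --> 1%E &
      forall alpha : R, 0 < alpha < 1 ->
        ((1 - alpha)%:E <= limn_einf (fun n =>
           P [set w | (Dhat alpha n w \subset D n) /\
                      (D n \subset Shat n w)]))%E].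
Proof.
move=> X Y Sn Lambda L Lhat Shat Dhat D star_min hat_min.
have sel := whp_selection p_gt iid splitting only_dimension_varies sigma_gt0 model
  c1_gt0 c2_ge0 c2_lt1 p_le beta_support s_le C0_gt0 C1_gt0 kappa_gt0 eigenvalues
  B_gt0 bounded k_infty k_o gap.
have cln := whp_clean p_gt iid splitting only_dimension_varies sigma_gt0 model
  beta_support s_le C1_gt0 kappa_gt0 eigenvalues
  bounded k_o.
have mX g n : measurable_mx (X g n) by move=> i j; exact: measurable_design.
have mY g n : measurable_mx (Y g n).
  by move=> i j; rewrite ord1; exact: measurable_responses.
have msel n (lam : {RV P >-> R}) (Q : {set 'I_(p n)} -> {set 'I_(p n)} -> Prop) alpha :
    measurable [set w | Q (Sn n w (lam w))
    (clean (X group_clean n w) (Y group_clean n w) (Sn n w (lam w)) alpha)].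
  exact: measurable_selection.
have mD n (lam : {RV P >-> R}) : measurable [set w | D n \subset Sn n w (lam w)].
  exact: (msel n lam (fun M _ => D n \subset M) 0).
(* Screening keeps D and cleaning returns exactly D, up to probability alpha_n + o(1). Conclusions 3
   to 5 are all consequences of this one event. *)
have both (alpha : nat -> R) : (forall n, 0 < alpha n < 1) ->
    (\forall n \near \oo, 1 <= Num.sqrt n%:R * alpha n) ->
    whp P alpha (fun n w => D n \subset Shat n w /\ Dhat (alpha n) n w = D n).
  move=> a01 al; apply: whp_mono (whpI0 (cln alpha a01 al) sel) _.
  apply: nearW => n w [H1 [_ H2]]; have DS := H2 _ (hat_min n w).
  by split=> //; exact: H1 (hat_min n w) DS.
have mboth n alpha (Q : {set 'I_(p n)} -> {set 'I_(p n)} -> Prop) :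
    measurable [set w | Q (Shat n w) (Dhat alpha n w)].
  exact: msel.
split.
- apply: cvg_prob1 => [n|]; first exact: mD.
  by apply: whp_mono sel _; apply: nearW => n w [H _]; exact: H (star_min n w).
- apply: cvg_prob1 => [n|]; first exact: mD.
  by apply: whp_mono sel _; apply: nearW => n w [_ H]; exact: H (hat_min n w).
- move=> alpha a01; have [a0 a1] := andP a01.
  have W := both (cst alpha) (fun=> a01) (sqrt_mul_infty a0).
  have mA n : measurable [set w | ~ (~: D n :&: Dhat alpha n w)%SET != finset.set0].
    exact: (mboth n alpha (fun _ S => ~ (~: D n :&: S)%SET != finset.set0)).
  have wA : whp P (cst alpha)
      (fun n => [set w | ~ (~: D n :&: Dhat alpha n w)%SET != finset.set0]).
    apply: whp_mono W _; apply: nearW => n w [_ E] /=; rewrite [Dhat _ _ _]E.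
    by rewrite finset.setIC finset.setICr eqxx.
  have [b b0 H] := prob_whp mA wA.
  apply/lee_addgt0Pr => e e0; apply: limn_esup_near_le.
  have /cvgr_le /(_ e e0) be := b0.
  apply: filterS2 H be => n H be; rewrite -EFinD.
  apply: le_trans (_ : (alpha + b n)%:E <= _)%E; last by rewrite lee_fin lerD2l.
  apply: le_trans H; rewrite le_eqVlt; apply/orP; left; apply/eqP; congr (P _).
  by apply/funext => w /=; apply/propext; split=> [E nE|/contrapT].
- move=> alpha a01 a0 ainf; apply: cvg_prob1 => [n|].
    exact: (mboth n (alpha n) (fun _ S => S = D n)).
  apply: (whp_cvg0 a0); apply: whp_mono (both alpha a01 _) _.
    by have /cvgryPge /(_ 1) := ainf.
  by apply: nearW => n w [].
- move=> alpha a01; have [a0 a1] := andP a01.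
  have W := both (cst alpha) (fun=> a01) (sqrt_mul_infty a0).
  have mA n : measurable [set w | (Dhat alpha n w \subset D n) /\ (D n \subset Shat n w)].
    exact: (mboth n alpha (fun M S => (S \subset D n) /\ (D n \subset M))).
  have wA : whp P (cst alpha)
      (fun n => [set w | (Dhat alpha n w \subset D n) /\ (D n \subset Shat n w)]).
    by apply: whp_mono W _; apply: nearW => n w [? E]; split=> //=; rewrite [Dhat _ _ _]E.
  have [b b0 H] := prob_whp mA wA.
  apply/lee_addgt0Pr => e e0; rewrite -leeBlDr//; apply: limn_einf_near_ge.
  have /cvgr_le /(_ e e0) be := b0.
  apply: filterS2 H be => n; rewrite probability_setC// /cst.
  have /fineK E := fin_num_measure P _ (mA n); rewrite -E -!EFinB !lee_fin; lra.
Qed.
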